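(* Let $G\subset \mathrm{SL}_3(\mathbb{C})$ be a finite abelian subgroup. The chamber $\mathfrak{C}_0$ of $G\text{-Hilb}\,\mathbb{A}^3$ has no Type II walls.
   Context: $\Theta=\{\theta\in\mathrm{Hom}_{\mathbb{Z}}(\mathbb{Z}^{\mathrm{Irr}(G)},\mathbb{Q}):\sum_\rho\theta(\rho)=0\}$; $\theta$ is extended additively to $\mathrm{Rep}(G)$. A $G$-constellation is a $G$-equivariant coherent sheaf $F$ on $\mathbb{A}^3$ with $H^0(F)\cong\mathbb{C}[G]$ (equivalently a representation of the McKay quiver with relations of dimension vector $(1,\dots,1)$). It is $\theta$-stable if $\theta(H^0(E))>0$ for all proper nonzero equivariant subsheaves $E$; $\theta$ is generic if semistability implies stability. $\Theta$ has a wall-and-chamber structure such that the moduli space $\mathcal{M}_\theta$ of $\theta$-stable $G$-constellations is constant on chambers; $\mathfrak{C}_0$ is the chamber containing all $\theta$ with $\theta(\rho)>0$ for every nontrivial $\rho$. Its moduli space $\mathcal{M}_{\mathfrak{C}_0}$ is $G\text{-Hilb}\,\mathbb{A}^3$, the moduli space of $G$-clusters ($G$-invariant zero-dimensional subschemes $Z\subset\mathbb{A}^3$ with $H^0(\mathcal{O}_Z)\cong\mathbb{C}[G]$), a crepant resolution of $\mathbb{A}^3/G$. With universal cluster $\mathcal{Z}$ and projection $\pi$ to $G\text{-Hilb}\,\mathbb{A}^3$, $\pi_*\mathcal{O}_{\mathcal{Z}}=\bigoplus_\rho\mathcal{R}_\rho$ is the decomposition into tautological line bundles. A wall of $\mathfrak{C}_0$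 is a codimension-one face of its closure. For generic $\theta_0$ on a wall, the nef $\mathbb{Q}$-line bundle $\bigotimes_\rho\mathcal{R}_\rho^{\theta_0(\rho)}$ defines a contraction of $\mathcal{M}_{\mathfrak{C}_0}$; the wall has Type II if this contraction contracts a divisor to a point. *)

(* Defs.v *)
From HB Require Import structures.
From Stdlib Require Import Relation_Operators.
From mathcomp Require Import all_boot all_order all_algebra all_fingroup.
From mathcomp Require Import mxrepresentation.
From mathcomp Require Import reals complex mpoly.

Set Implicit Arguments.
Unset Strict Implicit.
Unset Printing Implicit Defensive.

Import Order.TTheory GRing.Theory Num.Theory.
Local Open Scope ring_scope.

(* Representations follow the row-vector convention of mxrepresentation: g acts
   on 'rV_n by v |-> v *m rG g, and submodules are row spaces of matrices. *)

Section GHilb.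

Variables (R : realType) (gT : finGroupType) (G : {group gT}).
Local Notation C := R[i].

Definition Irr : irrType C G := DecSocleType (regular_repr C G).

(** * Stability parameters *)

Definition param := {ffun Irr -> rat^o}.

Definition in_Theta (theta : param) : Prop := \sum_(i : Irr) theta i = 0.

(* Multiplicity of the irreducible representation i in the submodule W of C[G];
   i also denotes its own isotypic component, a submodule of C[G]. *)
Definition mult (W : 'M[C]_#|G|) (i : Irr) : nat :=
  (\rank (W :&: i)%MS %/ irr_degree i)%N.

Definition theta_of (theta : param) (W : 'M[C]_#|G|) : rat :=
  \sum_(i : Irr) theta i *+ mult W i.

(** * G-constellations *)

(* A G-equivariant coherent sheaf on the affine space A^3 with H^0 = C[G] is a
   G-equivariant C[x_0, x_1, x_2]-module structure on C[G]; X j is the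
   multiplication by the coordinate function x_j. *)
Definition rep := {ffun 'I_3 -> 'M[C]_#|G|}.

(* G acts on functions by (f . g)(v) = f(v . g^-1), so that
   x_j . g = \sum_k rG g^-1 k j x_k; equivariance of the module structure is
   (x_j m) . g = (x_j . g) (m . g). *)
Definition constellation (rG : mx_representation C G 3) (X : rep) : Prop :=
  (forall j k, X j *m X k = X k *m X j) /\
  (forall g, g \in G -> forall j,
     X j *m regular_repr C G g =
     \sum_k rG g^-1%g k j *: (regular_repr C G g *m X k)).

Definition subsheaf (X : rep) (W : 'M[C]_#|G|) : Prop :=
  mxmodule (regular_repr C G) W /\ (forall j, stablemx W (X j)).

Definition stable (rG : mx_representation C G 3) (theta : param) (X : rep) :=
  constellation rG X /\
  forall W, subsheaf X W -> W != 0 -> ~~ row_full W -> 0 < theta_of theta W.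

Definition semistable (rG : mx_representation C G 3) (theta : param)
    (X : rep) :=
  constellation rG X /\
  forall W, subsheaf X W -> W != 0 -> ~~ row_full W -> 0 <= theta_of theta W.

Definition generic (rG : mx_representation C G 3) (theta : param) : Prop :=
  in_Theta theta /\ forall X, semistable rG theta X -> stable rG theta X.

(** * The chamber of G-Hilb and its walls *)

(* Chambers are the connected components of the generic locus. As Theta is a
   rational vector space, connectedness means connectedness by polygonal paths;
   a rational segment meeting a wall properly does so at a rational point. *)
Definition generic_segment (rG : mx_representation C G 3)
    (theta theta' : param) : Prop :=
  forall t : rat, 0 <= t <= 1 -> generic rG ((1 - t) *: theta + t *: theta').

Definition same_chamber (rG : mx_representation C G 3) (theta theta' : param) :=
  [/\ generic rG theta, generic rG theta' &
      clos_refl_trans param (generic_segment rG) theta theta'].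

Definition positive (theta : param) : Prop :=
  in_Theta theta /\ forall i : Irr, i != principal_comp Irr -> 0 < theta i.

Definition chamber0 (rG : mx_representation C G 3) (theta : param) : Prop :=
  exists2 theta0, positive theta0 & same_chamber rG theta0 theta.

Definition closure0 (rG : mx_representation C G 3) (theta : param) : Prop :=
  in_Theta theta /\
  forall eps : rat, 0 < eps ->
    exists2 theta', chamber0 rG theta' &
      forall i, `|theta i - theta' i : rat| < eps.

Definition face (K F : param -> Prop) : Prop :=
  exists a : param,
    (forall theta, K theta -> 0 <= \sum_i (a i * theta i : rat)) /\
    (forall theta, F theta <-> K theta /\ \sum_i (a i * theta i : rat) = 0).

(* Dimension of a cone, that is, of its linear span. *)
Definition cone_dim (F : param -> Prop) (d : nat) : Prop :=
  (exists s : seq param,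
     [/\ forall theta, theta \in s -> F theta, free s & size s = d]) /\
  (forall s : seq param,
     (forall theta, theta \in s -> F theta) -> free s -> (size s <= d)%N).

Definition wall0 (rG : mx_representation C G 3) (F : param -> Prop) : Prop :=
  face (closure0 rG) F /\
  exists2 d, cone_dim F d & cone_dim (closure0 rG) d.+1.

(* The generic points of a wall are those of its relative interior. *)
Definition generic_on (F : param -> Prop) (theta0 : param) : Prop :=
  F theta0 /\
  forall theta, F theta ->
    exists2 eps : rat, 0 < eps & F (theta0 + eps *: (theta0 - theta)).

(** * The moduli space *)

(* The closed points of the moduli space of the chamber are the orbits, in the
   locus stable0 below, of the torus of G-automorphisms of C[G] (for abelian G,
   one nonzero scalar for each irreducible representation). *)
Definition stable0 (rG : mx_representation C G 3) (X : rep) : Prop :=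
  forall theta, chamber0 rG theta -> stable rG theta X.

Definition in_torus (c : {ffun Irr -> C}) : Prop := forall i, c i != 0.

Definition torus_mx (c : {ffun Irr -> C}) : 'M[C]_#|G| :=
  \sum_i c i *: Wedderburn_id i.

(* The module structure transported along v |-> v *m torus_mx c. *)
Definition torus_act (c : {ffun Irr -> C}) (X : rep) : rep :=
  [ffun j => invmx (torus_mx c) *m X j *m torus_mx c].

Definition ncoord := #|{: 'I_3 * 'I_#|G| * 'I_#|G|}|.

Definition eval (p : {mpoly C[ncoord]}) (X : rep) : C :=
  p.@[fun k : 'I_ncoord =>
        let: (j, a, b) := (enum_val k : 'I_3 * 'I_#|G| * 'I_#|G|) in X j a b].

(* Zariski closed subsets of the moduli space, given by their inverse images in
   the stable locus. *)
Definition closed (rG : mx_representation C G 3) (D : rep -> Prop) : Prop :=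
  (exists P : {mpoly C[ncoord]} -> Prop,
     forall X, D X <-> stable0 rG X /\ forall p, P p -> eval p X = 0) /\
  (forall c X, in_torus c -> D X -> D (torus_act c X)).

Definition subset (D E : rep -> Prop) : Prop := forall X, D X -> E X.

Definition irreducible (rG : mx_representation C G 3) (D : rep -> Prop) :=
  [/\ closed rG D, exists X, D X &
      forall A B, closed rG A -> closed rG B ->
        (forall X, D X -> A X \/ B X) -> subset D A \/ subset D B].

Definition proper_subset (D E : rep -> Prop) : Prop :=
  subset D E /\ ~ subset E D.

(* Irreducible closed subsets of codimension one. *)
Definition prime_divisor (rG : mx_representation C G 3) (D : rep -> Prop) :=
  [/\ irreducible rG D,
      exists2 E, irreducible rG E & proper_subset D E &
      ~ exists E1 E2, [/\ irreducible rG E1, irreducible rG E2,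
                          proper_subset D E1 & proper_subset E1 E2]].

(** * Tautological bundles and the contraction of a wall *)

(* The moduli space, hence the stable locus, is smooth, in particular reduced:
   regular functions are determined by their values at closed points. *)
Definition regular (rG : mx_representation C G 3) (f : rep -> C) : Prop :=
  forall X, stable0 rG X ->
    exists p q : {mpoly C[ncoord]}, eval q X != 0 /\
      forall Y, stable0 rG Y -> eval q Y != 0 -> f Y = eval p Y / eval q Y.

(* The tautological line bundle of the irreducible representation i is the
   i-isotypic part of the trivial bundle C[G] over the stable locus, descended
   along (X, v) ~ (torus_act c X, c i *: v). So a section of the tensor product
   of the w i-th powers of these bundles is a regular function f on the stable
   locus, of weight w. *)
Definition taut_section (rG : mx_representation C G 3) (w : Irr -> int)
    (f : rep -> C) : Prop :=
  regular rG f /\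
  forall c X, in_torus c -> stable0 rG X ->
    f (torus_act c X) = (\prod_i c i ^ w i) * f X.

(* The contraction maps a point to the homogeneous prime ideal of the sections
   vanishing at this point, in Proj of the ring of sections of the powers of the
   Q-line bundle with exponents theta0 (those m-th powers, m >= 0, such that
   m theta0 is integral; m = 0 gives the functions on the moduli space). *)
Definition same_image (rG : mx_representation C G 3) (theta0 : param)
    (X Y : rep) : Prop :=
  forall (m : nat) (w : Irr -> int), (forall i, (w i)%:~R = theta0 i *+ m) ->
    forall f, taut_section rG w f -> (f X = 0 <-> f Y = 0).

Definition contracted_to_point (rG : mx_representation C G 3) (theta0 : param)
    (D : rep -> Prop) : Prop :=
  forall X Y, D X -> D Y -> same_image rG theta0 X Y.

Definition typeII (rG : mx_representation C G 3) (F : param -> Prop) : Prop :=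
  exists2 theta0, generic_on F theta0 &
    exists2 D, prime_divisor rG D & contracted_to_point rG theta0 D.

End GHilb.

(* Main.v *)
(** Diagonalising G turns G-constellations into representations of the McKay quiver, and
    stability for the chamber of G-Hilb becomes generation by the trivial character.  A generic
    point of a wall vanishes on the dimension vector of at most one submodule, always supported
    on the same set S of characters.  If the wall contracts D to a point, a flow argument on the
    quiver yields enough sections of the contracting line bundle to show that all points of D
    have, up to the torus, the same quotient and the same submodule supported on S, and differ
    only in the arrows entering S.  Combinations of the possible values on these arrows are
    again clusters as long as they do not vanish, and the combinatorics of monomials excludes
    three independent ones: D is at most a pencil.  In a monomial chart A^3 of G-Hilb
    (Nakamura), freeing one coordinate of this pencil gives an irreducible surface strictly
    between D and the whole space, so that D is not a divisor. *)

Require Import Defs.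
From Stdlib Require Import Relation_Operators.
From mathcomp Require Import all_boot all_order all_algebra all_fingroup all_solvable.
From mathcomp Require Import separable cyclotomic mxrepresentation.
From mathcomp Require Import reals complex mpoly boolp zify ring lra.

Set Implicit Arguments.
Unset Strict Implicit.
Unset Printing Implicit Defensive.

Import Order.TTheory GRing.Theory Num.Theory.
Local Open Scope ring_scope.

(** The aim cannot be that D is a point: a wall may well contract curves, and these are pencils of
    extensions, so one parameter is the best bound. A second obstacle is that the ring of sections
    defining the contraction is not known. Only differences of two arrow monomials of equal weight
    are used: an integral flow whose divergence is a multiple of theta0 gives such a monomial, and
    if it is nonzero at one point of D, it is nonzero on all of D. A flow can be made positive on
    every nonzero arrow that does not enter S, because S is the only proper submodule of weight
    zero; this is why exactly the arrows entering S stay undetermined. A path of nonzero value that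
    enters S never leaves it, so its value is linear in these arrows, and the possible extensions
    are studied as a vector space. Codimension is expressed by chains of irreducible sets, so no
    dimension theory enters: irreducibility comes from joining points by rational curves, strictness
    from one explicit point and one explicit equation. *)

(** * Invariant Laurent monomials and the staircases of monomial bases *)

Record lattice (L : int -> int -> int -> Prop) : Prop := Lattice {
  latD : forall x y z x' y' z', L x y z -> L x' y' z' ->
    L (x + x') (y + y') (z + z');
  latN : forall x y z, L x y z -> L (- x) (- y) (- z);
  lat1 : L 1 1 1;
  lat_tors : forall x y z, exists2 N : nat, (0 < N)%N & L (x *+ N) (y *+ N) (z *+ N) }.

Lemma lat_eq (L : int -> int -> int -> Prop) x y z x' y' z' :
  L x y z -> x = x' -> y = y' -> z = z' -> L x' y' z'.
Proof. by move=> ? <- <- <-. Qed.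

(** A transversal modulo [L] that is closed under division: a G-graph in the sense of Nakamura. Both
    arguments are ternary predicates, so that permuting coordinates is permuting arguments. *)
Record standard (L : int -> int -> int -> Prop) (Gam : nat -> nat -> nat -> Prop)
  : Prop := Standard {
  std_lat : lattice L;
  std_dvd : forall i j k i' j' k', (i <= i')%N -> (j <= j')%N -> (k <= k')%N ->
    Gam i' j' k' -> Gam i j k;
  std_ex : forall i j k : nat, exists i' j' k' : nat,
    Gam i' j' k' /\ L (i%:Z - i'%:Z) (j%:Z - j'%:Z) (k%:Z - k'%:Z);
  std_uniq : forall i j k i' j' k' : nat, Gam i j k -> Gam i' j' k' ->
    L (i%:Z - i'%:Z) (j%:Z - j'%:Z) (k%:Z - k'%:Z) ->
    [/\ i = i', j = j' & k = k'] }.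

Lemma standard_rot L Gam : standard L Gam ->
  standard (fun x y z => L z x y) (fun i j k => Gam k i j).
Proof.
case=> [[LD LN L1 Lt] Gd Ge Gu]; split.
- split; [move=> x y z x' y' z'; exact: LD|move=> x y z; exact: LN|exact: L1|].
  by move=> x y z; exact: Lt.
- by move=> i j k i' j' k' h1 h2 h3; apply: Gd.
- by move=> i j k; have [i' [j' [k' [? ?]]]] := Ge k i j; exists j', k', i'.
- by move=> i j k i' j' k' g g' l; have [] := Gu _ _ _ _ _ _ g g' l.
Qed.

Lemma standard_swap L Gam : standard L Gam ->
  standard (fun x y z => L x z y) (fun i j k => Gam i k j).
Proof.
case=> [[LD LN L1 Lt] Gd Ge Gu]; split.
- split; [move=> x y z x' y' z'; exact: LD|move=> x y z; exact: LN|exact: L1|].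
  by move=> x y z; exact: Lt.
- by move=> i j k i' j' k' h1 h2 h3; apply: Gd.
- by move=> i j k; have [i' [j' [k' [? ?]]]] := Ge i k j; exists i', k', j'.
- by move=> i j k i' j' k' g g' l; have [] := Gu _ _ _ _ _ _ g g' l.
Qed.

Section Corner.
Variables (L : int -> int -> int -> Prop) (Gam : nat -> nat -> nat -> Prop).
Hypothesis sG : standard L Gam.
Let LD := latD (std_lat sG).
Let LN := latN (std_lat sG).
Let L1 := lat1 (std_lat sG).
Let Gd := std_dvd sG.
Let Gu := std_uniq sG.

Lemma std0 : Gam 0 0 0.
Proof. by have [i [j [k [g _]]]] := std_ex sG 0 0 0; apply: Gd g. Qed.

Lemma std_congr i j k i' j' k' (g : Gam i j k) (g' : Gam i' j' k') x y z :
  L x y z -> x = (i%:Z - i'%:Z) -> y = (j%:Z - j'%:Z) -> z = (k%:Z - k'%:Z) ->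
  [/\ i = i', j = j' & k = k'].
Proof. by move=> l ex ey ez; apply: Gu => //; rewrite -ex -ey -ez. Qed.

(** The representative of the first missing power of x contains no x: dividing both by x would give
    equivalent, hence equal, monomials of [Gam], and the missing power would lie in [Gam]. *)
Lemma std_corner : exists a b1 c1 : nat,
  [/\ (0 < a)%N, forall i, Gam i 0 0 <-> (i < a)%N, Gam 0 b1 c1 &
      L a%:Z (- b1%:Z) (- c1%:Z)].
Proof.
have [N N0 LN0] := lat_tors (std_lat sG) 1 0 0.
have notN : ~ Gam N 0 0.
  move=> g; have [] := std_congr g std0 LN0; lia.
have [a [na min_a]] : exists a, ~ Gam a 0 0 /\ forall i, (i < a)%N -> Gam i 0 0.
  elim: N {N0 LN0} notN => [|N IH] notN; first by case: notN; exact: std0.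
  have [i [j [k [g l]]]] := std_ex sG N 0 0.
  have [e|ne] := eqVneq (i, j, k) (N, 0, 0)%N.
    case: e g => -> -> -> g; exists N.+1; split=> // i'; rewrite ltnS => h.
    exact: Gd g.
  apply: IH => g'; case/eqP: ne.
  by have [|||-> -> ->] := std_congr g' g l.
have a0 : (0 < a)%N by case: a na {min_a} => // -[]; exact: std0.
have [i [j [k [g l]]]] := std_ex sG a 0 0.
have i0 : i = 0%N.
  case: i g l => // i g l; case: na.
  have g1 : Gam i j k by apply: Gd g.
  have g2 : Gam a.-1 0 0 by apply: min_a; lia.
  have [| | |e1 e2 e3] := std_congr g2 g1 l; try lia.
  by apply: Gd g; lia.
exists a, j, k; split=> //; last 2 [by rewrite -i0]; last first.
  by apply: (lat_eq l); lia.
move=> i'; split=> [g'|]; last exact: min_a.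
by rewrite ltnNge; apply/negP=> h; apply: na; apply: Gd g'.
Qed.

Lemma std_xyz i j k : Gam i j k -> [|| i == 0, j == 0 | k == 0]%N.
Proof.
move=> g; apply/contraT => h.
have g1 : Gam 1 1 1 by apply: Gd g; lia.
by have [] := std_congr g1 std0 L1.
Qed.

(** Modulo xyz, the relation between z^c and x^a3 y^b3 makes x^(a3+1) y^(b3+1) equivalent to
    z^(c-1), which lies in [Gam]; this removes a corner of the rectangle, and nothing else is
    missing. *)
Lemma std_plane a b c a3 b3 :
  (forall i, Gam i 0 0 <-> (i < a)%N) -> (forall j, Gam 0 j 0 <-> (j < b)%N) ->
  (forall k, Gam 0 0 k <-> (k < c)%N) -> Gam a3 b3 0 ->
  L (- a3%:Z) (- b3%:Z) c%:Z ->
  forall i j, Gam i j 0 <-> [/\ (i < a)%N, (j < b)%N & ~~ ((a3 < i)%N && (b3 < j)%N)].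
Proof.
move=> gx gy gz g3 l3 i j; split=> [g|[ia jb]].
  split; [by apply/gx; apply: Gd g|by apply/gy; apply: Gd g|].
  apply/andP=> -[i3 j3].
  have c0 : (0 < c)%N by apply/gz; exact: std0.
  have g1 : Gam a3.+1 b3.+1 0 by apply: Gd g.
  have g2 : Gam 0 0 c.-1 by apply/gz; lia.
  have [] := std_congr g1 g2 (LD (LN l3) L1); lia.
elim: i j ia jb => [|i IHi] j ia jb; first by move=> _; apply/gy.
elim: j jb => [|j IHj] jb; first by move=> _; apply/gx.
move=> h; have g1 : Gam i j.+1 0 by apply: IHi; lia.
have g2 : Gam i.+1 j 0 by apply: IHj; lia.
(* A representative that involves x or y is the monomial itself, by division. A power of z, once xyz
   is divided out, contradicts uniqueness unless (i, j) is (a3, b3). *)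
have [i' [j' [k' [g l]]]] := std_ex sG i.+1 j.+1 0.
case: i' g l => [|i'] g l; last first.
  have [||||e1 e2 e3] := @std_congr i j.+1 0 i' j' k' g1 _ _ _ _ l; try lia.
    by apply: Gd g; lia.
  by apply: Gd g; lia.
case: j' g l => [|j'] g l; last first.
  have [||||e1 e2 e3] := @std_congr i.+1 j 0 0 j' k' g2 _ _ _ _ l; try lia.
  by apply: Gd g; lia.
have k'c : (k' < c)%N by apply/gz.
have g3' : Gam i j 0 by apply: Gd g1; lia.
have [e|ne] := eqVneq k'.+1 c; last first.
  have g4 : Gam 0 0 k'.+1 by apply/gz; lia.
  have [] := std_congr g3' g4 (LD l (LN L1)); lia.
have [] := std_congr g3' g3 (LD (LD l (LN L1)) l3); lia.
Qed.

End Corner.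

(* [x^a], [y^b], [z^c] are the first powers outside [Gam], and [y^b1 z^c1], [x^a2 z^c2],
   [x^a3 y^b3] are equivalent to them. *)
Record stairs (L : int -> int -> int -> Prop) (Gam : nat -> nat -> nat -> Prop)
  (a b c a2 a3 b1 b3 c1 c2 : nat) : Prop := Stairs {
  stG : standard L Gam;
  stx : forall i, Gam i 0 0 <-> (i < a)%N;
  sty : forall j, Gam 0 j 0 <-> (j < b)%N;
  stz : forall k, Gam 0 0 k <-> (k < c)%N;
  stcx : Gam 0 b1 c1 /\ L a%:Z (- b1%:Z) (- c1%:Z);
  stcy : Gam a2 0 c2 /\ L (- a2%:Z) b%:Z (- c2%:Z);
  stcz : Gam a3 b3 0 /\ L (- a3%:Z) (- b3%:Z) c%:Z }.

Lemma stairs_ex L Gam : standard L Gam ->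
  exists a b c a2 a3 b1 b3 c1 c2, stairs L Gam a b c a2 a3 b1 b3 c1 c2.
Proof.
move=> sG.
have [a [b1 [c1 [_ ? ? ?]]]] := std_corner sG.
have [b [c2 [a2 [_ ? ? ?]]]] := std_corner (standard_rot sG).
have [c [a3 [b3 [_ ? ? ?]]]] := std_corner (standard_rot (standard_rot sG)).
by exists a, b, c, a2, a3, b1, b3, c1, c2.
Qed.

(* The new coordinates are (z, x, y). *)
Lemma stairs_rot L Gam a b c a2 a3 b1 b3 c1 c2 :
  stairs L Gam a b c a2 a3 b1 b3 c1 c2 ->
  stairs (fun x y z => L y z x) (fun i j k => Gam j k i) c a b c1 c2 a3 a2 b3 b1.
Proof.
by case=> sG x y z [? ?] [? ?] [? ?]; split=> //;
  exact: standard_rot (standard_rot sG).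
Qed.

Lemma stairs_swap L Gam a b c a2 a3 b1 b3 c1 c2 :
  stairs L Gam a b c a2 a3 b1 b3 c1 c2 ->
  stairs (fun x y z => L x z y) (fun i j k => Gam i k j) a c b a3 a2 c1 c2 b1 b3.
Proof. by case=> sG x y z [? ?] [? ?] [? ?]; split=> //; exact: standard_swap. Qed.

Lemma stairs_xy L Gam a b c a2 a3 b1 b3 c1 c2 :
  stairs L Gam a b c a2 a3 b1 b3 c1 c2 -> forall i j,
  Gam i j 0 <-> [/\ (i < a)%N, (j < b)%N & ~~ ((a3 < i)%N && (b3 < j)%N)].
Proof.
by case=> std x y z _ _ [g l]; exact: (std_plane std x y z g l).
Qed.

Lemma stairs_yz L Gam a b c a2 a3 b1 b3 c1 c2 :
  stairs L Gam a b c a2 a3 b1 b3 c1 c2 -> forall j k,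
  Gam 0 j k <-> [/\ (j < b)%N, (k < c)%N & ~~ ((b1 < j)%N && (c1 < k)%N)].
Proof. by move=> s; exact: (stairs_xy (stairs_rot (stairs_rot s))). Qed.

Lemma stairs_zx L Gam a b c a2 a3 b1 b3 c1 c2 :
  stairs L Gam a b c a2 a3 b1 b3 c1 c2 -> forall i k,
  Gam i 0 k <-> [/\ (k < c)%N, (i < a)%N & ~~ ((c2 < k)%N && (a2 < i)%N)].
Proof. by move/stairs_rot => s i k; have := stairs_xy s k i. Qed.

(** * The two shapes of a staircase *)

Section Excess.
Variables (L : int -> int -> int -> Prop) (Gam : nat -> nat -> nat -> Prop).
Variables (a b c a2 a3 b1 b3 c1 c2 : nat).
Hypothesis sG : stairs L Gam a b c a2 a3 b1 b3 c1 c2.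
Let std := stG sG.
Let LD := latD (std_lat std).
Let LN := latN (std_lat std).
Let L1 := lat1 (std_lat std).
Let xy := stairs_xy sG.
Let yz := stairs_yz sG.
Let zx := stairs_zx sG.
Let congr := @std_congr _ _ std.

Lemma stairs_bounds : [&& (a2 < a)%N, (a3 < a)%N, (b1 < b)%N, (b3 < b)%N,
  (c1 < c)%N & (c2 < c)%N].
Proof.
case: sG => _ _ _ _ [gx _] [gy _] [gz _].
move/yz: gx => [-> -> _]; move/zx: gy => [-> -> _]; by move/xy: gz => [-> ->].
Qed.

(** The product of the relations for x^a and y^b, divided by xyz, makes x^(a-a2-1) y^(b-b1-1)
    equivalent to z^(c1+c2+1), which is in [Gam]; so the former lies beyond the corner (a3, b3). *)
Lemma excess_pos : (c1 + c2 + 1 < c)%N -> (a2 + a3 + 1 < a)%N /\ (b1 + b3 + 1 < b)%N.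
Proof.
move=> cc; have bd := stairs_bounds.
case: sG => _ _ _ z [_ lx] [_ ly] _.
have l := LD (LD lx ly) (LN L1).
have g1 : Gam 0 0 (c1 + c2 + 1) by apply/z.
have n2 : ~ Gam (a - a2 - 1) (b - b1 - 1) 0.
  by move=> g2; have [] := congr g2 g1 l; lia.
suff: (a3 < a - a2 - 1)%N && (b3 < b - b1 - 1)%N by lia.
by apply/contraT => h; case: n2; apply/xy; split=> //; lia.
Qed.

(** If b were larger, the representative of y^(b1+1) z^(c-1) could contain neither x nor y, by
    comparison with x^a3 y^(b1+b3+2) and y^b1 z^(c-1), and could not be a power of z either. *)
Lemma excess_lt2 : (c1 + c2 + 1 < c)%N -> (a2 + a3 + 1 < a)%N -> (b <= b1 + b3 + 2)%N.
Proof.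
move=> cc aa; have bd := stairs_bounds; rewrite leqNgt; apply/negP => bb.
case: (sG) => _ gx gy gz [_ lx] [_ ly] [_ lz].
have [i [j [k [g l]]]] := std_ex std 0 b1.+1 c.-1.
case: i g l => [|i] g l; last first.
  have g1 : Gam i j k by apply: (std_dvd std) g.
  have g2 : Gam a3 (b1 + b3 + 2) 0 by apply/xy; split; lia.
  have [|||e1 e2 e3] := congr g2 g1 (LD (LD l (LN lz)) (lat1 (std_lat std))); try lia.
  by move: g; rewrite -e1 -e2 -e3 => /xy[]; lia.
case: j g l => [|j] g l; last first.
  have g1 : Gam 0 j k by apply: (std_dvd std) g.
  have g2 : Gam 0 b1 c.-1 by apply/yz; split; lia.
  have [|||e1 e2 e3] := congr g2 g1 l; try lia.
  by move: g; rewrite -e2 -e3 => /yz[]; lia.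
have kc : (k < c)%N by apply/gz.
have [e|ne] := eqVneq k c.-1.
  have g2 : Gam 0 b1.+1 0 by apply/gy; lia.
  have [] := congr g2 (std0 std) l; lia.
have g2 : Gam 0 b1 (c - 2 - k) by apply/yz; split; lia.
have g1 : Gam 1 0 0 by apply/gx; lia.
have [] := congr g2 g1 (LD l (LN L1)); lia.
Qed.

(** If a is too small, the representative of x^a y^b3 can only be a power of y. An exponent above b3
    gives c1 = 0; otherwise yz is missing from [Gam], so b1 or c1 vanishes. *)
Lemma excess_neg_aux : (a <= a2 + a3)%N ->
  c1 = 0%N \/ b1 = 0%N /\ exists2 j, (j <= b3)%N & L a%:Z (b3%:Z - j%:Z) 0.
Proof.
move=> aa; have bd := stairs_bounds.
case: (sG) => _ gx gy gz [gcx lx] [_ ly] [_ lz].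
have [i [j [k [g l]]]] := std_ex std a b3 0.
case: i g l => [|i] g l; last first.
  have g1 : Gam i j k by apply: (std_dvd std) g.
  have g2 : Gam a.-1 b3 0 by apply/xy; split; lia.
  have [|||e1 e2 e3] := congr g2 g1 l; try lia.
  by move: g; rewrite -e1 -e2 -e3 => /xy[]; lia.
case: k g l => [|k] g l; last first.
  have g1 : Gam 0 j k by apply: (std_dvd std) g.
  have g2 : Gam (a - a3) 0 c.-1 by apply/zx; split; lia.
  have [|||e1 e2 e3] := congr g2 g1 (LD l lz); try lia.
have [jb|jb] := leqP j b3; last first.
  have g1 : Gam 0 (j - b3) 0 by apply: (std_dvd std) g; lia.
  left; have [] := congr g1 gcx (LD lx (LN l)); lia.
have := yz 1 1 => yz11.
have a0 : ~ Gam 0 1 1.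
  move=> g2; have g1 : Gam a.-1 (b3 - j) 0 by apply/xy; split; lia.
  have [] := congr g1 g2 (LD l (LN L1)); lia.
case: (posnP c1) => [|c10]; [by left | right].
have b10 : b1 = 0%N.
  by case: (posnP b1) => // b10; case: a0; apply: (std_dvd std) gcx.
by split=> //; exists j => //; apply: (lat_eq l); lia.
Qed.

End Excess.

(** Both orientations of the degenerate case together give b1 = c1 = 0. The product of the three
    relations divided by xyz then makes a power of x invariant whose exponent is positive and below
    a. *)
Lemma excess_nonneg L Gam a b c a2 a3 b1 b3 c1 c2 :
  stairs L Gam a b c a2 a3 b1 b3 c1 c2 -> (a2 + a3 < a)%N.
Proof.
move=> sG; rewrite ltnNge; apply/negP => aa; have bd := stairs_bounds sG.
have std := stG sG.
have L1 := lat1 (std_lat std).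
case: (sG) => _ gx gy gz [gcx lx] [_ ly] [_ lz].
have yz := stairs_yz sG.
have [b10 c10] : b1 = 0%N /\ c1 = 0%N.
  have := excess_neg_aux (stairs_swap sG); rewrite addnC => /(_ aa).
  case: (excess_neg_aux sG aa) => [c10|[b10 [j jb l]]] [b10'|[c10' [k kc l']]]//; split=> //.
    have g1 : Gam 0 b1 (c2 - k)%N by apply/yz; split; lia.
    by have [] := std_congr std g1 (std0 std) (latD (std_lat std) l' (latN (std_lat std) lx)); lia.
  have g1 : Gam 0 (b3 - j)%N c1 by apply/yz; split; lia.
  by have [] := std_congr std g1 (std0 std) (latD (std_lat std) l (latN (std_lat std) lx)); lia.
have cc : (c <= c1 + c2 + 1)%N.
  rewrite leqNgt; apply/negP => /(excess_pos sG)[]; lia.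
have bb : (b <= b3 + b1 + 1)%N.
  rewrite leqNgt; apply/negP => /(excess_pos (stairs_rot sG))[]; lia.
have l := latD (std_lat std) (latD (std_lat std) (latD (std_lat std) lx ly) lz) (latN (std_lat std) L1).
have g1 : Gam (a2 + a3 + 1 - a)%N 0 0 by apply/gx; lia.
have [] := std_congr std g1 (std0 std) (latN (std_lat std) l); lia.
Qed.

(** By cyclic symmetry an excess in one coordinate propagates to the others and is at most one. The
    bit [e] separates two kinds of charts: the coordinates come from x^a, y^b, z^c if it is false,
    from the corner products if it is true. *)
Lemma stairs_excess L Gam a b c a2 a3 b1 b3 c1 c2 :
  stairs L Gam a b c a2 a3 b1 b3 c1 c2 -> exists2 e : bool, True &
  [/\ a = (a2 + a3 + 1 + e)%N, b = (b1 + b3 + 1 + e)%N & c = (c1 + c2 + 1 + e)%N].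
Proof.
move=> sG; have sG1 := stairs_rot sG; have sG2 := stairs_rot sG1.
have [A B C] := And3 (excess_nonneg sG) (excess_nonneg sG1) (excess_nonneg sG2).
have [A' B' C'] := And3 (excess_pos sG) (excess_pos sG1) (excess_pos sG2).
have [A2 B2 C2] := And3 (excess_lt2 sG) (excess_lt2 sG1) (excess_lt2 sG2).
case: (leqP c (c1 + c2 + 1)) => [c0|c0]; [exists false|exists true] => //.
  have : (a <= a2 + a3 + 1)%N by rewrite leqNgt; apply/negP => h; move: C'; lia.
  have : (b <= b1 + b3 + 1)%N by rewrite leqNgt; apply/negP => h; move: B'; lia.
  by split; lia.
have [h1 h2] := A' c0.
by split; move: A2 B2 C2; lia.
Qed.

(** * Values of monomials on a cluster, and charts *)

Definition expo := (nat * nat * nat)%type.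

Definition Lexpo (L : int -> int -> int -> Prop) (m m' : expo) : Prop :=
  L (m.1.1%:Z - m'.1.1%:Z) (m.1.2%:Z - m'.1.2%:Z) (m.2%:Z - m'.2%:Z).

(* Values of the monomials on a cluster for which the monomials in [Gam] form a basis. *)
Record normalized (K : comNzRingType) (L : int -> int -> int -> Prop)
  (Gam : nat -> nat -> nat -> Prop) (X : expo -> K) : Prop := Normalized {
  nrm1 : forall i j k, Gam i j k -> X (i, j, k) = 1;
  nrmM : forall i j k i' j' k' p q r : nat, Gam i' j' k' ->
    L (i%:Z - i'%:Z) (j%:Z - j'%:Z) (k%:Z - k'%:Z) ->
    X (i + p, j + q, k + r)%N = X (i, j, k) * X (i' + p, j' + q, k' + r)%N }.

Lemma normalized_rot (K : comNzRingType) L Gam (X : expo -> K) :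
  normalized L Gam X ->
  normalized (fun x y z => L y z x) (fun i j k => Gam j k i) (fun m => X (m.1.2, m.2, m.1.1)).
Proof.
case=> X1 XM; split=> [i j k g|i j k i' j' k' p q r g l] /=; first exact: X1.
exact: XM.
Qed.

Lemma nrmE (K : comNzRingType) L Gam (X : expo -> K) (nX : normalized L Gam X)
    (i j k p q r i' j' k' : nat) m m' x y z :
  Gam i' j' k' -> L x y z ->
  x = i%:Z - i'%:Z -> y = j%:Z - j'%:Z -> z = k%:Z - k'%:Z ->
  m = (i + p, j + q, k + r)%N -> m' = (i' + p, j' + q, k' + r)%N ->
  X m = X (i, j, k) * X m'.
Proof. by move=> g l ex ey ez -> ->; apply: (nrmM nX) => //; rewrite -ex -ey -ez. Qed.
Arguments nrmE {K L Gam X} nX i j k p q r {i' j' k' m m' x y z}.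

Local Ltac expo_lia := try lia; try by congr (_, _, _); lia.

Section Values.
Variables (L : int -> int -> int -> Prop) (Gam : nat -> nat -> nat -> Prop).
Variables (a b c a2 a3 b1 b3 c1 c2 : nat).
Hypothesis sG : stairs L Gam a b c a2 a3 b1 b3 c1 c2.

(** One constructor for staying in [Gam] and one for each way of leaving it: the end of a row, the
    missing corners in the planes xy and zx, and the invariant xyz. *)
Variant xstep_spec (i j k : nat) : nat -> nat -> nat -> Prop :=
| Xstep_in : xstep_spec i j k i.+1 j k
| Xstep_pow of i.+1 = a : xstep_spec i j k 0 (b1 + j) (c1 + k)
| Xstep_xy of i = a3 & (b3 < j)%N & k = 0%N : xstep_spec i j k 0 (j - b3.+1) c.-1
| Xstep_zx of i = a2 & (c2 < k)%N & j = 0%N : xstep_spec i j k 0 b.-1 (k - c2.+1)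
| Xstep_xyz of (0 < j)%N & (0 < k)%N & i = 0%N : xstep_spec i j k 0 j.-1 k.-1.

Lemma xstep i j k : Gam i j k ->
  exists i' j' k', Gam i' j' k' /\ xstep_spec i j k i' j' k'.
Proof.
move=> g; have bd := stairs_bounds sG; have std := stG sG.
have [e _ [ea eb ec]] := stairs_excess sG.
have xy := stairs_xy sG; have yz := stairs_yz sG; have zx := stairs_zx sG.
have z := std_xyz std g.
case: (posnP k) => [k0|kp].
  move: g; rewrite k0 => g; have /xy [ia jb h] := g.
  case: (ltnP b3 j) => jb3.
    have [e3|ne] := eqVneq i a3.
      exists 0%N, (j - b3.+1)%N, c.-1; split; last exact: Xstep_xy.
      by apply/yz; split; lia.
    by exists i.+1, j, 0%N; split; [apply/xy; split; lia|exact: Xstep_in].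
  have [e3|ne] := eqVneq i.+1 a.
    exists 0%N, (b1 + j)%N, (c1 + 0)%N; split; last exact: Xstep_pow.
    by apply/yz; split; lia.
  by exists i.+1, j, 0%N; split; [apply/xy; split; lia|exact: Xstep_in].
case: (posnP j) => [j0|jp]; last first.
  have i0 : i = 0%N by lia.
  exists 0%N, j.-1, k.-1; split; last exact: Xstep_xyz.
  by apply: (std_dvd std) g; lia.
move: g; rewrite j0 => g; have /zx [kc ia h] := g.
case: (ltnP c2 k) => kc2.
  have [e3|ne] := eqVneq i a2.
    exists 0%N, b.-1, (k - c2.+1)%N; split; last exact: Xstep_zx.
    by apply/yz; split; lia.
  by exists i.+1, 0%N, k; split; [apply/zx; split; lia|exact: Xstep_in].
have [e3|ne] := eqVneq i.+1 a.
  exists 0%N, (b1 + 0)%N, (c1 + k)%N; split; last exact: Xstep_pow.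
  by apply/yz; split; lia.
by exists i.+1, 0%N, k; split; [apply/zx; split; lia|exact: Xstep_in].
Qed.

Variables (K : comNzRingType) (X : expo -> K).
Hypothesis nX : normalized L Gam X.

Let vx := X (a, 0, 0)%N.
Let vy := X (0, b, 0)%N.
Let vz := X (0, 0, c)%N.
Let lam := X (0, b1.+1, c1.+1)%N.
Let mu := X (a2.+1, 0, c2.+1)%N.
Let nu := X (a3.+1, b3.+1, 0)%N.
Let LD := latD (std_lat (stG sG)).
Let LN := latN (std_lat (stG sG)).
Let L1 := lat1 (std_lat (stG sG)).
Let bd := stairs_bounds sG.

Lemma value_xyz : X (1, 1, 1)%N = lam * vx.
Proof.
case: (sG) => std gx gy gz [gcx lx] _ _.
have g0 := std0 std.
have : X (1, b1.+1, c1.+1)%N = X (1, 1, 1)%N * X (0, b1, c1)%N.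
  apply: (nrmE nX _ _ _ 0 b1 c1 g0 L1) => //.
rewrite (nrm1 nX gcx) mulr1 => <-.
have g1 : Gam a.-1 0 0 by apply/gx; lia.
apply: (nrmE nX _ _ _ 1 0 0 g1 (LD L1 (LN lx))); try lia.
- by congr (_, _, _); lia.
- by congr (_, _, _); lia.
Qed.

(** The monomial y^b z^(c1+1) reduces to x^(a-1) y^b3 in two ways: by the corner product of y and z,
    or by y^b followed by z^c. *)
Lemma value_yz : b = (b1 + b3 + 1)%N -> a = (a2 + a3 + 1)%N -> c = (c1 + c2 + 1)%N ->
  lam = vy * vz.
Proof.
move=> eb ea ec; case: (sG) => std gx gy gz [gcx lx] [gcy ly] [gcz lz].
have : X (0, b, c1.+1)%N = lam * X (a.-1, b3, 0)%N.
  have g1 : Gam a.-1 0 0 by apply/gx; lia.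
  by apply: (nrmE nX _ _ _ 0 b3 0 g1 (LD L1 (LN lx))); expo_lia.
have g2 : Gam a.-1 b3 0 by apply/(stairs_xy sG); split; lia.
rewrite (nrm1 nX g2) mulr1 => <-.
rewrite (nrmE nX 0 b 0 0 0 c1.+1 (m := (0, b, c1.+1)%N) (m' := (a2, 0, c)%N) gcy ly); expo_lia.
rewrite (nrmE nX 0 0 c a2 0 0 (m := (a2, 0, c)%N) (m' := (a.-1, b3, 0)%N) gcz lz); expo_lia.
by rewrite (nrm1 nX g2) mulr1.
Qed.

(** Likewise x^a y^(b3+1) reduces to y^(b-1) z^c1 by x^a alone, or by two corner products in
    turn. *)
Lemma value_x : b = (b1 + b3 + 2)%N -> a = (a2 + a3 + 2)%N -> c = (c1 + c2 + 2)%N ->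
  vx = mu * nu.
Proof.
move=> eb ea ec; case: (sG) => std gx gy gz [gcx lx] [gcy ly] [gcz lz].
have g1 : Gam 0 b.-1 c1 by apply/(stairs_yz sG); split; lia.
have : X (a, b3.+1, 0)%N = vx * X (0, b.-1, c1)%N.
  by apply: (nrmE nX _ _ _ 0 b3.+1 0 gcx lx); expo_lia.
rewrite (nrm1 nX g1) mulr1 => <-.
have g2 : Gam 0 0 c.-1 by apply/gz; lia.
rewrite (nrmE nX a3.+1 b3.+1 0 a2.+1 0 0
  (m := (a, b3.+1, 0)%N) (m' := (a2.+1, 0, c.-1)%N) g2 (LD L1 (LN lz))); expo_lia.
have g3 : Gam 0 b.-1 0 by apply/gy; lia.
rewrite (nrmE nX a2.+1 0 c2.+1 0 0 c1
  (m := (a2.+1, 0, c.-1)%N) (m' := (0, b.-1, c1)%N) g3 (LD L1 (LN ly))); expo_lia.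
by rewrite (nrm1 nX g1) mulr1 mulrC.
Qed.

Lemma xstep_value i j k i' j' k' : Gam i j k -> Gam i' j' k' ->
  xstep_spec i j k i' j' k' ->
  [\/ [/\ i' = i.+1, j' = j, k' = k & X (i.+1, j, k) = 1],
       [/\ i.+1 = a, i' = 0, j' = b1 + j & k' = c1 + k]%N /\ X (i.+1, j, k) = vx,
       [/\ i' = 0, i = a3, j = j' + b3.+1, k = 0 & k' = c.-1]%N /\ X (i.+1, j, k) = nu |
       [/\ i' = 0, i = a2, j = 0, j' = b.-1 & k = k' + c2.+1]%N /\ X (i.+1, j, k) = mu \/
       [/\ i = 0, i' = 0, j = j'.+1 & k = k'.+1]%N /\ X (i.+1, j, k) = lam * vx].
Proof.
move=> g g' sp; case: (sG) => std gx gy gz [gcx lx] [gcy ly] [gcz lz].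
case: sp g g' => [|ia|ia bj k0|ia ck j0|jp kp i0] g g'.
- by apply: Or41; split; rewrite ?(nrm1 nX g').
- apply: Or42; split; first by split.
  rewrite (nrmE nX a 0 0 0 j k (m := (i.+1, j, k)) (m' := (0, b1 + j, c1 + k)%N) gcx lx); expo_lia.
  by rewrite (nrm1 nX g') mulr1.
- apply: Or43; split; first by split; lia.
  have g2 : Gam 0 0 c.-1 by apply/gz; lia.
  rewrite (nrmE nX a3.+1 b3.+1 0 0 (j - b3.+1) 0 (m := (i.+1, j, k)) (m' := (0, j - b3.+1, c.-1)%N) g2 (LD L1 (LN lz))); expo_lia.
  by rewrite (nrm1 nX g') mulr1.
- apply: Or44; left; split; first by split; lia.
  have g2 : Gam 0 b.-1 0 by apply/gy; lia.
  rewrite (nrmE nX a2.+1 0 c2.+1 0 0 (k - c2.+1) (m := (i.+1, j, k)) (m' := (0, b.-1, k - c2.+1)%N) g2 (LD L1 (LN ly))); expo_lia.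
  by rewrite (nrm1 nX g') mulr1.
- apply: Or44; right; split; first by split; lia.
  rewrite (nrmE nX 1 1 1 0 j.-1 k.-1 (m := (i.+1, j, k)) (m' := (0, j.-1, k.-1)%N) (std0 std) L1) //;
  try by congr (_, _, _); lia.
  by rewrite (nrm1 nX g') mulr1 value_xyz.
Qed.
End Values.

(** Exponents are recorded besides values because, by independence, the end points determine [q]:
    two composites with the same ends are the same monomial, which yields the commutation relations
    of the chart. *)
Definition expo_step (m m' q g1 g2 g3 r1 r2 r3 : expo) : Prop :=
  [/\ m.1.1%:Z - m'.1.1%:Z = q.1.1%:Z * (g1.1.1%:Z - r1.1.1%:Z)
        + q.1.2%:Z * (g2.1.1%:Z - r2.1.1%:Z) + q.2%:Z * (g3.1.1%:Z - r3.1.1%:Z),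
      m.1.2%:Z - m'.1.2%:Z = q.1.1%:Z * (g1.1.2%:Z - r1.1.2%:Z)
        + q.1.2%:Z * (g2.1.2%:Z - r2.1.2%:Z) + q.2%:Z * (g3.1.2%:Z - r3.1.2%:Z) &
      m.2%:Z - m'.2%:Z = q.1.1%:Z * (g1.2%:Z - r1.2%:Z)
        + q.1.2%:Z * (g2.2%:Z - r2.2%:Z) + q.2%:Z * (g3.2%:Z - r3.2%:Z)].

Definition indep_expo (g1 g2 g3 r1 r2 r3 : expo) : Prop := forall d1 d2 d3 : int,
  d1 * (g1.1.1%:Z - r1.1.1%:Z) + d2 * (g2.1.1%:Z - r2.1.1%:Z) + d3 * (g3.1.1%:Z - r3.1.1%:Z) = 0 ->
  d1 * (g1.1.2%:Z - r1.1.2%:Z) + d2 * (g2.1.2%:Z - r2.1.2%:Z) + d3 * (g3.1.2%:Z - r3.1.2%:Z) = 0 ->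
  d1 * (g1.2%:Z - r1.2%:Z) + d2 * (g2.2%:Z - r2.2%:Z) + d3 * (g3.2%:Z - r3.2%:Z) = 0 ->
  [/\ d1 = 0, d2 = 0 & d3 = 0].

Definition qmon (K : comNzRingType) (X : expo -> K) (g1 g2 g3 q : expo) : K :=
  X g1 ^+ q.1.1 * X g2 ^+ q.1.2 * X g3 ^+ q.2.

Definition in_expo (Gam : nat -> nat -> nat -> Prop) (m : expo) : Prop :=
  Gam m.1.1 m.1.2 m.2.

Definition step_ok (K : comNzRingType) L Gam (g1 g2 g3 r1 r2 r3 m : expo) : Prop :=
  exists m' q : expo, [/\ in_expo Gam m', expo_step m m' q g1 g2 g3 r1 r2 r3 &
    forall X : expo -> K, normalized L Gam X -> X m = qmon X g1 g2 g3 q].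

(** In the equation of the largest unknown all differences are nonnegative, so it is at most 0;
    dually the smallest is at least 0. *)
Lemma dominant_free (d1 d2 d3 : int) (a2 a3 b1 b3 c1 c2 : nat) :
  d1 + a2%:Z * (d1 - d2) + a3%:Z * (d1 - d3) = 0 ->
  d2 + b1%:Z * (d2 - d1) + b3%:Z * (d2 - d3) = 0 ->
  d3 + c1%:Z * (d3 - d1) + c2%:Z * (d3 - d2) = 0 -> [/\ d1 = 0, d2 = 0 & d3 = 0].
Proof.
move=> k1 k2 k3.
have pos (n : nat) (x y : int) : x <= y -> 0 <= n%:Z * (y - x) by move=> h; apply: mulr_ge0; lia.
have [h12|h12] := lerP d1 d2; have [h13|h13] := lerP d1 d3; have [h23|h23] := lerP d2 d3;
 try (move/ltW: h12 => h12); try (move/ltW: h13 => h13); try (move/ltW: h23 => h23);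
 have p1 := pos a2 _ _ h12; have p2 := pos a3 _ _ h13; have p3 := pos b1 _ _ h12;
 have p4 := pos b3 _ _ h23; have p5 := pos c1 _ _ h13; have p6 := pos c2 _ _ h23; clear pos; split; nia.
Qed.

(** The largest unknown is at most the sum of the other two, and the smallest is at least the sum of
    the other two; adding, all three are equal, hence 0. *)
Lemma dominant_free1 (d1 d2 d3 : int) (a2 a3 b1 b3 c1 c2 : nat) :
  d1 = (a2%:Z + 1) * (d1 - d2) + (a3%:Z + 1) * (d1 - d3) ->
  d2 = (b1%:Z + 1) * (d2 - d1) + (b3%:Z + 1) * (d2 - d3) ->
  d3 = (c1%:Z + 1) * (d3 - d1) + (c2%:Z + 1) * (d3 - d2) -> [/\ d1 = 0, d2 = 0 & d3 = 0].
Proof.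
move=> k1 k2 k3.
have pos (n : nat) (x y : int) : x <= y -> 0 <= n%:Z * (y - x) by move=> h; apply: mulr_ge0; lia.
have [h12|h12] := lerP d1 d2; have [h13|h13] := lerP d1 d3; have [h23|h23] := lerP d2 d3;
 try (move/ltW: h12 => h12); try (move/ltW: h13 => h13); try (move/ltW: h23 => h23);
 have p1 := pos a2 _ _ h12; have p2 := pos a3 _ _ h13; have p3 := pos b1 _ _ h12;
 have p4 := pos b3 _ _ h23; have p5 := pos c1 _ _ h13; have p6 := pos c2 _ _ h23; clear pos; split; nia.
Qed.

Section Table.
Variables (K : comNzRingType).

Section Gens.
Variables (a b c a2 a3 b1 b3 c1 c2 : nat) (e : bool).
(** The coordinates are the ratios of [gen] to [red]: a first missing power over its representative,
    or, for [e] true, a corner product over the last power inside [Gam]. *)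
Definition gen1 : expo := (if e then (0, b1.+1, c1.+1) else (a, 0, 0))%N.
Definition gen2 : expo := (if e then (a2.+1, 0, c2.+1) else (0, b, 0))%N.
Definition gen3 : expo := (if e then (a3.+1, b3.+1, 0) else (0, 0, c))%N.
Definition red1 : expo := (if e then (a.-1, 0, 0) else (0, b1, c1))%N.
Definition red2 : expo := (if e then (0, b.-1, 0) else (a2, 0, c2))%N.
Definition red3 : expo := (if e then (0, 0, c.-1) else (a3, b3, 0))%N.
End Gens.

Section X.
Variables (L : int -> int -> int -> Prop) (Gam : nat -> nat -> nat -> Prop).
Variables (a b c a2 a3 b1 b3 c1 c2 : nat) (e : bool).
Hypothesis sG : stairs L Gam a b c a2 a3 b1 b3 c1 c2.
Hypothesis ea : a = (a2 + a3 + 1 + e)%N.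
Hypothesis eb : b = (b1 + b3 + 1 + e)%N.
Hypothesis ec : c = (c1 + c2 + 1 + e)%N.
Local Notation g1 := (gen1 a b1 c1 e).
Local Notation g2 := (gen2 b a2 c2 e).
Local Notation g3 := (gen3 c a3 b3 e).
Local Notation r1 := (red1 a b1 c1 e).
Local Notation r2 := (red2 b a2 c2 e).
Local Notation r3 := (red3 c a3 b3 e).

Local Notation nrm := (normalized L Gam).
Implicit Types X : expo -> K.

Lemma red_in : [/\ in_expo Gam r1, in_expo Gam r2 & in_expo Gam r3].
Proof.
case: (sG) => std gx gy gz [gcx lx] [gcy ly] [gcz lz].
have bd := stairs_bounds sG.
rewrite /red1 /red2 /red3; case: (e); rewrite /in_expo /=; last by [].
by split; [apply/gx|apply/gy|apply/gz]; lia.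
Qed.

Lemma gen_red :
  [/\ Lexpo L g1 r1, Lexpo L g2 r2 & Lexpo L g3 r3].
Proof.
case: (sG) => std gx gy gz [gcx lx] [gcy ly] [gcz lz].
have bd := stairs_bounds sG; have L1 := lat1 (std_lat std).
have lt u v w (l : L u v w) := latD (std_lat std) L1 (latN (std_lat std) l).
rewrite /Lexpo /red1 /red2 /red3 /gen1 /gen2 /gen3; case: (e) => /=.
  split; [apply: (lat_eq (lt _ _ _ lx))|apply: (lat_eq (lt _ _ _ ly))|apply: (lat_eq (lt _ _ _ lz))]; lia.
split; [apply: (lat_eq lx)|apply: (lat_eq ly)|apply: (lat_eq lz)]; lia.
Qed.

Lemma gen_free : indep_expo g1 g2 g3 r1 r2 r3.
Proof.
rewrite /indep_expo /red1 /red2 /red3 /gen1 /gen2 /gen3; move: ea eb ec; case: (e) => /= ha hb hc d1 d2 d3.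
  by move=> h1 h2 h3; apply: (@dominant_free1 _ _ _ a2 a3 b1 b3 c1 c2); nia.
by move=> h1 h2 h3; apply: (@dominant_free _ _ _ a2 a3 b1 b3 c1 c2); nia.
Qed.

Local Ltac check_step := rewrite /red1 /red2 /red3 /gen1 /gen2 /gen3;
  move: ea eb ec; case: (e) => /= ? ? ?; by split=> /=; lia.

(** Each reduction has as value 1, a first missing power, a corner product or xyz; [value_yz] and
    [value_x] rewrite those that are not coordinates in the given kind of chart. *)
Lemma xtable i j k : Gam i j k -> step_ok K L Gam g1 g2 g3 r1 r2 r3 (i.+1, j, k).
Proof.
move=> g; have [i' [j' [k' [g' sp]]]] := xstep sG g.
have val X (nX : nrm X) := xstep_value sG (X := X) nX g g' sp.
have vyz X (nX : nrm X) (e0 : e = false) : X (0, b1.+1, c1.+1)%N = X (0, b, 0)%N * X (0, 0, c)%N.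
  by apply: (value_yz sG nX); lia.
have vzx X (nX : nrm X) (e0 : e = false) : X (a2.+1, 0, c2.+1)%N = X (0, 0, c)%N * X (a, 0, 0)%N.
  by apply: (value_yz (stairs_rot (stairs_rot sG)) (normalized_rot (normalized_rot nX))); lia.
have vxy X (nX : nrm X) (e0 : e = false) : X (a3.+1, b3.+1, 0)%N = X (a, 0, 0)%N * X (0, b, 0)%N.
  by apply: (value_yz (stairs_rot sG) (normalized_rot nX)); lia.
have vx X (nX : nrm X) (e0 : e = true) : X (a, 0, 0)%N = X (a2.+1, 0, c2.+1)%N * X (a3.+1, b3.+1, 0)%N.
  by apply: (value_x sG nX); lia.
have bd := stairs_bounds sG; exists (i', j', k').
case: sp g' val => [|ia|ia bj k0|ia ck j0|jp kp i0] g' val.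
- exists (0, 0, 0)%N; split; [exact: g'|by split=> /=; lia|].
  by move=> X nX; rewrite /qmon /= !expr0 !mulr1; case: (val X nX) => [[]|[[]]|[[]]|[[[]]|[[]]]] //; lia.
- have v X (nX : nrm X) : X (i.+1, j, k) = X (a, 0, 0)%N :> K.
    by case: (val X nX) => [[]|[[]]|[[]]|[[[]]|[[]]]] //; lia.
  exists (if e then (0, 1, 1) else (1, 0, 0))%N; split; [exact: g'| |]; last first.
    move=> X nX; rewrite v // /qmon /gen1 /gen2 /gen3; case: (boolP e) => /= e0.
      by rewrite expr0 mul1r !expr1; apply: vx.
    by rewrite expr1 !expr0 !mulr1.
  check_step.
- have v X (nX : nrm X) : X (i.+1, j, k) = X (a3.+1, b3.+1, 0)%N :> K.
    by case: (val X nX) => [[]|[[]]|[[]]|[[[]]|[[]]]] //; lia.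
  exists (if e then (0, 0, 1) else (1, 1, 0))%N; split; [exact: g'| |]; last first.
    move=> X nX; rewrite v // /qmon /gen1 /gen2 /gen3; case: (boolP e) => /= e0.
      by rewrite !expr0 !mul1r expr1.
    by rewrite !expr1 !expr0 !mulr1 vxy //; apply/negbTE.
  check_step.
- have v X (nX : nrm X) : X (i.+1, j, k) = X (a2.+1, 0, c2.+1)%N :> K.
    by case: (val X nX) => [[]|[[]]|[[]]|[[[]]|[[]]]] //; lia.
  exists (if e then (0, 1, 0) else (1, 0, 1))%N; split; [exact: g'| |]; last first.
    move=> X nX; rewrite v // /qmon /gen1 /gen2 /gen3; case: (boolP e) => /= e0.
      by rewrite !expr0 !mul1r expr1 mulr1.
    by rewrite !expr1 !expr0 !mulr1 vzx 1?mulrC //; apply/negbTE.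
  check_step.
have v X (nX : nrm X) : X (i.+1, j, k) = X (0, b1.+1, c1.+1)%N * X (a, 0, 0)%N :> K.
  by case: (val X nX) => [[]|[[]]|[[]]|[[[]]|[[]]]] //; lia.
exists (1, 1, 1)%N; split; [exact: g'| |]; last first.
  move=> X nX; rewrite v // /qmon /gen1 /gen2 /gen3 !expr1; case: (boolP e) => /= e0.
    by rewrite (vx X nX) // mulrA.
  by rewrite (vyz X nX) ?(negbTE e0) // mulrC mulrA.
check_step.
Qed.
End X.

Lemma step_ok_rot L Gam g1 g2 g3 r1 r2 r3 (i j k : nat) :
  step_ok K (fun x y z => L y z x) (fun i j k => Gam j k i)
    (g3.2, g3.1.1, g3.1.2) (g1.2, g1.1.1, g1.1.2) (g2.2, g2.1.1, g2.1.2)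
    (r3.2, r3.1.1, r3.1.2) (r1.2, r1.1.1, r1.1.2) (r2.2, r2.1.1, r2.1.2)
    (i, j, k) ->
  step_ok K L Gam g1 g2 g3 r1 r2 r3 (j, k, i).
Proof.
move=> [m' [q [h1 h2 h3]]]; exists (m'.1.2, m'.2, m'.1.1), (q.1.2, q.2, q.1.1).
split=> //.
  by case: h2 => /= e1 e2 e3; split=> /=; rewrite ?e1 ?e2 ?e3; ring.
move=> X nX; have /= -> := h3 _ (normalized_rot nX).
rewrite /qmon /=; move: g1 g2 g3 {h2 h3} => [[g11 g12] g13] [[g21 g22] g23] [[g31 g32] g33] /=.
by rewrite -mulrA mulrC.
Qed.
End Table.

(* A chart of G-Hilb: the coordinates [X g1], [X g2], [X g3] are free, and every arrow of the
   McKay quiver acts on the basis [Gam] by a monomial in them. *)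
Record chart (K : comNzRingType) L Gam (g1 g2 g3 r1 r2 r3 : expo) : Prop := Chart {
  chart_red : [/\ in_expo Gam r1, in_expo Gam r2 & in_expo Gam r3];
  chart_gen : [/\ Lexpo L g1 r1, Lexpo L g2 r2 & Lexpo L g3 r3];
  chart_free : indep_expo g1 g2 g3 r1 r2 r3;
  chart_step : forall i j k, Gam i j k ->
    [/\ step_ok K L Gam g1 g2 g3 r1 r2 r3 (i.+1, j, k),
        step_ok K L Gam g1 g2 g3 r1 r2 r3 (i, j.+1, k) &
        step_ok K L Gam g1 g2 g3 r1 r2 r3 (i, j, k.+1)] }.

Lemma chart_ex (K : comNzRingType) L Gam : standard L Gam ->
  exists g1 g2 g3 r1 r2 r3, chart K L Gam g1 g2 g3 r1 r2 r3.
Proof.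
move=> std; have [a [b [c [a2 [a3 [b1 [b3 [c1 [c2 sG]]]]]]]]] := stairs_ex std.
have [e _ [ea eb ec]] := stairs_excess sG.
exists (gen1 a b1 c1 e), (gen2 b a2 c2 e), (gen3 c a3 b3 e).
exists (red1 a b1 c1 e), (red2 b a2 c2 e), (red3 c a3 b3 e).
split; [exact: (red_in sG ea eb ec)|exact: (gen_red sG ea eb ec)|exact: gen_free ea eb ec|].
have sG1 := stairs_rot sG; have sG2 := stairs_rot sG1.
move=> i j k g; split; first exact: xtable.
- apply: step_ok_rot; apply: step_ok_rot.
  have := xtable K sG2 (e := e) _ _ _ g; move: ea eb ec.
  by rewrite /gen1 /gen2 /gen3 /red1 /red2 /red3; case: (e) => /= ? ? ?; apply; lia.
apply: step_ok_rot.
have := xtable K sG1 (e := e) _ _ _ g; move: ea eb ec.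
by rewrite /gen1 /gen2 /gen3 /red1 /red2 /red3; case: (e) => /= ? ? ?; apply; lia.
Qed.

(** * Words in the three coordinates and their exponents *)

Definition lx : 'I_3 := @Ordinal 3 0 isT.
Definition ly : 'I_3 := @Ordinal 3 1 isT.
Definition lz : 'I_3 := @Ordinal 3 2 isT.

Variant letter_spec : 'I_3 -> Prop :=
| Letter_x : letter_spec lx | Letter_y : letter_spec ly | Letter_z : letter_spec lz.

Lemma letterP j : letter_spec j.
Proof.
by case: j => [[|[|[|//]]] h];
  [have -> : Ordinal h = lx | have -> : Ordinal h = ly | have -> : Ordinal h = lz];
  try exact: val_inj; constructor.
Qed.

Lemma big_letter (R : nmodType) (F : 'I_3 -> R) : \sum_j F j = F lx + F ly + F lz.
Proof.
rewrite !big_ord_recl big_ord0 addr0 addrA.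
by congr (F _ + F _ + F _); apply: val_inj.
Qed.

Definition mon (m : expo) : seq 'I_3 := nseq m.1.1 lx ++ nseq m.1.2 ly ++ nseq m.2 lz.
Definition cnt (w : seq 'I_3) : expo := (count_mem lx w, count_mem ly w, count_mem lz w).
Definition addm (m n : expo) : expo := (m.1.1 + n.1.1, m.1.2 + n.1.2, m.2 + n.2)%N.

Lemma cnt_cat w w' : cnt (w ++ w') = addm (cnt w) (cnt w').
Proof. by rewrite /cnt !count_cat. Qed.

Lemma cnt_mon m : cnt (mon m) = m.
Proof.
case: m => [[i j] k]; rewrite /cnt /mon !count_cat !count_nseq /=.
by congr (_, _, _); lia.
Qed.

Lemma cnt_perm w w' : cnt w = cnt w' -> perm_eq w w'.
Proof.
case=> ex ey ez; apply/allP => j _ /=; apply/eqP.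
by case: (letterP j).
Qed.

Lemma perm_cnt w w' : perm_eq w w' -> cnt w = cnt w'.
Proof. by move/seq.permP => e; rewrite /cnt !e. Qed.

Lemma perm_mon w : perm_eq w (mon (cnt w)).
Proof. by apply: cnt_perm; rewrite cnt_mon. Qed.

Lemma perm_nseq (j : 'I_3) n (w : seq 'I_3) : (n <= count_mem j w)%N -> exists v, perm_eq w (nseq n j ++ v).
Proof.
move=> le; exists (nseq (count_mem j w - n) j ++ filter (predC (pred1 j)) w).
rewrite catA -nseqD subnKC // -size_filter perm_sym.
have /all_pred1P <- : all (pred1 j) (filter (pred1 j) w) by exact: filter_all.
by rewrite perm_filterC.
Qed.

Section ExpoStep.
Variables (g1 g2 g3 r1 r2 r3 : expo).
Local Notation estep m m' q := (expo_step m m' q g1 g2 g3 r1 r2 r3).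

Lemma estep0 m : estep m m (0, 0, 0)%N.
Proof. by split=> /=; lia. Qed.

Lemma estep_add m m' n m'' q q' :
  estep m m' q -> estep (addm m' n) m'' q' -> estep (addm m n) m'' (addm q q').
Proof.
case=> /= e1 e2 e3 [/= f1 f2 f3]; split=> /=.
- by transitivity ((m.1.1%:Z - m'.1.1%:Z) + ((m'.1.1 + n.1.1)%N%:Z - m''.1.1%:Z));
    [rewrite !PoszD; ring|rewrite e1 f1 !PoszD; ring].
- by transitivity ((m.1.2%:Z - m'.1.2%:Z) + ((m'.1.2 + n.1.2)%N%:Z - m''.1.2%:Z));
    [rewrite !PoszD; ring|rewrite e2 f2 !PoszD; ring].
- by transitivity ((m.2%:Z - m'.2%:Z) + ((m'.2 + n.2)%N%:Z - m''.2%:Z));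
    [rewrite !PoszD; ring|rewrite e3 f3 !PoszD; ring].
Qed.

Lemma estep_uniq (K : comNzRingType) L Gam m m' q q' :
  chart K L Gam g1 g2 g3 r1 r2 r3 -> estep m m' q -> estep m m' q' -> q = q'.
Proof.
case=> _ _ free _ [e1 e2 e3] [f1 f2 f3].
have [|||] := free (q.1.1%:Z - q'.1.1%:Z) (q.1.2%:Z - q'.1.2%:Z) (q.2%:Z - q'.2%:Z).
- by rewrite -[RHS](subrr (m.1.1%:Z - m'.1.1%:Z)) {1}e1 f1; ring.
- by rewrite -[RHS](subrr (m.1.2%:Z - m'.1.2%:Z)) {1}e2 f2; ring.
- by rewrite -[RHS](subrr (m.2%:Z - m'.2%:Z)) {1}e3 f3; ring.
case: q q' {e1 e2 e3 f1 f2 f3} => [[x y] z] [[x' y'] z'] /=; move=> h1 h2 h3.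
by congr (_, _, _); lia.
Qed.
End ExpoStep.

Definition qpow (K : comNzRingType) (p : 'I_3 -> K) (q : expo) : K :=
  p lx ^+ q.1.1 * p ly ^+ q.1.2 * p lz ^+ q.2.

Lemma qpowD (K : comNzRingType) (p : 'I_3 -> K) q q' :
  qpow p (addm q q') = qpow p q * qpow p q'.
Proof. by rewrite /qpow /= !exprD; ring. Qed.

Definition sel (T : Type) (x y z : T) (j : 'I_3) : T :=
  match nat_of_ord j with 0%N => x | 1%N => y | _ => z end.

Definition lexle (m m' : expo) : Prop :=
  (m.1.1 < m'.1.1)%N \/ m.1.1 = m'.1.1 /\
   ((m.1.2 < m'.1.2)%N \/ m.1.2 = m'.1.2 /\ (m.2 <= m'.2)%N).

Lemma lexmin_ex (P : expo -> Prop) : (exists m, P m) ->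
  exists2 m, P m & forall m', P m' -> lexle m m'.
Proof.
case=> [[[i0 j0] k0] P0].
have min (Q : nat -> Prop) : (exists n, Q n) -> exists2 n, Q n & forall n', Q n' -> (n <= n')%N.
  case=> n0 Q0; have ex : exists n, `[< Q n >] by exists n0; apply/asboolP.
  by exists (ex_minn ex); case: ex_minnP => n /asboolP Qn mn // n' /asboolP; exact: mn.
have [i [j1 [k1 Pi]] mi] : exists2 n, (exists j k, P (n, j, k)) &
  forall n', (exists j k, P (n', j, k)) -> (n <= n')%N.
  by apply: min; exists i0, j0, k0.
have [j [k2 Pj] mj] : exists2 n, (exists k, P (i, n, k)) &
  forall n', (exists k, P (i, n', k)) -> (n <= n')%N.
  by apply: min; exists j1, k1.
have [k Pk mk] : exists2 n, P (i, j, n) & forall n', P (i, j, n') -> (n <= n')%N.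
  by apply: min; exists k2.
exists (i, j, k) => // -[[i' j'] k'] P'; rewrite /lexle /=.
have := mi i' (ex_intro _ j' (ex_intro _ k' P')).
rewrite leq_eqVlt => /orP[/eqP ei|]; last by left.
right; split=> //; move: P'; rewrite -ei => P'.
have := mj j' (ex_intro _ k' P'); rewrite leq_eqVlt => /orP[/eqP ej|]; last by left.
by right; split=> //; apply: mk; rewrite ej.
Qed.

(** * Three powers of the same character *)

Section Independence.
Variables (K : fieldType) (V : lmodType K).
Definition indep2 (u v : V) : Prop := [/\ u != 0, v != 0 & forall c, v <> c *: u].

Lemma indep2_sym u v : indep2 u v -> indep2 v u.
Proof.
case=> u0 v0 uv; split=> // c e; case: (eqVneq c 0) => [c0|c0].
  by case/eqP: u0; rewrite e c0 scale0r.
by apply: (uv c^-1); rewrite e scalerA mulVf ?scale1r.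
Qed.

Lemma indep2_scale u v w c : indep2 u v -> v = c *: w -> indep2 u w.
Proof.
case=> u0 v0 uv e; have w0 : w != 0.
  by apply: contraNneq v0 => w0; rewrite e w0 scaler0.
by split=> // d ed; apply: (uv (c * d)); rewrite e ed scalerA.
Qed.
End Independence.

Section PowersOfSameCharacter.
Variables (K : fieldType) (V : lmodType K).

(* [Q m] says that [m] is a nonzero monomial with character outside [S], and [E m] is the vector
   of its values on a basis of the extensions, if its character lies in [S]. *)
Record powers (L : int -> int -> int -> Prop) (Q : expo -> Prop) (E : expo -> V)
  (a b c : nat) : Prop := Powers {
  pow_lat : lattice L;
  pow_gt0 : [/\ 0 < a, 0 < b & 0 < c]%N;
  pow_L : L a%:Z (- b%:Z) 0 /\ L 0 b%:Z (- c%:Z);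
  pow_Q : forall l, [/\ (l < a)%N -> Q (l, 0, 0)%N, (l < b)%N -> Q (0, l, 0)%N &
    (l < c)%N -> Q (0, 0, l)%N];
  pow_Qout : forall m, Q m -> Lexpo L m (a, 0, 0)%N -> False;
  pow_prop : forall m m' n, Q m -> Q m' -> Lexpo L m m' ->
    exists d, E (addm n m) = d *: E (addm n m');
  pow_share : forall m m', Lexpo L m (a, 0, 0)%N -> Lexpo L m' (a, 0, 0)%N ->
    [|| (0 < m.1.1) && (0 < m'.1.1), (0 < m.1.2) && (0 < m'.1.2) | (0 < m.2) && (0 < m'.2)]%N ->
    ~ indep2 (E m) (E m');
  pow_nil : forall l, [/\ Q (l, 0, 0)%N -> L l%:Z 0 0 -> l = 0%N,
    Q (0, l, 0)%N -> L 0 l%:Z 0 -> l = 0%N & Q (0, 0, l)%N -> L 0 0 l%:Z -> l = 0%N];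
  pow_ind : [/\ indep2 (E (a, 0, 0)%N) (E (0, b, 0)%N), indep2 (E (0, b, 0)%N) (E (0, 0, c)%N) &
    indep2 (E (0, 0, c)%N) (E (a, 0, 0)%N)] }.

Lemma powers_rot L Q E a b c : powers L Q E a b c ->
  powers (fun x y z => L z x y) (fun m => Q (m.2, m.1.1, m.1.2))
    (fun m => E (m.2, m.1.1, m.1.2)) b c a.
Proof.
case=> [[LD LN L1 Lt] [a0 b0 c0] [lab lbc] hQ hQo hP hS hN [i1 i2 i3]].
have lba : L (- a%:Z) b%:Z 0 by apply: (lat_eq (LN _ _ _ lab)); lia.
split=> //.
- by split; [move=> x y z x' y' z'; exact: LD|move=> x y z; exact: LN|exact: L1|move=> x y z; exact: Lt].
- split=> //; apply: (lat_eq (LN _ _ _ (LD _ _ _ _ _ _ lab lbc))); lia.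
- by move=> l; have [] := hQ l.
- move=> m q l; apply: (hQo _ q); rewrite /Lexpo /= in l *.
  by apply: (lat_eq (LD _ _ _ _ _ _ l lba)); lia.
- by move=> m m' n q q' l; exact: (hP _ _ (n.2, n.1.1, n.1.2) q q' l).
- move=> m m' l l' h; apply: hS; rewrite /Lexpo /= in l l' *; last by lia.
  + by apply: (lat_eq (LD _ _ _ _ _ _ l lba)); lia.
  by apply: (lat_eq (LD _ _ _ _ _ _ l' lba)); lia.
- by move=> l; have [] := hN l.
Qed.

(** Dividing x^p y^q by a power of xyz yields two equivalent nonzero monomials outside S. By
    [pow_prop] one of the three pure powers then has a value proportional to that of a monomial
    sharing a letter with another of them, against independence. *)
Lemma powers_no_square L Q E a b c p q : powers L Q E a b c ->
  (0 < p <= a)%N -> (0 < q <= b)%N -> L p%:Z q%:Z 0 -> False.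
Proof.
move=> pw pa qb lpq; case: (pw) => [lat [a0 b0 c0] [lab lbc] hQ hQo hP hS hN [i1 i2 i3]].
have L1 := lat1 lat.
have LM (n : nat) : L n%:Z n%:Z n%:Z.
  elim: n => [|n IH]; first by apply: (lat_eq (latD lat L1 (latN lat L1))); lia.
  by apply: (lat_eq (latD lat L1 IH)); lia.
have lpc n := latD lat lpq (latN lat (LM n)).
have lbc' := latN lat lbc; have lab' := latN lat lab.
(* The power of xyz to divide by is the least of p, q and c. *)
have [h|h] := boolP ((c <= p) && (c <= q))%N.
  have Qp : Q (p - c, 0, 0)%N by have [h1 _ _] := hQ (p - c)%N; apply: h1; lia.
  have [e|ne] := eqVneq q c.
    apply: (hQo _ Qp); rewrite /Lexpo /=.
    by apply: (lat_eq (latD lat (latD lat (lpc c) lbc') lab')); lia.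
  have Ql : Q (0, b - q + c, 0)%N by have [_ h1 _] := hQ (b - q + c)%N; apply: h1; lia.
  have l1 := latD lat (lpc c) lbc'.
  have [e|ne'] := eqVneq p c.
    have [_ h1 _] := hN (b - q + c)%N; suff : (b - q + c = 0)%N by lia.
    by apply: h1 => //; apply: (lat_eq (latN lat l1)); lia.
  have [|d] := hP _ _ (0, q - c, 0)%N Ql Qp.
    by rewrite /Lexpo /=; apply: (lat_eq (latN lat l1)); lia.
  rewrite /addm /= add0n addn0; have -> : (q - c + (b - q + c) = b)%N by lia.
  move=> eE; have := indep2_scale i1 eE; apply: hS; rewrite /Lexpo /=; last by lia.
    by apply: (lat_eq (latD lat L1 (latN lat L1))); lia.
  by apply: (lat_eq (latD lat l1 lab')); lia.
have [h1|h1] := leqP p q.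
  have l1 := lpc p.
  have Qq : Q (0, q - p, 0)%N by have [_ h2 _] := hQ (q - p)%N; apply: h2; lia.
  have Qp : Q (0, 0, p)%N by have [_ _ h2] := hQ p; apply: h2; lia.
  have [e|ne] := eqVneq q p.
    have [_ _ h2] := hN p; suff : (p = 0)%N by lia.
    by apply: h2 => //; apply: (lat_eq (latN lat l1)); lia.
  have [|d] := hP _ _ (0, 0, c - p)%N Qp Qq.
    by rewrite /Lexpo /=; apply: (lat_eq (latN lat l1)); lia.
  rewrite /addm /= add0n addn0; have -> : (c - p + p = c)%N by lia.
  move=> eE; have := indep2_scale i2 eE; apply: hS; rewrite /Lexpo /=; last by lia.
    by apply: (lat_eq lab'); lia.
  by apply: (lat_eq (latD lat (latD lat l1 lbc') lab')); lia.
have l1 := lpc q.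
have Qq : Q (p - q, 0, 0)%N by have [h2 _ _] := hQ (p - q)%N; apply: h2; lia.
have Qp : Q (0, 0, q)%N by have [_ _ h2] := hQ q; apply: h2; lia.
have [|d] := hP _ _ (0, 0, c - q)%N Qp Qq.
  by rewrite /Lexpo /=; apply: (lat_eq (latN lat l1)); lia.
rewrite /addm /= !add0n addn0; have -> : (c - q + q = c)%N by lia.
move=> eE; have := indep2_scale (indep2_sym i3) eE; apply: hS; rewrite /Lexpo /=; last by lia.
  by apply: (lat_eq (latD lat L1 (latN lat L1))); lia.
by apply: (lat_eq (latD lat (latD lat l1 lbc') lab')); lia.
Qed.

End PowersOfSameCharacter.

(** * Rational functions of one parameter *)

Section Rational.
Variable K : numFieldType.

Lemma poly_fun0 (P : {poly K}) : (forall r, P.[r] = 0) -> P = 0.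
Proof.
move=> P0; apply: (@roots_geq_poly_eq0 _ _ [seq n%:R | n <- iota 0 (size P)]).
- by apply/allP => x _; rewrite /root P0.
- by rewrite map_inj_uniq ?iota_uniq // => m n /eqP; rewrite eqr_nat => /eqP.
- by rewrite size_map size_iota.
Qed.

(** Regular functions on the open set where [Q] does not vanish. Values at the zeros of [Q] are
    unconstrained, so quotients may be used there with their conventional values. *)
Definition ratl (Q : {poly K}) (f : K -> K) : Prop :=
  exists M (P : {poly K}), forall r, Q.[r] != 0 -> f r * Q.[r] ^+ M = P.[r].

Lemma ratl_poly Q (P : {poly K}) : ratl Q (fun r => P.[r]).
Proof. by exists 0%N, P => r _; rewrite mulr1. Qed.

Lemma ratl_const Q c : ratl Q (fun=> c).
Proof. by exists 0%N, c%:P => r _; rewrite mulr1 hornerC. Qed.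

Lemma ratlM Q f g : ratl Q f -> ratl Q g -> ratl Q (fun r => f r * g r).
Proof.
move=> [M [P eP]] [M' [P' eP']]; exists (M + M')%N, (P * P') => r Qr.
by rewrite hornerM -eP // -eP' // exprD; ring.
Qed.

Lemma ratlD Q f g : ratl Q f -> ratl Q g -> ratl Q (fun r => f r + g r).
Proof.
move=> [M [P eP]] [M' [P' eP']]; exists (M + M')%N, (P * Q ^+ M' + P' * Q ^+ M) => r Qr.
by rewrite hornerD !hornerM !horner_exp -eP // -eP' // exprD; ring.
Qed.

Lemma ratlX Q f n : ratl Q f -> ratl Q (fun r => f r ^+ n).
Proof.
move=> [M [P eP]]; exists (M * n)%N, (P ^+ n) => r Qr.
by rewrite horner_exp -eP // exprMn exprM.
Qed.

Lemma ratl_div Q (P P' P'' : {poly K}) : Q = P' * P'' -> ratl Q (fun r => P.[r] / P'.[r]).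
Proof.
move=> e; exists 1%N, (P * P'') => r; rewrite e !hornerM mulf_eq0 negb_or => /andP[h1 h2].
by field.
Qed.

Lemma ratl_mul0 Q f g : Q != 0 -> ratl Q f -> ratl Q g ->
  (forall r, Q.[r] != 0 -> f r * g r = 0) ->
  (forall r, Q.[r] != 0 -> f r = 0) \/ (forall r, Q.[r] != 0 -> g r = 0).
Proof.
move=> Q0 [M [P eP]] [M' [P' eP']] fg.
have : P * P' * Q = 0.
  apply: poly_fun0 => r; rewrite !hornerM; have [->|Qr] := eqVneq Q.[r] 0; first by rewrite mulr0.
  by rewrite -eP // -eP' // mulrACA fg // !mul0r.
have div0 R h N : (forall r, Q.[r] != 0 -> h r * Q.[r] ^+ N = R.[r]) -> R = 0 ->
    forall r, Q.[r] != 0 -> h r = 0.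
  move=> e R0 r Qr; apply: (mulIf (expf_neq0 N Qr)).
  by rewrite e // R0 horner0 mul0r.
move/eqP; rewrite !mulf_eq0 (negbTE Q0) orbF => /orP[] /eqP e0.
- by left; apply: div0 eP e0.
- by right; apply: div0 eP' e0.
Qed.

End Rational.

(* Four products of linear forms in two variables lie in the three-dimensional space of
   quadratic forms. *)
Lemma bilinear_relation (K : fieldType) (f f' g g' : 'I_2 -> K) :
  exists al be ga de : K, ~ [/\ al = 0, be = 0, ga = 0 & de = 0] /\
  forall lam : 'I_2 -> K, let ev (h : 'I_2 -> K) := \sum_l lam l * h l in
    al * (ev f * ev g) + be * (ev f * ev g') + ga * (ev f' * ev g) + de * (ev f' * ev g') = 0.
Proof.
pose F (i : 'I_4) := nth f [:: f; f; f'; f'] i.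
pose G (i : 'I_4) := nth g [:: g; g'; g; g'] i.
pose A := \matrix_(i < 4, j < 3) sel (F i 0 * G i 0) (F i 0 * G i 1 + F i 1 * G i 0) (F i 1 * G i 1) j.
have : kermx A != 0.
  by rewrite -mxrank_eq0 mxrank_ker subn_eq0 -ltnNge (leq_ltn_trans (rank_leq_col A)).
case/rowV0Pn => v /sub_kermxP/rowP rel nz.
have sum4 (h : 'I_4 -> K) : \sum_i h i = h ord0 + h (lift ord0 ord0) +
    h (lift ord0 (lift ord0 ord0)) + h (lift ord0 (lift ord0 (lift ord0 ord0))).
  by rewrite !big_ord_recl big_ord0 addr0 !addrA.
exists (v 0 ord0), (v 0 (lift ord0 ord0)), (v 0 (lift ord0 (lift ord0 ord0))),
  (v 0 (lift ord0 (lift ord0 (lift ord0 ord0)))); split.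
  case=> a0 b0 c0 d0; case/eqP: nz; apply/rowP => i; rewrite mxE.
  case: (unliftP ord0 i) => [i1|] ->; last exact: a0.
  case: (unliftP ord0 i1) => [i2|] ->; last exact: b0.
  case: (unliftP ord0 i2) => [i3|] ->; last exact: c0.
  by rewrite (ord1 i3).
move=> lam ev.
have evE h : ev h = lam 0 * h 0 + lam 1 * h 1.
  rewrite /ev !big_ord_recl big_ord0 addr0; have -> : lift ord0 ord0 = 1 :> 'I_2 by apply: val_inj.
  by [].
transitivity (\sum_i v 0 i * (ev (F i) * ev (G i))); first by rewrite sum4.
transitivity (lam 0 ^+ 2 * (v *m A) 0 lx + lam 0 * lam 1 * (v *m A) 0 ly + lam 1 ^+ 2 * (v *m A) 0 lz).
  rewrite !mxE !mulr_sumr -!big_split; apply: eq_bigr => i _; rewrite !mxE /sel /= !evE; ring.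
by rewrite !rel !mxE !mulr0 !addr0.
Qed.

(** The default 0 of the maximum keeps the amount of flow chosen with it nonnegative. *)
Lemma max_ex (s : seq rat) : exists e : rat,
  [/\ 0 <= e, forall x, x \in s -> x <= e & e = 0 \/ e \in s].
Proof.
elim: s => [|x s [e [e0 es ei]]]; first by exists 0; split=> //; left.
have [xe|ex] := lerP x e.
  exists e; split=> //; last by case: ei => [->|h]; [left|right; rewrite inE h orbT].
  by move=> y; rewrite inE => /orP[/eqP->|/es].
exists x; split; first exact: le_trans (ltW ex).
  by move=> y; rewrite inE => /orP[/eqP->|/es h] //; exact: le_trans (ltW ex).
by right; rewrite inE eqxx.
Qed.

Lemma eps_ex (s : seq rat) : exists2 e : rat, 0 < e & forall x, x \in s -> 0 < x -> e <= x.
Proof.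
elim: s => [|x s [e e0 es]]; first by exists 1.
exists (if 0 < x then Num.min e x else e); first by case: ifP => // x0; rewrite lt_min e0 x0.
move=> y; rewrite inE => /orP[/eqP->|/es h] y0; first by rewrite y0 ge_min lexx orbT.
by case: ifP => _; rewrite ?ge_min h.
Qed.

(** * Feasible flows on a finite graph *)

Section Flow.
Variables (I A : finType) (s t : A -> I).

Definition flux (R : pzRingType) (n : A -> R) (i : I) : R :=
  \sum_a n a * ((t a == i)%:R - (s a == i)%:R).

Lemma flux_sum (R : pzRingType) (n : A -> R) (W : {set I}) :
  \sum_(i in W) flux n i = \sum_a n a * ((t a \in W)%:R - (s a \in W)%:R).
Proof.
have ind (x : I) : \sum_(i in W) (x == i)%:R = (x \in W)%:R :> R.
  have [xW|xW] := boolP (x \in W).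
    rewrite (bigD1 x) //= eqxx big1 ?addr0 // => i /andP[_ /negbTE]; by rewrite eq_sym => ->.
  by rewrite big1 // => i iW; case: eqP => // e; rewrite e iW in xW.
rewrite /flux exchange_big; apply: eq_bigr => a _.
by rewrite -mulr_sumr sumrB !ind.
Qed.

(* Removing an edge [a] of the graph, some amount of flow through [a] keeps the cut condition:
   two cuts bounding this amount from both sides can be uncrossed. *)
Lemma flow_ex (E : {set A}) (b : I -> rat) : \sum_i b i = 0 ->
  (forall W : {set I}, (forall a, a \in E -> s a \in W -> t a \in W) -> 0 <= \sum_(i in W) b i) ->
  exists n : A -> rat, [/\ forall a, 0 <= n a, forall a, a \notin E -> n a = 0 &
    forall i, flux n i = b i].
Proof.
have [m] := ubnP #|E|; elim: m E b => // m IH E b Em b0 cut.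
have [E0|[a aE]] := set_0Vmem E.
  have pos i : 0 <= b i.
    by have := cut [set i]; rewrite big_set1 => h; apply: h => a; rewrite E0 in_set0.
  exists (fun=> 0); split=> // i; rewrite /flux big1 => [|a _]; last by rewrite mul0r.
  by have e := psumr_eq0P (fun i _ => pos i) b0; rewrite e.
pose cl (W : {set I}) := [forall a', (a' \in E :\ a) ==> (s a' \in W) ==> (t a' \in W)].
have clP (W : {set I}) : reflect (forall a', a' \in E :\ a -> s a' \in W -> t a' \in W) (cl W).
  apply: (iffP forallP) => h a'; first by move=> h1 h2; have := h a'; rewrite h1 h2.
  by apply/implyP => h1; apply/implyP; exact: h.
pose B (W : {set I}) := \sum_(i in W) b i.
have clE W : cl W -> (s a \in W -> t a \in W) -> 0 <= B W.
  move/clP => cW h; apply: cut => a' a'E; have [->//|ne] := eqVneq a' a.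
  by apply: cW; rewrite !inE ne.
(* Through [a] is sent the least amount [e] that the sets left by [a] permit; it has to be at most
   what the sets entered by [a] permit. *)
pose ls := [seq - B W | W <- enum [pred W | [&& cl W, s a \in W & t a \notin W]]].
have [e [e0 le_e ei]] := max_ex ls.
have low W : cl W -> s a \in W -> t a \notin W -> - B W <= e.
  by move=> h1 h2 h3; apply: le_e; apply/mapP; exists W; rewrite // mem_enum inE h1 h2.
have upp W : cl W -> s a \notin W -> t a \in W -> e <= B W.
  move=> h1 h2 h3; case: ei => [->|/mapP[W']]; first by apply: clE; rewrite // (negbTE h2).
  rewrite mem_enum inE => /and3P[h1' h2' h3'] ->.
  (* The union contains the target of [a] and the intersection misses its source, so the cut
     condition holds for both. *)
  have : 0 <= B (W :|: W') + B (W :&: W').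
    apply: addr_ge0; apply: clE.
    - apply/clP => a' a'E; rewrite !inE => /orP[h|h].
        by rewrite (clP _ h1).
      by rewrite (clP _ h1' a') ?orbT.
    - by move=> _; rewrite inE h3.
    - apply/clP => a' a'E; rewrite !inE => /andP[h h'].
      by rewrite (clP _ h1) // (clP _ h1').
    - by rewrite inE (negbTE h2).
  have -> : B (W :|: W') + B (W :&: W') = B W + B W'.
    have e1 : B (W :|: W') = B W + B (W' :\: W).
      by rewrite /B (big_setID W) /= setUK setDUl setDv set0U.
    have e2 : B W' = B (W :&: W') + B (W' :\: W).
      by rewrite /B (big_setID W) /= setIC.
    by rewrite e1 e2; ring.
  lra.
pose b' i := b i - e * ((t a == i)%:R - (s a == i)%:R).
have sumb' (W : {set I}) : \sum_(i in W) b' i = B W - e * ((t a \in W)%:R - (s a \in W)%:R).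
  have single (F : A -> rat) : \sum_a' (a' == a)%:R * e * F a' = e * F a.
    rewrite (bigD1 a) //= big1 => [|a' /negbTE->]; last by rewrite !mul0r.
    by rewrite eqxx mul1r addr0.
  rewrite -[e * _](single (fun a' => (t a' \in W)%:R - (s a' \in W)%:R)) -flux_sum /B -sumrB.
  by apply: eq_bigr => i _; rewrite /b' /flux single.
have [|||n [n0 nE nb]] := IH (E :\ a) b'.
- by move: Em; rewrite (cardsD1 a) aE.
- have := sumb' [set: I]; rewrite !inE subrr mulr0 subr0 /B.
  by rewrite !(eq_bigl _ _ (in_setT (T := I))) => ->.
- move=> W /clP cW; rewrite sumb'.
  have [h2|h2] := boolP (s a \in W); have [h3|h3] := boolP (t a \in W); rewrite ?subrr ?mulr0 ?subr0.
  + by apply: clE.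
  + by rewrite sub0r mulrN1 opprK -[B W]opprK addrC subr_ge0; exact: low.
  + by rewrite mulr1 subr_ge0; exact: upp.
  + by apply: clE; rewrite // (negbTE h2).
exists (fun a' => n a' + (a' == a)%:R * e); split.
- by move=> a'; rewrite addr_ge0 // mulr_ge0 // ler0n.
- move=> a' a'E; have ne : a' != a by apply: contraNneq a'E => ->.
  by rewrite nE ?(negbTE ne) ?mul0r ?addr0 // !inE ne.
move=> i; rewrite /flux; under eq_bigr do rewrite mulrDl.
rewrite big_split /= -/(flux n i) nb /b' (bigD1 a) //= big1 => [|a' /negbTE->]; last by rewrite !mul0r.
by rewrite eqxx mul1r addr0 subrK.
Qed.

Lemma clear_denominators (n : A -> rat) : (forall a, 0 <= n a) ->
  exists (m : nat) (N : A -> nat), (0 < m)%N /\ forall a, (N a)%:R = n a * m%:R.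
Proof.
move=> n0; exists (\prod_a `|denq (n a)|)%N.
exists (fun a => `|numq (n a)| * \prod_(a' | a' != a) `|denq (n a')|)%N; split.
  by rewrite prodn_gt0 // => a; rewrite absz_gt0 denq_neq0.
move=> a; rewrite [in RHS](bigD1 a) //= !natrM mulrA; congr (_ * _).
by rewrite !natr_absz ger0_norm ?numq_ge0 // gtr0_norm ?denq_gt0 // numqE.
Qed.

End Flow.

(** * Paths in the McKay quiver *)

Section McKayQuiver.
Variables (I : finType) (K : numFieldType) (st : 'I_3 -> I -> I) (o : I).
Variable (L : int -> int -> int -> Prop).
Hypothesis st_comm : forall j k i, st j (st k i) = st k (st j i).
Hypothesis st_inj : forall j, injective (st j).

(* [a j i] is the scalar of the arrow from the character [i] to [st j i], that is, of the action of
   the [j]-th eigencoordinate. *)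
Definition data := 'I_3 -> I -> K.

Fixpoint mv (i : I) (w : seq 'I_3) : I := if w is j :: w' then mv (st j i) w' else i.
Fixpoint pv (a : data) (i : I) (w : seq 'I_3) : K :=
  if w is j :: w' then a j i * pv a (st j i) w' else 1.
Lemma data_ext (a b : data) : (forall j i, a j i = b j i) -> a = b.
Proof. by move=> e; apply/funext => j; apply/funext => i. Qed.

Definition comm (a : data) := forall j k i, a j i * a k (st j i) = a k i * a j (st k i).
Definition arrow_closed (a : data) (W : {set I}) :=
  forall j i, i \in W -> a j i != 0 -> st j i \in W.

Lemma mv_cat i w w' : mv i (w ++ w') = mv (mv i w) w'.
Proof. by elim: w i => //= j w IH i. Qed.

Lemma mv_rcons i w j : mv i (rcons w j) = st j (mv i w).
Proof. by rewrite -cats1 mv_cat. Qed.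

Lemma mv_cons i j w : mv i (j :: w) = st j (mv i w).
Proof. by elim: w i => //= k w IH i; rewrite -IH /= st_comm. Qed.

Lemma mv_catC i w w' : mv i (w ++ w') = mv i (w' ++ w).
Proof.
elim: w i => [|j w IH] i; first by rewrite cats0.
by rewrite cat_cons [LHS]/= IH [RHS]mv_cat mv_cons -mv_cat -mv_cons.
Qed.

Lemma mv_perm i w w' : perm_eq w w' -> mv i w = mv i w'.
Proof.
move=> p; apply: (catCA_perm_ind (P := fun v => mv i w = mv i v) _ p) => // s1 s2 s3 ->.
by rewrite !catA !(mv_cat i (_ ++ _)) mv_catC.
Qed.

Lemma pv_cat a i w w' : pv a i (w ++ w') = pv a i w * pv a (mv i w) w'.
Proof. by elim: w i => [|j w IH] i /=; rewrite ?mul1r // IH mulrA. Qed.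

Lemma pv_rcons a i w j : pv a i (rcons w j) = pv a i w * a j (mv i w).
Proof. by rewrite -cats1 pv_cat /= mulr1. Qed.

Lemma pv_cons a (ca : comm a) i j w : pv a i (j :: w) = pv a i (rcons w j).
Proof.
elim: w i => //= k w IH i.
rewrite -IH /= !mulrA [a j i * _]ca; congr (_ * _ * pv a _ w); exact: st_comm.
Qed.

Lemma pv_catC a (ca : comm a) i w w' : pv a i (w ++ w') = pv a i (w' ++ w).
Proof.
elim: w w' i => [|j w IH] w' i; first by rewrite cats0.
by rewrite cat_cons (pv_cons ca) -cats1 -catA IH -catA.
Qed.

Lemma pv_perm a (ca : comm a) i w w' : perm_eq w w' -> pv a i w = pv a i w'.
Proof.
move=> p; apply: (catCA_perm_ind (P := fun v => pv a i w = pv a i v) _ p) => // s1 s2 s3 ->.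
by rewrite !catA !(pv_cat a i (_ ++ _)) pv_catC // mv_catC.
Qed.

Lemma arrow_closed_pv a W i w : arrow_closed a W -> i \in W -> pv a i w != 0 -> mv i w \in W.
Proof.
move=> cW; elim: w i => //= j w IH i iW; rewrite mulf_eq0 negb_or => /andP[h1 h2].
by apply: IH => //; apply: cW.
Qed.

Lemma pv_comm a (ca : comm a) i w w' :
  pv a i w * pv a (mv i w) w' = pv a i w' * pv a (mv i w') w.
Proof. by rewrite -!pv_cat pv_catC. Qed.

Hypothesis latL : lattice L.
Hypothesis L_mv : forall m m' : expo, mv o (mon m) = mv o (mon m') <-> Lexpo L m m'.
Local Notation pvo a m := (pv a o (mon m)).
Local Notation mvo m := (mv o (mon m)).

Definition cluster (a : data) := comm a /\ forall i, exists2 w, mv o w = i & pv a o w != 0.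
Definition geq (a b : data) := exists2 c : I -> K, (forall i, c i != 0) &
  forall j i, b j i = (c i)^-1 * c (st j i) * a j i.
Definition chart_data (k : 'I_3 -> I -> expo) (p : 'I_3 -> K) : data := fun j i => qpow p (k j i).

Lemma geq_pv (a b : data) : geq a b -> exists2 c : I -> K, (forall i, c i != 0) &
  forall i w, pv b i w = (c i)^-1 * c (mv i w) * pv a i w.
Proof.
case=> c c0 e; exists c => // i w; elim: w i => [|j w IH] i /=.
  by rewrite mulVf ?mul1r ?c0.
rewrite IH e; field; rewrite !c0 //.
Qed.

Lemma pv_mon (a : data) (ca : comm a) i w : pv a i w = pv a i (mon (cnt w)).
Proof. exact/pv_perm/perm_mon. Qed.

Lemma mv_mon i w : mv i w = mv i (mon (cnt w)).
Proof. exact/mv_perm/perm_mon. Qed.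

Lemma mon_add_perm m n : perm_eq (mon (addm m n)) (mon m ++ mon n).
Proof. by apply: cnt_perm; rewrite cnt_cat !cnt_mon. Qed.

Lemma mv_addm i m n : mv i (mon (addm m n)) = mv (mv i (mon m)) (mon n).
Proof. by rewrite (mv_perm _ (mon_add_perm m n)) mv_cat. Qed.

Lemma pv_addm (a : data) (ca : comm a) i m n :
  pv a i (mon (addm m n)) = pv a i (mon m) * pv a (mv i (mon m)) (mon n).
Proof. by rewrite (pv_perm ca _ (mon_add_perm m n)) pv_cat. Qed.

(** * The monomial chart around a cluster *)

Definition rep_set (rep : I -> expo) (i j k : nat) : Prop :=
  rep (mvo (i, j, k)) = (i, j, k).

Lemma in_rep_set rep m : in_expo (rep_set rep) m <-> rep (mvo m) = m.
Proof. by case: m => [[i j] k]. Qed.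

(* Standard monomials of the ideal of a cluster, for the lexicographic order. *)
Lemma standard_ex (X : data) : cluster X -> exists rep : I -> expo,
  [/\ forall i, mvo (rep i) = i, forall i, pvo X (rep i) != 0 &
      standard L (rep_set rep)].
Proof.
move=> [cX cyc].
pose good i m := mvo m = i /\ pvo X m != 0.
have /fin_all_exists [rep repP] : forall i, exists m, good i m /\ forall m', good i m' -> lexle m m'.
  move=> i; have [|m gm mm] := @lexmin_ex (good i); last by exists m.
  by have [w ew vw] := cyc i; exists (cnt w); rewrite /good -mv_mon -pv_mon.
have repC i := (repP i).1.1; have repV i := (repP i).1.2.
have repM i m : mvo m = i -> pvo X m != 0 -> lexle (rep i) m.
  by move=> e v; apply: (repP i).2.
exists rep; split=> //; split=> //.
- move=> i j k i' j' k' hi hj hk g'; rewrite /rep_set.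
  pose m : expo := (i, j, k); pose n : expo := (i' - i, j' - j, k' - k)%N.
  have em : (i', j', k') = addm m n by rewrite /addm /=; congr (_, _, _); lia.
  have := repV (mvo (i', j', k')); rewrite g' em pv_addm // mulf_eq0 negb_or => /andP[v1 v2].
  (* Minimality of [r] gives r <= m; minimality of m + n among the nonzero monomials of its
     character gives m + n <= r + n. Translation invariance of the order yields r = m. *)
  set r := rep _; have rC : mvo r = mvo m by exact: repC.
  have le1 : lexle r m by apply: repM.
  have le2 : lexle (addm m n) (addm r n).
    have : lexle (rep (mvo (i', j', k'))) (addm r n).
      apply: repM; first by rewrite em !mv_addm rC.
      by rewrite pv_addm // mulf_neq0 ?rC // repV.
    by rewrite g' em.
  move: le1 le2; rewrite /lexle; case: r {rC} => [[r1 r2] r3] /=.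
  by move=> h1 h2; congr (_, _, _); lia.
- move=> i j k; case e: (rep (mvo (i, j, k))) => [[i' j'] k'].
  exists i', j', k'; split; first by rewrite /rep_set -e repC.
  by apply/(L_mv (i, j, k) (i', j', k')); rewrite -e repC.
- move=> i j k i' j' k' g g' /(L_mv (i, j, k) (i', j', k')) e.
  by move: g; rewrite /rep_set e g' => -[-> -> ->].
Qed.

Lemma normalized_pv rep (Y : data) : comm Y -> (forall i, mvo (rep i) = i) ->
  (forall i, pvo Y (rep i) != 0) ->
  normalized L (rep_set rep) (fun m => pvo Y m / pvo Y (rep (mvo m))).
Proof.
move=> cY repC v0; split=> [i j k g|i j k i' j' k' p q r g' l].
  by rewrite g divff // -g v0.
have e : mvo (i, j, k) = mvo (i', j', k') by apply/L_mv.
rewrite -[(i + p, _, _)%N]/(addm (i, j, k) (p, q, r)) -[(i' + p, _, _)%N]/(addm (i', j', k') (p, q, r)).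
rewrite !mv_addm !pv_addm // e g'; field.
rewrite v0 /=; have := v0 (mvo (i', j', k')); by rewrite g'.
Qed.

(** [rep] is the monomial basis, the ratios of [g] to [r] are the coordinates, [k] expresses the
    arrows by them; [co_geq] puts every point where the basis does not vanish into the chart. *)
Record coords (rep : I -> expo) (g r : 'I_3 -> expo) (k : 'I_3 -> I -> expo) : Prop := Coords {
  co_rep : forall i, mvo (rep i) = i;
  co_mv : forall l, mvo (g l) = mvo (r l);
  co_red : forall l, rep (mvo (r l)) = r l;
  co_comm : forall p, comm (chart_data k p);
  co_pv : forall p i, pvo (chart_data k p) (rep i) = 1;
  co_gen : forall p l, pvo (chart_data k p) (g l) = p l;
  co_geq : forall Y, comm Y -> (forall i, pvo Y (rep i) != 0) ->
    geq Y (chart_data k (fun l => pvo Y (g l) / pvo Y (r l))) }.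

Lemma coords_ex X : cluster X -> exists rep g r k,
  coords rep g r k /\ forall i, pvo X (rep i) != 0.
Proof.
move=> clX; have [rep [repC repV std]] := standard_ex clX.
have [g1 [g2 [g3 [r1 [r2 [r3 ch]]]]]] := chart_ex K std.
pose e j : expo := sel (1, 0, 0)%N (0, 1, 0)%N (0, 0, 1)%N j.
have e_mon j : mon (e j) = [:: j] by case: (letterP j).
have stp i j : step_ok K L (rep_set rep) g1 g2 g3 r1 r2 r3 (addm (rep i) (e j)).
  have gi : in_expo (rep_set rep) (rep i) by apply/in_rep_set; rewrite repC.
  have [] := chart_step ch gi; case: (rep i) => [[x y] z] /=.
  by case: (letterP j); rewrite /addm /= !addn0 !addn1.
have lat_mul (q : nat) x y z : L x y z -> L (q%:Z * x) (q%:Z * y) (q%:Z * z).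
  move=> l; elim: q => [|q IH].
    by apply: (lat_eq (latD latL l (latN latL l))); lia.
  by apply: (lat_eq (latD latL l IH)); rewrite intS mulrDl mul1r.
have step_mv m m' q : expo_step m m' q g1 g2 g3 r1 r2 r3 -> mvo m = mvo m'.
  case=> h1 h2 h3; apply/L_mv; rewrite /Lexpo h1 h2 h3; have [l1 l2 l3] := chart_gen ch.
  by apply: (latD latL); [apply: (latD latL)|]; apply: lat_mul.
have /fin_all_exists [kk kkP] : forall ji : 'I_3 * I, exists q,
    expo_step (addm (rep ji.2) (e ji.1)) (rep (st ji.1 ji.2)) q g1 g2 g3 r1 r2 r3 /\
    forall X, normalized L (rep_set rep) X ->
      X (addm (rep ji.2) (e ji.1)) = qmon X g1 g2 g3 q :> K.
  case=> j i /=; have [m' [q [hm hq hX]]] := stp i j; exists q; split=> //.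
  move/in_rep_set: hm hq => hm hq; have em := step_mv _ _ _ hq.
  suff <- : m' = rep (st j i) by [].
  by rewrite -hm -em mv_addm // repC e_mon.
pose k j i := kk (j, i).
pose g := sel g1 g2 g3; pose r := sel r1 r2 r3.
have path p i w : exists2 q, expo_step (addm (rep i) (cnt w)) (rep (mv i w)) q g1 g2 g3 r1 r2 r3 &
    pv (chart_data k p) i w = qpow p q.
  elim: w i => [|j w IH] i /=.
    exists (0, 0, 0)%N; last by rewrite /qpow /= !expr0 !mulr1.
    by case: (rep i) => [[x y] z]; rewrite /addm /= !addn0; exact: estep0.
  have [q hq eq] := IH (st j i); have [hk _] := kkP (j, i).
  exists (addm (k j i) q); last by rewrite eq qpowD.
  have -> : addm (rep i) (cnt (j :: w)) = addm (addm (rep i) (e j)) (cnt w).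
    by rewrite /cnt /addm /=; case: (letterP j) => /=; congr (_, _, _); lia.
  exact: estep_add hk hq.
have rep_o : rep o = (0, 0, 0)%N.
  by have := std0 std; rewrite /rep_set.
have path0 p m : exists2 q, expo_step m (rep (mvo m)) q g1 g2 g3 r1 r2 r3 &
    pvo (chart_data k p) m = qpow p q.
  have [q hq eq] := path p o (mon m); exists q => //.
  by move: hq; rewrite rep_o cnt_mon; case: (m) => [[x y] z].
have [l1 l2 l3] := chart_gen ch; have [r1P r2P r3P] := chart_red ch.
have gr l : mvo (g l) = mvo (r l) by apply/L_mv; case: (letterP l).
have rr l : rep (mvo (r l)) = r l by apply/in_rep_set; case: (letterP l).
exists rep, g, r, k; split=> //; split=> //.
(* Both composites join the same end points, which determine the exponents of the coordinates. *)
- move=> p j l i; rewrite /chart_data -!qpowD; congr qpow.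
  have [h1 _] := kkP (j, i); have [h2 _] := kkP (l, st j i).
  have [f1 _] := kkP (l, i); have [f2 _] := kkP (j, st l i).
  move: (estep_add h1 h2) (estep_add f1 f2) => /= e1 e2.
  apply: (estep_uniq ch e1); move: e2; rewrite st_comm /=.
  suff -> : addm (addm (rep i) (e l)) (e j) = addm (addm (rep i) (e j)) (e l) by [].
  by rewrite /addm /=; congr (_, _, _); lia.
- move=> p i; have [q hq ->] := path0 p (rep i).
  move: hq; rewrite repC => hq; rewrite -(estep_uniq ch (estep0 g1 g2 g3 r1 r2 r3 _) hq).
  by rewrite /qpow /= !expr0 !mulr1.
- move=> p l; have [q hq ->] := path0 p (g l).
  move: hq; rewrite gr rr => hq; rewrite -(estep_uniq ch (q := e l) _ hq).
    by case: (letterP l); rewrite /qpow /= !expr0 ?mulr1 ?mul1r expr1.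
  by case: (letterP l); rewrite /expo_step /=; split; rewrite !mul0r mul1r ?addr0 ?add0r.
move=> Y cY v0; exists (fun i => (pvo Y (rep i))^-1); first by move=> i; rewrite invr_eq0.
move=> j i; have [_ /(_ _ (normalized_pv cY repC v0))] := kkP (j, i).
rewrite /chart_data -/(k j i) /qmon /qpow /=.
rewrite pv_addm // mv_addm // repC e_mon /= mulr1.
rewrite -[g1]/(g lx) -[g2]/(g ly) -[g3]/(g lz) !gr !rr => <-.
by rewrite invrK mulrAC.
Qed.

(** * Changing the arrows that enter a submodule *)

Section Cross.
Variables (X : data) (S : {set I}).
Hypothesis cS : arrow_closed X S.

(* Extensions of the quotient of [X] by its submodule of support [S], by this submodule. *)
Definition cross (t : data) : data :=
  fun j i => if (i \notin S) && (st j i \in S) then t j i else X j i.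

Lemma pv_stuck i w : i \in S -> mv i w \notin S -> pv X i w = 0.
Proof.
by move=> iS; apply: contraNeq => v; apply: (arrow_closed_pv cS iS v).
Qed.

Lemma cross_in t i w : i \in S -> pv (cross t) i w = pv X i w.
Proof.
elim: w i => //= j w IH i iS; rewrite {1}/cross iS /=.
have [h|h] := boolP (st j i \in S); first by rewrite IH.
have -> : X j i = 0 by apply: contraNeq h => v; apply: cS.
by rewrite !mul0r.
Qed.

Lemma cross_out t i w : mv i w \notin S -> pv (cross t) i w = pv X i w.
Proof.
have [iS mS|] := boolP (i \in S); first exact: cross_in.
elim: w i => //= j w IH i iS mS.
have [h|h] := boolP (st j i \in S).
  by rewrite cross_in // pv_stuck // !mulr0.
by rewrite {1}/cross (negbTE h) andbF IH.
Qed.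

(** A path of nonzero value enters S once and stays there, so its value is linear in the arrows
    entering S. *)
Lemma cross_sum n (lam : 'I_n -> K) (T : 'I_n -> data) i w : i \notin S -> mv i w \in S ->
  pv (cross (fun j i => \sum_l lam l * T l j i)) i w = \sum_l lam l * pv (cross (T l)) i w.
Proof.
elim: w i => [|j w IH] i iS /= mS; first by rewrite mS in iS.
have [h|h] := boolP (st j i \in S).
  rewrite cross_in // /cross iS h /= mulr_suml; apply: eq_bigr => l _.
  by rewrite -/(cross (T l)) cross_in // mulrA.
rewrite IH // {1}/cross (negbTE h) andbF mulr_sumr; apply: eq_bigr => l _.
by rewrite [in RHS]/cross (negbTE h) andbF -/(cross (T l)) mulrCA.
Qed.

Lemma comm_pv (a : data) : comm a <-> forall j k i, pv a i [:: j; k] = pv a i [:: k; j].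
Proof.
split=> h j k i; first by rewrite /= !mulr1 h.
by have := h j k i; rewrite /= !mulr1.
Qed.

(** A commutation relation compares two paths with the same ends: it is linear in the changed arrows
    if these ends are separated by S, and a relation of [X] otherwise. *)
Lemma cross_comm_sum n (lam : 'I_n -> K) (T : 'I_n -> data) : comm X ->
  (forall l, comm (cross (T l))) -> comm (cross (fun j i => \sum_l lam l * T l j i)).
Proof.
move=> /comm_pv cX' cT; apply/comm_pv => j k i.
have [iS|iS] := boolP (i \in S); first by rewrite !cross_in //; apply: cX'.
have e : mv i [:: j; k] = mv i [:: k; j] by rewrite /= st_comm.
have [mS|mS] := boolP (mv i [:: j; k] \in S); last first.
  by rewrite !cross_out // -?e //; apply: cX'.
rewrite !cross_sum -?e //; apply: eq_bigr => l _; congr (_ * _).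
by move/comm_pv: (cT l); apply.
Qed.

Lemma cross_id j i : cross X j i = X j i.
Proof. by rewrite /cross; case: ifP. Qed.
End Cross.

(** * Excluding three independent extensions *)

Section RankThree.
Variables (X : data) (S : {set I}) (T : 'I_3 -> data).
Hypothesis clX : cluster X.
Hypothesis cS : arrow_closed X S.
Hypothesis oS : o \notin S.
Hypothesis S0 : S != set0.
Local Notation crs t := (cross X S t).
Hypothesis clT : forall lam : 'I_3 -> K, (exists l, lam l != 0) ->
  cluster (crs (fun j i => \sum_l lam l * T l j i)).

Let ev (w : seq 'I_3) : 'rV[K]_3 := \row_l pv (crs (T l)) o w.

Lemma order_letter : exists2 N, (0 < N)%N & forall j, mv o (nseq N j) = o.
Proof.
have mvE n j i : mv i (nseq n j) = iter n (st j) i.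
  by elim: n i => //= n IH i; rewrite IH -iterSr.
exists (\prod_j fingraph.order (st j) o)%N; first by rewrite prodn_gt0 // => j; exact: order_gt0.
move=> j; rewrite mvE (bigD1 j) //= mulnC; move: (\prod_(_ | _) _)%N => q.
by elim: q => [|q IH] //; rewrite mulSn iterD IH iter_order.
Qed.

(** The action of an invariant monomial commutes with a nonzero path from [o] to [i]. *)
Lemma invariant_scalar (a : data) w i : cluster a -> mv o w = o -> pv a i w = pv a o w.
Proof.
case=> ca cyc ow; have [v <- v0] := cyc i.
have := pv_comm ca o v w; rewrite ow mulrC; exact: mulIf.
Qed.

Let clTl l : cluster (crs (T l)).
Proof.
have := clT (lam := fun l' => (l' == l)%:R); have -> : (fun j i => \sum_l' (l' == l)%:R * T l' j i) = T l.
  apply: data_ext => j i; rewrite (bigD1 l) //= eqxx mul1r big1 ?addr0 // => l' /negbTE ->.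
  by rewrite mul0r.
by apply; exists l; rewrite eqxx oner_eq0.
Qed.

Let ev_perm w w' : perm_eq w w' -> ev w = ev w'.
Proof.
by move=> p; apply/rowP => l; rewrite /ev !mxE; apply: pv_perm => //; case: (clTl l).
Qed.

Let ev_cat v u : mv o v \in S -> ev (v ++ u) = pv X (mv o v) u *: ev v.
Proof.
by move=> vS; apply/rowP => l; rewrite /ev !mxE pv_cat (cross_in cS (T l) u vS) mulrC.
Qed.

Let ev_rcons v j : mv o v \notin S -> st j (mv o v) \in S ->
  ev (rcons v j) = pv X o v *: \row_l T l j (mv o v).
Proof.
move=> vS jS; apply/rowP => l; rewrite /ev !mxE pv_rcons (cross_out cS (T l) vS).
by rewrite /cross vS jS.
Qed.

(** A nonzero covector killing the rows of [A] is a nonzero combination of the three extensions.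
    This combination is a cluster, so some path to [sig] has a value vector that the covector does
    not kill. *)
Let ev_span sig m (A : 'M[K]_(m, 3)) : sig \in S -> (m < 3)%N ->
  exists2 w, mv o w = sig & forall D : 'rV_m, ev w <> D *m A.
Proof.
move=> sS m3; have : cokermx A != 0.
  by rewrite -mxrank_eq0 mxrank_coker subn_eq0 -ltnNge (leq_ltn_trans (rank_leq_row A)).
case/matrix0Pn => k0 [j0 nz].
have [|_ cyc] := clT (lam := fun l => cokermx A l j0); first by exists k0.
have [w ow wn] := cyc sig; exists w => // D eD.
move: wn; rewrite cross_sum ?ow //; case/negP; apply/eqP.
transitivity ((ev w *m cokermx A) 0 j0).
  by rewrite [RHS]mxE; apply: eq_bigr => l _; rewrite /ev [in RHS](mxE _ _ 0 l) mulrC.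
by rewrite eD -mulmxA mulmx_coker mulmx0 mxE.
Qed.

Let ev_indep3 sig : sig \in S -> exists w : 'I_3 -> seq 'I_3,
  (forall l, mv o (w l) = sig) /\ forall l l', l != l' -> indep2 (ev (w l)) (ev (w l')).
Proof.
move=> sS; have [w1 o1 n1] := ev_span (0 : 'M_(0, 3)) sS isT.
have [w2 o2 n2] := ev_span (ev w1) sS isT.
have [w3 o3 n3] := ev_span (col_mx (ev w1) (ev w2)) sS isT.
have e1 : ev w1 != 0 by apply/eqP => e; apply: (n1 0); rewrite e mul0mx.
have e2 : ev w2 != 0 by apply/eqP => e; apply: (n2 0); rewrite e mul0mx.
have e3 : ev w3 != 0 by apply/eqP => e; apply: (n3 0); rewrite e mul0mx.
have i12 : indep2 (ev w1) (ev w2).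
  by split=> // c e; apply: (n2 c%:M); rewrite mul_scalar_mx.
have i13 : indep2 (ev w1) (ev w3).
  by split=> // c e; apply: (n3 (row_mx c%:M 0)); rewrite mul_row_col mul0mx addr0 mul_scalar_mx.
have i23 : indep2 (ev w2) (ev w3).
  by split=> // c e; apply: (n3 (row_mx 0 c%:M)); rewrite mul_row_col mul0mx add0r mul_scalar_mx.
exists (sel w1 w2 w3); split; first by move=> l; case: (letterP l).
by move=> l l'; case: (letterP l); case: (letterP l') => // _; rewrite /sel /=; do ?[assumption|exact: indep2_sym].
Qed.

Section Nilpotent.
Variable N : nat.
Hypothesis N0 : (0 < N)%N.
Hypothesis oN : forall j, mv o (nseq N j) = o.
Let nil j := pv X o (nseq N j) == 0.

Let cX : comm X := clX.1.

Lemma invariant_arrow w j i : mv o w = o -> pv X o w != 0 -> j \in w -> X j i != 0.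
Proof.
move=> ow wn jw; have := invariant_scalar i clX ow.
rewrite (pv_perm cX i (perm_to_rem jw)) /= => e.
by move: wn; rewrite -e mulf_eq0 negb_or => /andP[].
Qed.

Lemma nil_arrow j : nil j -> (forall i, X j i != 0) -> False.
Proof.
move=> nj h; move: nj; rewrite /nil; apply/negP.
by elim: (N) (o) => [|n IH] i /=; rewrite ?oner_eq0 // mulf_neq0.
Qed.

(** A letter that is not nilpotent has only nonzero arrows, and these form cycles; a cycle that
    entered the closed set S could not come back out. *)
Lemma not_nil_out w i : all (predC nil) w -> i \notin S -> mv i w \notin S.
Proof.
elim: w i => //= j w IH i /andP[nj nw] iS; apply: IH => //; apply: contra iS => jS.
have e : pv X i (nseq N j) = pv X o (nseq N j) by apply: invariant_scalar.
have mi : mv i (nseq N j) = i.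
  by have [v <- _] := clX.2 i; rewrite -mv_cat mv_catC // mv_cat oN.
move: nj; rewrite /nil -e -[X in X \in S]mi -(prednK N0) /= mulf_eq0 negb_or => /andP[_].
exact: arrow_closed_pv.
Qed.

(** Nonzero paths of nilpotent letters starting in S have bounded length; the start of a longest one
    receives no nonzero nilpotent arrow from S. *)
Lemma terminal_ex : exists2 sig, sig \in S &
  forall j tau, nil j -> tau \in S -> st j tau = sig -> X j tau = 0.
Proof.
pose P n := `[< exists tau w, [/\ tau \in S, size w = n, all nil w & pv X tau w != 0] >].
have exP : exists n, P n.
  have [tau tS] := set0Pn _ S0; exists 0%N; apply/asboolP; exists tau, [::].
  by split=> //=; rewrite oner_eq0.
(* A longer word contains some letter N times, and the N-th power of a nilpotent letter acts by zero
   everywhere. *)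
have bP n : P n -> (n <= 3 * N)%N.
  case/asboolP => tau [w [tS sw /allP nw wn]]; rewrite leqNgt; apply/negP => big.
  have [j jN] : exists j, (N <= count_mem j w)%N.
    have es : size w = (count_mem lx w + (count_mem ly w + count_mem lz w))%N.
      by rewrite {1}(perm_size (perm_mon w)) /mon !size_cat !size_nseq.
    have [h|h] := leqP N (count_mem lx w); first by exists lx.
    have [h'|h'] := leqP N (count_mem ly w); first by exists ly.
    by exists lz; lia.
  have jw : j \in w by rewrite -has_pred1 has_count; lia.
  have [v p] := perm_nseq jN.
  move: wn; rewrite (pv_perm cX _ p) pv_cat invariant_scalar //.
  by rewrite (eqP (nw _ jw)) mul0r eqxx.
case: (ex_maxnP exP bP) => n /asboolP[tau [w [tS sw nw wn]]] max; exists tau => // j tau' nj tS' e.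
apply/eqP/contraT => h; have : P n.+1.
  apply/asboolP; exists tau', (j :: w); rewrite /= nj sw nw; split=> //.
  by rewrite mulf_neq0 // e.
by move/max; rewrite ltnn.
Qed.

Section Terminal.
Variable sig : I.
Hypothesis sS : sig \in S.
Hypothesis term : forall j tau, nil j -> tau \in S -> st j tau = sig -> X j tau = 0.

(** Both words can be reordered to end with [j], hence with the same arrow into [sig]. It is zero if
    it starts in S; otherwise both value vectors are multiples of the values of the three extensions
    on this arrow. *)
Lemma share_dep w w' j : nil j -> mv o w = sig -> mv o w' = sig -> j \in w -> j \in w' ->
  ~ indep2 (ev w) (ev w').
Proof.
move=> nj.
have eq u : mv o u = sig -> j \in u ->
    mv o (rem j u) = invF (@st_inj j) sig /\ ev u = ev (rcons (rem j u) j).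
  move=> ou ju; have p : perm_eq u (rcons (rem j u) j).
    by rewrite (permPl (perm_to_rem ju)) perm_sym perm_rcons.
  split; last exact: ev_perm.
  by apply: (@st_inj j); rewrite f_invF -mv_rcons -ou; apply: mv_perm; rewrite // perm_sym.
move=> ow ow' jw jw'; have [o1 ->] := eq _ ow jw; have [o2 ->] := eq _ ow' jw'.
set tau := invF _ _ in o1 o2; have jt : st j tau = sig by rewrite f_invF.
have [tS|tS] := boolP (tau \in S).
  case; rewrite -cats1 ev_cat o1 //= term // mul0r scale0r eqxx //.
rewrite !ev_rcons ?o1 ?o2 ?jt //; case=> n1 _ n3.
have c0 : pv X o (rem j w) != 0 by apply: contraNneq n1 => ->; rewrite scale0r.
apply: (n3 (pv X o (rem j w') / pv X o (rem j w))).
by rewrite scalerA divfK.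
Qed.

Lemma ev_nil w : mv o w = sig -> exists2 j, nil j & j \in w.
Proof.
move=> ow; have : has nil w.
  by apply/contraT; rewrite -all_predC => /not_nil_out/(_ oS); rewrite ow sS.
by case/hasP => j jw nj; exists j.
Qed.

(** Three words with pairwise independent values each contain a nilpotent letter, and no two share
    one. So the three letters are nilpotent, each belongs to one word, and this word is a power of
    it. *)
Lemma ev_powers : exists A : 'I_3 -> nat, (forall j, nil j) /\
  (forall j, mv o (nseq (A j) j) = sig) /\
  (forall j k, j != k -> indep2 (ev (nseq (A j) j)) (ev (nseq (A k) k))).
Proof.
have [w [ow iw]] := ev_indep3 sS.
have /fin_all_exists [f fP] : forall l, exists j, nil j /\ j \in w l.
  by move=> l; have [j nj jw] := ev_nil (ow l); exists j.
have fI : injective f.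
  move=> l l' e; apply/eqP/contraT => ne; have [n1 w1] := fP l; have [_ w2] := fP l'.
  by rewrite -e in w2; case: (share_dep n1 (ow l) (ow l') w1 w2 (iw _ _ ne)).
pose g := invF fI.
have ng j : nil j by rewrite -(f_invF fI j); case: (fP (invF fI j)).
have wg j : w (g j) = nseq (size (w (g j))) j.
  apply/all_pred1P/allP => k kw /=; apply/contraT => kj.
  have ne : g j != g k by apply: contra kj => /eqP/(congr1 f); rewrite !f_invF => ->.
  case: (share_dep (ng k) (ow (g j)) (ow (g k)) kw _ (iw _ _ ne)).
  by have [_] := fP (g k); rewrite f_invF.
exists (fun j => size (w (g j))); split=> //; split=> [j|j k jk]; rewrite -!wg //.
by apply: iw; apply: contra jk => /eqP/(congr1 f); rewrite !f_invF => ->.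
Qed.

(** Commuting [u] with the words [w l] makes the scalar of [u] at [sig] times [ev (w l)] a multiple
    of [ev u]; a nonzero scalar would make the three vectors dependent. *)
Lemma same_char_kill u : mv o u = sig -> pv X sig u = 0.
Proof.
move=> ou; apply/eqP/contraT => k0; have [w [ow iw]] := ev_indep3 sS.
have c l : ev (w l) = (pv X sig u)^-1 *: (pv X sig (w l) *: ev u).
  rewrite -[in pv X sig (w l)]ou -ev_cat ?ou // (ev_perm (w := u ++ w l) (w' := w l ++ u)); last by rewrite perm_catC.
  by rewrite ev_cat ow // scalerA mulVf // scale1r.
have [n1 n2 n3] := iw lx ly isT; exfalso.
have d0 : pv X sig (w lx) != 0 by apply: contraNneq n1; rewrite c => ->; rewrite scale0r scaler0.
apply: (n3 (pv X sig (w ly) / pv X sig (w lx))); rewrite [ev (w ly)]c [ev (w lx)]c !scalerA.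
by congr (_ *: _); rewrite mulrAC divfK // mulrC.
Qed.

(** The contradiction sits at the square of the character [sig]. A nonzero monomial of this
    character omits a letter, say z, because xyz acts by zero, and its exponents are below those of
    the pure powers by [same_char_kill]. Its quotient into x^a y^b is an invariant monomial excluded
    by [powers_no_square]. *)
Lemma terminal_false : False.
Proof.
have [A [ng [oA iA]]] := ev_powers.
have A0 j : (0 < A j)%N.
  by rewrite lt0n; apply: contraTneq sS => e; rewrite -(oA j) e.
have LA m j : Lexpo L m (cnt (nseq (A j) j)) -> mvo m = sig.
  move/L_mv => ->; rewrite -(oA j) [RHS]mv_mon //.
have LAC m j : mvo m = sig -> Lexpo L m (cnt (nseq (A j) j)).
  by move=> e; apply/L_mv; rewrite e -(oA j) mv_mon.
pose Q m := mvo m \notin S /\ pvo X m != 0.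
have QA l j : (l < A j)%N -> mv o (nseq l j) \notin S /\ pv X o (nseq l j) != 0.
  move=> lA.
  have [n1 _ _] := iA j (if j == lx then ly else lx) ltac:(by case: (letterP j)).
  have eA : nseq (A j) j = rcons (nseq (A j).-1 j) j by rewrite -cats1 -[in LHS](prednK (A0 j)) -[_.-1.+1]addn1 nseqD.
  have oS' : mv o (nseq (A j).-1 j) \notin S.
    apply: contra n1 => tS; rewrite eA -cats1 ev_cat //= term ?mul0r ?scale0r //.
    by rewrite -mv_rcons -eA.
  have el : nseq (A j).-1 j = nseq l j ++ nseq ((A j).-1 - l) j by rewrite -nseqD subnKC //; lia.
  have v0 : pv X o (nseq (A j).-1 j) != 0.
    by apply: contra n1 => /eqP e; rewrite eA ev_rcons // ?e ?scale0r // -mv_rcons -eA oA.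
  move: v0 oS'; rewrite el mv_cat pv_cat mulf_eq0 negb_or => /andP[v1 v2] oS'; split=> //.
  by apply: contra oS' => h; apply: arrow_closed_pv v2.
have monx l : mon (l, 0, 0)%N = nseq l lx by rewrite /mon /= cats0.
have mony l : mon (0, l, 0)%N = nseq l ly by rewrite /mon /= cats0.
have monz l : mon (0, 0, l)%N = nseq l lz by [].
have cntx : cnt (nseq (A lx) lx) = (A lx, 0, 0)%N by rewrite -monx cnt_mon.
have cnty : cnt (nseq (A ly) ly) = (0, A ly, 0)%N by rewrite -mony cnt_mon.
have cntz : cnt (nseq (A lz) lz) = (0, 0, A lz)%N by rewrite -monz cnt_mon.
have nilA l j : pv X o (nseq l j) != 0 -> mv o (nseq l j) = o -> l = 0%N.
  case: l => // l v e; exfalso; apply: (nil_arrow (ng j)) => i.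
  by apply: (invariant_arrow i e v); rewrite inE eqxx.
have mem_mon m : [/\ (0 < m.1.1)%N -> lx \in mon m, (0 < m.1.2)%N -> ly \in mon m &
    (0 < m.2)%N -> lz \in mon m].
  by split=> h; rewrite /mon !mem_cat !mem_nseq h eqxx ?orbT.
have pw : powers L Q (fun m => ev (mon m)) (A lx) (A ly) (A lz).
  split=> //.
  - split; [have := LAC (A lx, 0, 0)%N ly | have := LAC (0, A ly, 0)%N lz];
      rewrite ?cnty ?cntz ?monx ?mony => /(_ (oA _)) l; apply: (lat_eq l) => /=; lia.
  - by move=> l; split=> h; rewrite /Q ?monx ?mony ?monz; apply: QA.
  - by move=> m [mS _]; rewrite -cntx => /LA e; rewrite e sS in mS.
  - move=> m m' n [mS m0] [mS' m0'] /L_mv em; exists (pvo X m / pvo X m').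
    apply/rowP => l; rewrite /ev !mxE.
    have [cT _] := clTl l.
    have pT m2 : pvo (crs (T l)) (addm n m2) = pv (crs (T l)) o (mon m2 ++ mon n).
      by apply: pv_perm => //; rewrite (permPl (mon_add_perm _ _)) perm_catC.
    by rewrite !pT !(pv_cat (crs (T l)) o (mon _) (mon n)) (cross_out cS _ mS) (cross_out cS _ mS') em mulrA divfK.
  - move=> m m'; rewrite -cntx => /LA e /LA e' h; have [x1 y1 z1] := mem_mon m.
    have [x2 y2 z2] := mem_mon m'.
    case/or3P: h => /andP[h1 h2]; [apply: (share_dep (ng lx))|apply: (share_dep (ng ly))|apply: (share_dep (ng lz))]; auto.
  - move=> l; split=> -[_ v0] l0.
    + rewrite monx in v0; apply: (nilA _ _ v0); rewrite -monx.
      by have /L_mv -> : Lexpo L (l, 0, 0)%N (0, 0, 0)%N by apply: (lat_eq l0) => /=; lia.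
    + rewrite mony in v0; apply: (nilA _ _ v0); rewrite -mony.
      by have /L_mv -> : Lexpo L (0, l, 0)%N (0, 0, 0)%N by apply: (lat_eq l0) => /=; lia.
    + rewrite monz in v0; apply: (nilA _ _ v0); rewrite -monz.
      by have /L_mv -> : Lexpo L (0, 0, l)%N (0, 0, 0)%N by apply: (lat_eq l0) => /=; lia.
  - by rewrite monx mony monz; split; apply: iA.
have [cT cyc] := clTl lx.
have [w ow w0] := cyc (mv sig (nseq (A lx) lx)).
have xyz : ~~ [&& lx \in w, ly \in w & lz \in w].
  apply/negP => /and3P[wx wy wz].
  have p : perm_eq w ([:: lx; ly; lz] ++ rem lz (rem ly (rem lx w))).
    rewrite (permPl (perm_to_rem wx)) perm_cons.
    have wy' : ly \in rem lx w by move: wy; rewrite (perm_mem (perm_to_rem wx)) inE.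
    have wz' : lz \in rem lx w by move: wz; rewrite (perm_mem (perm_to_rem wx)) inE.
    rewrite (permPl (perm_to_rem wy')) perm_cons.
    have wz'' : lz \in rem ly (rem lx w) by move: wz'; rewrite (perm_mem (perm_to_rem wy')) inE.
    by rewrite (permPl (perm_to_rem wz'')) perm_cons.
  have o1 : mv o [:: lx; ly; lz] = o.
    by have /L_mv : Lexpo L (1, 1, 1)%N (0, 0, 0)%N by apply: (lat_eq (lat1 latL)).
  move: w0; rewrite (pv_perm cT _ p) pv_cat mulf_eq0 negb_or => /andP[v0 _].
  rewrite (cross_out cS) ?o1 // in v0; apply: (nil_arrow (ng lx)) => i.
  exact: (invariant_arrow i o1 v0).
have wL : Lexpo L (cnt w) (addm (A lx, 0, 0)%N (A lx, 0, 0)%N).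
  by apply/L_mv; rewrite -mv_mon // ow mv_addm // monx oA.
have lt j : (count_mem j w < A j)%N.
  rewrite ltnNge; apply/negP => /perm_nseq[v p].
  move: w0; rewrite (pv_perm cT _ p) pv_cat oA (cross_in cS (T lx) v sS) same_char_kill ?mulr0 ?eqxx //.
  rewrite (mv_mon); apply: (LA _ lx); rewrite cntx.
  have l1 := LAC (A lx, 0, 0)%N j; rewrite monx in l1; move/(_ (oA _)): l1 => l1.
  move: wL; rewrite (perm_cnt p) cnt_cat => l2.
  apply: (lat_eq (latD latL l2 l1)); rewrite /=; lia.
have l1 := LAC (A lx, 0, 0)%N ly; rewrite monx cnty in l1; move/(_ (oA _)): l1 => l1.
have l2 := LAC (A lx, 0, 0)%N lz; rewrite monx cntz in l2; move/(_ (oA _)): l2 => l2.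
have hx := lt lx; have hy := lt ly; have hz := lt lz.
have cnt0 j : j \notin w -> count_mem j w = 0%N by move/count_memPn.
case ew : (cnt w) wL => [[n1 n2] n3] wL; case: ew => ex ey ez.
rewrite ex in hx; rewrite ey in hy; rewrite ez in hz.
case/nandP: xyz => [/cnt0|/nandP[]/cnt0]; rewrite ?ex ?ey ?ez => e.
- apply: (powers_no_square (p := A ly - n2) (q := A lz - n3) (powers_rot pw)); try lia.
  by apply: (lat_eq (latN latL (latD latL (latD latL wL l1) l2))); rewrite /= ?e; lia.
- apply: (powers_no_square (p := A lz - n3) (q := A lx - n1) (powers_rot (powers_rot pw))); try lia.
  by apply: (lat_eq (latN latL (latD latL wL l2))); rewrite /= ?e; lia.
apply: (powers_no_square (p := A lx - n1) (q := A ly - n2) pw); try lia.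
by apply: (lat_eq (latN latL (latD latL wL l1))); rewrite /= ?e; lia.
Qed.

End Terminal.
End Nilpotent.

(* A three-dimensional space of extensions cannot consist of clusters. *)
Lemma rank_three_false : False.
Proof.
have [N N0 oN] := order_letter; have [sig sS term] := terminal_ex N0 oN.
exact: (terminal_false N0 oN sS term).
Qed.
End RankThree.

(** * Zariski topology on the space of quiver data *)

Section Zariski.
(** Polynomial functions are given by generation, so that pulling them back along gauge
    transformations and rational curves is an induction. *)
Inductive polyf : (data -> K) -> Prop :=
| polyf_const c : polyf (fun=> c)
| polyf_coord j i : polyf (fun a => a j i)
| polyf_add f g : polyf f -> polyf g -> polyf (fun a => f a + g a)
| polyf_mul f g : polyf f -> polyf g -> polyf (fun a => f a * g a).

Lemma polyf_pv i w : polyf (fun a => pv a i w).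
Proof.
elim: w i => [|j w IH] i /=; first exact: polyf_const.
exact: polyf_mul (polyf_coord _ _) (IH _).
Qed.

Lemma geq_refl a : geq a a.
Proof.
exists (fun=> 1); first by move=> i; rewrite oner_eq0.
by move=> j i; rewrite invr1 !mul1r.
Qed.

Lemma geq_sym a b : geq a b -> geq b a.
Proof.
case=> c c0 e; exists (fun i => (c i)^-1); first by move=> i; rewrite invr_eq0.
by move=> j i; rewrite e; field; rewrite !c0.
Qed.

Lemma geq_trans a b d : geq a b -> geq b d -> geq a d.
Proof.
case=> c c0 e [c' c'0 e']; exists (fun i => c i * c' i); first by move=> i; rewrite mulf_neq0.
by move=> j i; rewrite e' e; field; rewrite c0 c'0.
Qed.

Lemma geq_cluster a b : geq a b -> cluster a -> cluster b.
Proof.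
move=> ab [/comm_pv ca cyc]; have [c c0 e] := geq_pv ab; split.
  by apply/comm_pv => j k i; rewrite !e ca /= st_comm.
move=> i; have [w ow w0] := cyc i; exists w => //.
by rewrite e !mulf_neq0 ?invr_eq0.
Qed.

Lemma polyf_gauge f (c : I -> K) : polyf f ->
  polyf (fun a => f (fun j i => (c i)^-1 * c (st j i) * a j i)).
Proof.
elim=> [k|j i|g h _ Hg _ Hh|g h _ Hg _ Hh].
- exact: polyf_const.
- exact: polyf_mul (polyf_const _) (polyf_coord _ _).
- exact: polyf_add.
- exact: polyf_mul.
Qed.

Definition zclosed (D : data -> Prop) : Prop :=
  (exists2 P : (data -> K) -> Prop, (forall f, P f -> polyf f) &
     forall a, D a <-> cluster a /\ forall f, P f -> f a = 0) /\
  (forall a b, geq a b -> D a -> D b).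

Definition zirreducible (D : data -> Prop) : Prop :=
  [/\ zclosed D, exists a, D a & forall A B, zclosed A -> zclosed B ->
    (forall a, D a -> A a \/ B a) -> (forall a, D a -> A a) \/ (forall a, D a -> B a)].

Definition zclosure (A : data -> Prop) (a : data) : Prop :=
  cluster a /\ forall f, polyf f -> (forall b, A b -> f b = 0) -> f a = 0.

Lemma zclosure_incl (A : data -> Prop) a : (forall b, A b -> cluster b) -> A a -> zclosure A a.
Proof. by move=> cA Aa; split=> [|f _]; [exact: cA|exact]. Qed.

Lemma zclosure_closed A : (forall a b, geq a b -> A a -> A b) -> zclosed (zclosure A).
Proof.
move=> Ainv; split.
  exists (fun f => polyf f /\ forall b, A b -> f b = 0); first by move=> f [].
  by move=> a; split=> -[ca h]; split=> // f; [case=> pf|move=> pf Af]; apply: h.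
move=> a b ab [ca h]; split; first exact: geq_cluster ca.
move=> f pf Af; case: ab => c c0 e.
have -> : b = fun j i => (c i)^-1 * c (st j i) * a j i by apply: data_ext => j i.
apply: (h _ (polyf_gauge c pf)) => d Ad; apply: Af; apply: Ainv Ad.
by exists c.
Qed.

Lemma ratl_polyf Q (gam : K -> data) f : polyf f ->
  (forall j i, ratl Q (fun r => gam r j i)) -> ratl Q (fun r => f (gam r)).
Proof.
move=> pf rg; elim: pf => [c|j i|g h _ Hg _ Hh|g h _ Hg _ Hh].
- exact: ratl_const.
- exact: rg.
- exact: ratlD.
- exact: ratlM.
Qed.

(** If two closed sets cover the closure but each misses a point of [A], take an equation of each
    that fails at that point. Along a rational curve joining the points the product of the equations
    vanishes, hence so does one of them, against its value at an end. *)
Lemma zclosure_irreducible (A : data -> Prop) :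
  (forall a b, geq a b -> A a -> A b) -> (forall a, A a -> cluster a) -> (exists a, A a) ->
  (forall a b, A a -> A b -> exists (Q : {poly K}) (gam : K -> data),
    [/\ Q.[0] != 0, Q.[1] != 0, forall j i, ratl Q (fun r => gam r j i),
        geq (gam 0) a /\ geq (gam 1) b & forall r, Q.[r] != 0 -> A (gam r)]) ->
  zirreducible (zclosure A).
Proof.
move=> Ainv Acl [a0 Aa0] line; split; first exact: (zclosure_closed Ainv).
  by exists a0; exact: zclosure_incl.
move=> D1 D2 [[P1 pP1 eD1] inv1] [[P2 pP2 eD2] inv2] cov.
have sub D P : (forall f, P f -> polyf f) ->
    (forall a, D a <-> cluster a /\ forall f, P f -> f a = 0) ->
    ~ (forall a, zclosure A a -> D a) -> exists2 a, A a & ~ D a.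
  move=> pP eD nD; apply: contrapT => h; apply: nD => a [ca ha].
  apply/eD; split=> // f Pf; apply: ha; first exact: pP.
  move=> b Ab; have : D b by apply: contrapT => nb; apply: h; exists b.
  by case/eD => _; apply.
apply/or_asboolP/contraT; rewrite negb_or => /andP[/asboolPn n1 /asboolPn n2].
have [a Aa nDa] := sub _ _ pP1 eD1 n1; have [b Ab nDb] := sub _ _ pP2 eD2 n2.
have [Q [gam [Q0 Q1 rg [g0 g1] Ag]]] := line _ _ Aa Ab.
have out (D : data -> Prop) (P : (data -> K) -> Prop) c : (forall a, D a <-> cluster a /\ forall f, P f -> f a = 0) -> A c -> ~ D c ->
    exists2 f, P f & f c != 0.
  move=> eD Ac nDc; apply: contrapT => h; apply: nDc; apply/eD; split; first exact: Acl.
  by move=> f Pf; apply/eqP/contraT => fc; case: h; exists f.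
have [f Pf f0] := out _ _ (gam 0) eD1 (Ag _ Q0) (fun h => nDa (inv1 _ _ g0 h)).
have [g Pg gg1] := out _ _ (gam 1) eD2 (Ag _ Q1) (fun h => nDb (inv2 _ _ g1 h)).
have Qn0 : Q != 0 by apply: contraNneq Q0 => ->; rewrite horner0.
case: (ratl_mul0 Qn0 (ratl_polyf (pP1 _ Pf) rg) (ratl_polyf (pP2 _ Pg) rg)).
- move=> r Qr; have [/eD1[_ h]|/eD2[_ h]] := cov _ (zclosure_incl Acl (Ag _ Qr)).
    by rewrite (h _ Pf) mul0r.
  by rewrite (h _ Pg) mulr0.
- by move=> h; rewrite h ?eqxx in f0.
- by move=> h; rewrite h ?eqxx in gg1.
Qed.
End Zariski.

(** * Pencils of extensions are not divisors *)

Section Pencil.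
Variables (X : data) (S : {set I}) (T : 'I_2 -> data).
Hypothesis clX : cluster X.
Hypothesis cS : arrow_closed X S.
Hypothesis oS : o \notin S.
Hypothesis TX : T 0 = X.
Hypothesis cT : forall l, comm (cross X S (T l)).
Local Notation Xl lam := (cross X S (fun j i => \sum_(l < 2) lam l * T l j i)).

Lemma pencil_comm (lam : 'I_2 -> K) : comm (Xl lam).
Proof. by apply: cross_comm_sum => //; case: clX. Qed.

Lemma pencil_in (lam : 'I_2 -> K) w : mv o w \in S ->
  pv (Xl lam) o w = \sum_l lam l * pv (cross X S (T l)) o w.
Proof. exact: cross_sum. Qed.

Lemma pencil_out (lam : 'I_2 -> K) w : mv o w \notin S -> pv (Xl lam) o w = pv X o w.
Proof. exact: cross_out. Qed.

Lemma pencil_line (lam lam' : 'I_2 -> K) j i : exists P : {poly K}, forall r,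
  Xl (fun l => (1 - r) * lam l + r * lam' l) j i = P.[r].
Proof.
case h: ((i \notin S) && (st j i \in S)); last by exists (X j i)%:P => r; rewrite /cross h hornerC.
exists (\sum_l ((1 - 'X) * (lam l)%:P + 'X * (lam' l)%:P) * (T l j i)%:P) => r.
by rewrite /cross h horner_sum; apply: eq_bigr => l _; rewrite !hornerE.
Qed.

Lemma poly_pv (gam : K -> data) i w : (forall j i, exists P : {poly K}, forall r, gam r j i = P.[r]) ->
  exists P : {poly K}, forall r, pv (gam r) i w = P.[r].
Proof.
move=> pg; elim: w i => [|j w IH] i /=; first by exists 1 => r; rewrite hornerC.
have [P eP] := pg j i; have [P' eP'] := IH (st j i).
by exists (P * P') => r; rewrite hornerM eP eP'.
Qed.

Variables (rep : I -> expo) (g r : 'I_3 -> expo) (k : 'I_3 -> I -> expo).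
Hypothesis co : coords rep g r k.
Hypothesis X0 : forall i, pvo X (rep i) != 0.
Let chd q := chart_data k q.
Let p (lam : 'I_2 -> K) l := pvo (Xl lam) (g l) / pvo (Xl lam) (r l).
(** Its zeros are the parameters at which the pencil leaves the chart and [p] may divide by zero. *)
Let Q (lam : 'I_2 -> K) := \prod_i pvo (Xl lam) (rep i).

Lemma chart_cluster q : cluster (chd q).
Proof.
split; first exact: (co_comm co).
by move=> i; exists (mon (rep i)); rewrite ?(co_rep co) ?(co_pv co) ?oner_eq0.
Qed.

Lemma chart_red_pv q l : pvo (chd q) (r l) = 1.
Proof. by rewrite -(co_red co) (co_pv co). Qed.

Lemma geq_ratio a b w w' : geq a b -> mv o w = mv o w' ->
  pv b o w / pv b o w' = pv a o w / pv a o w'.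
Proof.
move=> /geq_pv[c c0 e] ew; rewrite !e ew invfM.
have h : (c o)^-1 * c (mv o w') != 0 by rewrite mulf_neq0 ?invr_eq0.
by rewrite mulrACA divff // mul1r.
Qed.

Lemma geq_chart_coord a q l : geq a (chd q) -> q l = pvo a (g l) / pvo a (r l).
Proof.
move/geq_ratio => /(_ _ _ (co_mv co l)) <-.
by rewrite chart_red_pv (co_gen co) divr1.
Qed.

(** The parameter of the base point [X], since [T 0 = X]. *)
Definition dual0 (l : 'I_2) : K := (l == 0)%:R.

Lemma sum_ord2 (F : 'I_2 -> K) : \sum_l F l = F 0 + F 1.
Proof.
rewrite !big_ord_recl big_ord0 addr0; congr (_ + F _); exact: val_inj.
Qed.

Lemma pencil0 : Xl dual0 = X.
Proof.
apply: data_ext => j i; rewrite -[in RHS](cross_id X S) /cross; case: ifP => // _.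
by rewrite sum_ord2 /dual0 eqxx mul1r mul0r addr0 TX.
Qed.

Lemma Q_neq0 (lam : 'I_2 -> K) : (Q lam != 0) <-> forall i, pvo (Xl lam) (rep i) != 0.
Proof.
split; first by move/prodf_neq0 => h i; apply: h.
by move=> h; apply/prodf_neq0 => i _.
Qed.

Lemma Q_chart (lam : 'I_2 -> K) : Q lam != 0 -> geq (Xl lam) (chd (p lam)).
Proof. by move/Q_neq0 => h; apply: (co_geq co) => //; exact: pencil_comm. Qed.

Lemma crossX : cross X S X = X.
Proof. by apply: data_ext => j i; rewrite cross_id. Qed.

Lemma pencil_in2 (lam : 'I_2 -> K) w : mv o w \in S ->
  pv (Xl lam) o w = lam 0 * pv X o w + lam 1 * pv (cross X S (T 1)) o w.
Proof. by move=> h; rewrite pencil_in // sum_ord2 TX crossX. Qed.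

Lemma p_lam0 (lam : 'I_2 -> K) l : lam 1 = 0 -> pvo (Xl lam) (r l) != 0 ->
  p lam l = p dual0 l.
Proof.
move=> l1; rewrite /p pencil0; have e := co_mv co l.
have [h|h] := boolP (mvo (r l) \in S); last by rewrite !pencil_out ?e.
rewrite !pencil_in2 ?e // l1 !mul0r !addr0 mulf_eq0 negb_or => /andP[h1 h2].
by rewrite invfM mulrACA divff ?mul1r.
Qed.

Lemma red_X0 l : pvo X (r l) != 0.
Proof. by rewrite -(co_red co). Qed.

(** Along the pencil this coordinate is a quotient of two linear forms. They are not proportional,
    so it takes its value at [X] only at multiples of the parameter of [X]. *)
Lemma p_nonconst (lam : 'I_2 -> K) l : mvo (r l) \in S ->
  pvo (cross X S (T 1)) (g l) * pvo X (r l) !=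
  pvo X (g l) * pvo (cross X S (T 1)) (r l) ->
  pvo (Xl lam) (r l) != 0 -> p lam l = p dual0 l -> lam 1 = 0.
Proof.
move=> h nc; rewrite /p pencil0 !pencil_in2 ?(co_mv co) //.
have := red_X0 l; move: (pvo X (r l)) (pvo X (g l)) nc => x y.
move: (pvo _ (r l)) (pvo _ (g l)) => z t nc x0 d0 /eqP.
rewrite eqr_div // => /eqP e; have : lam 1 * (t * x - y * z) = 0.
  transitivity ((lam 0 * y + lam 1 * t) * x - y * (lam 0 * x + lam 1 * z)); first ring.
  by rewrite e subrr.
by move/eqP; rewrite mulf_eq0 subr_eq0 (negbTE nc) orbF => /eqP.
Qed.

Lemma line_end (lam lam' : 'I_2 -> K) :
  (fun l => (1 - 0) * lam l + 0 * lam' l) = lam /\ (fun l => (1 - 1) * lam l + 1 * lam' l) = lam'.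
Proof. by split; apply/funext => l; rewrite ?subr0 ?subrr ?mul0r ?mul1r ?addr0 ?add0r. Qed.

Lemma Q_line (lam lam' : 'I_2 -> K) : exists P : I -> {poly K},
  forall i x, pvo (Xl (fun l => (1 - x) * lam l + x * lam' l)) (rep i) = (P i).[x].
Proof.
have /fin_all_exists [P eP] : forall i, exists P : {poly K},
    forall x, pvo (Xl (fun l => (1 - x) * lam l + x * lam' l)) (rep i) = P.[x].
  by move=> i; apply: poly_pv => j i'; exact: pencil_line.
by exists P.
Qed.

Lemma Q_dual0 : Q dual0 != 0.
Proof. by apply/Q_neq0 => i; rewrite pencil0. Qed.

(** If no coordinate varied, a member of the pencil other than [X] would be equivalent to [X], and
    the values of [X] and [T 1] on the paths to a character of S would be proportional. The nonzero
    member that kills one of these paths would kill all of them, and not be a cluster. *)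
Lemma p_nonconst_ex : S != set0 ->
  (forall lam : 'I_2 -> K, (exists l, lam l != 0) -> cluster (Xl lam)) ->
  exists l, mvo (r l) \in S /\
    pvo (cross X S (T 1)) (g l) * pvo X (r l) !=
    pvo X (g l) * pvo (cross X S (T 1)) (r l).
Proof.
move=> /set0Pn[sig sS] cl; apply: contrapT => no.
(* The line from [dual0] to this parameter consists of the points (1, x), and only finitely many x
   leave the chart. *)
pose lam' (l : 'I_2) : K := 1.
have [P eP] := Q_line dual0 lam'.
pose lamr x l := (1 - x) * dual0 l + x * lam' l.
have [x x0 Qx] : exists2 x, x != 0 & Q (lamr x) != 0.
  apply: contrapT => h; have e0 : \prod_i P i * 'X = 0.
    apply: poly_fun0 => x; rewrite hornerM hornerX horner_prod.
    have [->|x0] := eqVneq x 0; first by rewrite mulr0.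
    have [Q0|Qx] := eqVneq (Q (lamr x)) 0; last by case: h; exists x.
    by under eq_bigr do rewrite -eP; rewrite -/(lamr x) -/(Q (lamr x)) Q0 mul0r.
  move/eqP: e0; rewrite mulf_eq0 polyX_eq0 orbF => /eqP e0.
  have := Q_dual0; rewrite -(line_end dual0 lam').1 /Q; under eq_bigr do rewrite eP.
  by rewrite -horner_prod e0 horner0 eqxx.
have e1 : lamr x 1 = x by rewrite /lamr /dual0 /lam' mulr0 add0r mulr1.
have e0 : lamr x 0 = 1 by rewrite /lamr /dual0 /lam' eqxx !mulr1 subrK.
have /Q_neq0 Qi := Qx.
have ep : p (lamr x) = p dual0.
  apply/funext => l; rewrite /p pencil0; have e := co_mv co l.
  have [h|h] := boolP (mvo (r l) \in S); last by rewrite !pencil_out ?e.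
  have r0 := Qi (mvo (r l)); rewrite (co_red co) in r0.
  rewrite !pencil_in2 ?e // e0 e1 !mul1r in r0 *.
  apply/eqP; rewrite eqr_div ?red_X0 // mulrDl mulrDr -!mulrA; apply/eqP; congr (_ + _).
  rewrite [RHS]mulrCA; congr (_ * _); apply/eqP/contraT => nc; case: no; exists l; split=> //.
have gX : geq X (Xl (lamr x)).
  apply: geq_trans (geq_sym (Q_chart Qx)); rewrite ep.
  by have := Q_chart Q_dual0; rewrite pencil0.
pose w0 := mon (rep sig); have ow0 : mv o w0 = sig by exact: (co_rep co).
pose mu (l : 'I_2) : K := if l == 0 then - pv (cross X S (T 1)) o w0 else pv X o w0.
have [|_ cyc] := cl mu; first by exists 1; rewrite /mu /= X0.
have [w ow] := cyc sig; rewrite pencil_in2 ?ow // /mu /= => /negP; apply; apply/eqP.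
have /eqP := geq_ratio gX (etrans ow (esym ow0)).
have r0 := Qi sig; rewrite -/w0 in r0.
rewrite !pencil_in2 ?ow ?ow0 // e0 e1 !mul1r in r0 *.
rewrite eqr_div // ?X0 // => /eqP; have := X0 sig; rewrite -/w0.
move: (pv X o w0) (pv X o w) (pv (cross X S (T 1)) o w0) (pv (cross X S (T 1)) o w) => a b c d a0 e.
apply: (mulfI x0); rewrite mulr0.
transitivity ((b + x * d) * a - b * (a + x * c)); first ring.
by rewrite e subrr.
Qed.

Section Chain.
Variables (l l1 l2 : 'I_3).
Hypothesis l1l : l1 != l.
Hypothesis l2l : l2 != l.
Hypothesis l12 : l1 != l2.

(** [A1] is the part of the pencil inside the chart with the coordinate [l] set free, [A2] is the
    whole chart; both are saturated under gauge equivalence. *)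
Let A1 Y := exists lam q, [/\ Q lam != 0, forall l', l' != l -> q l' = p lam l' & geq (chd q) Y].
Let A2 Y := exists q, geq (chd q) Y.

Let A1_inv a b : geq a b -> A1 a -> A1 b.
Proof. by move=> ab [lam [q [Q0 eq ga]]]; exists lam, q; split=> //; exact: geq_trans ab. Qed.
Let A2_inv a b : geq a b -> A2 a -> A2 b.
Proof. by move=> ab [q ga]; exists q; exact: geq_trans ab. Qed.
Let A1_cl a : A1 a -> cluster a.
Proof. by move=> [lam [q [_ _ ga]]]; apply: geq_cluster ga (chart_cluster q). Qed.
Let A2_cl a : A2 a -> cluster a.
Proof. by move=> [q ga]; apply: geq_cluster ga (chart_cluster q). Qed.

Lemma surface_irreducible : zirreducible (zclosure A1).
Proof.
apply: zclosure_irreducible => //.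
  by exists X, dual0, (p dual0); split; [exact: Q_dual0|by []|apply: geq_sym; rewrite -{1}pencil0; exact: Q_chart Q_dual0].
move=> a b [lam [q [Q0 eq ga]]] [lam' [q' [Q0' eq' gb]]].
have [P eP] := Q_line lam lam'.
pose lamr x l := (1 - x) * lam l + x * lam' l.
(* The free coordinate moves linearly; the others follow a line in the pencil and are rational, with
   denominators among the [P i]. *)
pose qr x l' := if l' == l then (1 - x) * q l + x * q' l else p (lamr x) l'.
have eQ x : (\prod_i P i).[x] = Q (lamr x).
  by rewrite horner_prod; apply: eq_bigr => i _; rewrite -eP.
exists (\prod_i P i), (fun x => chd (qr x)).
have [lr0 lr1] := line_end lam lam'.
have q0 : qr 0 = q.
  apply/funext => l'; rewrite /qr /lamr lr0; case: eqP => [->|/eqP ne]; last by rewrite eq.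
  by rewrite subr0 mul1r mul0r addr0.
have q1 : qr 1 = q'.
  apply/funext => l'; rewrite /qr /lamr lr1; case: eqP => [->|/eqP ne]; last by rewrite eq'.
  by rewrite subrr mul0r mul1r add0r.
split.
- by rewrite eQ /lamr lr0.
- by rewrite eQ /lamr lr1.
- have rq l' : ratl (\prod_i P i) (fun x => qr x l').
    rewrite /qr; case: eqP => _.
      have := ratl_poly (\prod_i P i) ((1 - 'X) * (q l)%:P + 'X * (q' l)%:P).
      by congr ratl; apply/funext => x; rewrite !hornerE.
    have [G eG] := @poly_pv (fun x => Xl (lamr x)) o (mon (g l')) (pencil_line lam lam').
    have eP1 : \prod_i P i = P (mvo (r l')) * \prod_(i | i != mvo (r l')) P i.
      by rewrite (bigD1 (mvo (r l'))).
    have := ratl_div G eP1; congr ratl; apply/funext => x.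
    by rewrite -eG -eP (co_red co).
  move=> j i; rewrite /chd /chart_data /qpow.
  by apply: ratlM; [apply: ratlM|]; apply: ratlX.
- by rewrite q0 q1.
move=> x; rewrite eQ => Qx; exists (lamr x), (qr x); split=> //; last exact: geq_refl.
by move=> l' /negbTE ne; rewrite /qr ne.
Qed.

Lemma threefold_irreducible : zirreducible (zclosure A2).
Proof.
apply: zclosure_irreducible => //.
  by exists (chd (p dual0)), (p dual0); exact: geq_refl.
move=> a b [q ga] [q' gb].
pose qr x l' := (1 - x) * q l' + x * q' l'.
exists 1, (fun x => chd (qr x)).
have q0 : qr 0 = q by apply/funext => l'; rewrite /qr subr0 mul1r mul0r addr0.
have q1 : qr 1 = q' by apply/funext => l'; rewrite /qr subrr mul0r mul1r add0r.
split; rewrite ?hornerC ?oner_eq0 ?q0 ?q1 //; last by move=> x _; exists (qr x); exact: geq_refl.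
have rq l' : ratl 1 (fun x => qr x l').
  have := ratl_poly 1 ((1 - 'X) * (q l')%:P + 'X * (q' l')%:P).
  by congr ratl; apply/funext => x; rewrite !hornerE.
move=> j i; rewrite /chd /chart_data /qpow.
by apply: ratlM; [apply: ratlM|]; apply: ratlX.
Qed.

(** A member outside the chart is a limit of members inside. On the line from [X], an equation of
    [A1] times the product of the basis values vanishes identically, and this product is nonzero at
    [X]. *)
Lemma pencil_surface (lam : 'I_2 -> K) Y : cluster Y -> geq (Xl lam) Y -> zclosure A1 Y.
Proof.
move=> clY gY; have [_ inv] := zclosure_closed A1_inv; apply: (inv _ _ gY).
split; first exact: (geq_cluster (geq_sym gY) clY).
move=> f pf f0; have [P eP] := Q_line dual0 lam.
pose lamr x l := (1 - x) * dual0 l + x * lam l.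
have eQ x : (\prod_i P i).[x] = Q (lamr x).
  by rewrite horner_prod; apply: eq_bigr => i _; rewrite -eP.
have [lr0 lr1] := line_end dual0 lam.
have rl j i : ratl 1 (fun x => Xl (lamr x) j i).
  have [R eR] := pencil_line dual0 lam j i.
  have := ratl_poly 1 R; congr ratl; apply/funext => x; by rewrite -eR.
case: (ratl_mul0 (oner_neq0 _) (ratl_polyf pf rl) (ratl_poly 1 (\prod_i P i))).
- move=> x _; rewrite eQ; have [->|Qx] := eqVneq (Q (lamr x)) 0; first by rewrite mulr0.
  rewrite f0 ?mul0r //; exists (lamr x), (p (lamr x)); split=> //.
  by apply: geq_sym; exact: Q_chart.
- by move/(_ 1); rewrite hornerC oner_eq0 (lr1 : lamr 1 = lam); apply.
move/(_ 0); rewrite hornerC oner_eq0 eQ (lr0 : lamr 0 = dual0) => /(_ isT)/eqP.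
by rewrite (negbTE Q_dual0).
Qed.

Lemma surface_sub_threefold Y : zclosure A1 Y -> zclosure A2 Y.
Proof.
case=> cY h; split=> // f pf f0; apply: h => // b [lam [q [_ _ gb]]].
by apply: f0; exists q.
Qed.

(** The witness is [X] with its free coordinate increased by one: the coordinate [l1] forces the
    parameter of [X] up to scale, and then the coordinate [l] disagrees. *)
Lemma surface_not_sub (D : data -> Prop) (good : ('I_2 -> K) -> Prop) :
  (forall Y, D Y -> exists2 lam, good lam & geq (Xl lam) Y) ->
  (forall lam, good lam -> pvo (Xl lam) (r l1) != 0 -> p lam l1 = p dual0 l1 -> lam 1 = 0) ->
  ~ (forall Y, zclosure A1 Y -> D Y).
Proof.
move=> hD hg sub; pose q l' := if l' == l then p dual0 l + 1 else p dual0 l'.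
have : zclosure A1 (chd q).
  apply: zclosure_incl => //; exists dual0, q; split; [exact: Q_dual0| |exact: geq_refl].
  by move=> l' /negbTE ne; rewrite /q ne.
move/sub/hD => [lam gl gq]; have eq l' := geq_chart_coord l' gq.
have r0 l' : pvo (Xl lam) (r l') != 0.
  have [c c0 e] := geq_pv gq.
  have := chart_red_pv q l'; rewrite e => h; apply: contra_eq_neq h => ->.
  by rewrite mulr0 eq_sym oner_neq0.
have l10 : lam 1 = 0.
  apply: hg => //; rewrite /p -eq /q (negbTE l1l) //.
have := p_lam0 l10 (r0 l); rewrite {1}/p -eq /q eqxx => /eqP.
by rewrite -subr_eq0 addrC addKr oner_eq0.
Qed.

(** The two bound coordinates are constants or quotients of linear forms in the parameter of the
    pencil; eliminating it leaves a bilinear relation. *)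
Lemma surface_relation : exists al be ga de : K, ~ [/\ al = 0, be = 0, ga = 0 & de = 0] /\
  forall lam, let G i := pvo (Xl lam) (g i) in let R i := pvo (Xl lam) (r i) in
    al * (G l1 * G l2) + be * (G l1 * R l2) + ga * (R l1 * G l2) + de * (R l1 * R l2) = 0.
Proof.
have out i : mvo (r i) \notin S -> forall lam,
    pvo (Xl lam) (g i) = pvo X (g i) /\ pvo (Xl lam) (r i) = pvo X (r i).
  by move=> h lam; rewrite !pencil_out // (co_mv co).
have [h1|h1] := boolP (mvo (r l1) \in S); last first.
  exists 0, (pvo X (r l1)), 0, (- pvo X (g l1)); split.
    by case=> _ e; case/eqP: (red_X0 l1).
  by move=> lam /=; have [-> ->] := out _ h1 lam; ring.
have [h2|h2] := boolP (mvo (r l2) \in S); last first.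
  exists 0, 0, (pvo X (r l2)), (- pvo X (g l2)); split.
    by case=> _ _ e; case/eqP: (red_X0 l2).
  by move=> lam /=; have [-> ->] := out _ h2 lam; ring.
pose F m (i : 'I_2) := pvo (cross X S (T i)) m.
have [al [be [ga [de [nz rel]]]]] := bilinear_relation (F (g l1)) (F (r l1)) (F (g l2)) (F (r l2)).
exists al, be, ga, de; split=> // lam /=.
by rewrite !pencil_in ?(co_mv co) //; exact: rel.
Qed.

(** On the whole chart the two coordinates are independent, so evaluating the relation at values 0
    and 1 kills all its coefficients. *)
Lemma threefold_not_sub : ~ (forall Y, zclosure A2 Y -> zclosure A1 Y).
Proof.
move=> sub; have [al [be [ga [de [nz rel]]]]] := surface_relation.
pose F Y := al * (pvo Y (g l1) * pvo Y (g l2))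
  + be * (pvo Y (g l1) * pvo Y (r l2))
  + ga * (pvo Y (r l1) * pvo Y (g l2))
  + de * (pvo Y (r l1) * pvo Y (r l2)).
have pF : polyf F.
  by do ?apply: polyf_add; apply: polyf_mul; first [exact: polyf_const|apply: polyf_mul; exact: polyf_pv].
have FA Y : A1 Y -> F Y = 0.
  move=> [lam [q [Q0 eq gY]]]; have [c c0 e] := geq_pv gY.
  have r0 i : pvo (Xl lam) (r i) != 0 by move/Q_neq0/(_ (mvo (r i))): Q0; rewrite (co_red co).
  rewrite /F !e !(co_mv co) !chart_red_pv !(co_gen co) !eq // /p.
  set c1 := _^-1 * c _; set c2 := _^-1 * c _.
  have /= := rel lam; have := r0 l1; have := r0 l2.
  move: (pvo (Xl lam) (g l1)) (pvo (Xl lam) (g l2)) (pvo (Xl lam) (r l1)).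
  move: (pvo (Xl lam) (r l2)).
  move=> t x y z t0 z0 rl.
  transitivity (c1 * c2 * (al * (x * y) + be * (x * t) + ga * (z * y) + de * (z * t)) / (z * t)).
    by field; rewrite z0 t0.
  by rewrite rl mulr0 mul0r.
pose q u v (l' : 'I_3) : K := if l' == l1 then u else if l' == l2 then v else 0.
have Fq u v : al * (u * v) + be * u + ga * v + de = 0.
  have [_ /(_ F pF FA)] : zclosure A1 (chd (q u v)).
    by apply/sub/zclosure_incl => //; exists (q u v); exact: geq_refl.
  rewrite /F !chart_red_pv !(co_gen co) /q !eqxx eq_sym (negbTE l12) => <-; ring.
have d0 : de = 0 by rewrite -(Fq 0 0); ring.
have b0 : be = 0 by rewrite -(Fq 1 0) d0; ring.
have c0 : ga = 0 by rewrite -(Fq 0 1) d0; ring.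
by apply: nz; split=> //; rewrite -(Fq 1 1) b0 c0 d0; ring.
Qed.

End Chain.

(* A contracted set which is at most a pencil is not a divisor. *)
Theorem pencil_chain (D : data -> Prop) (good : ('I_2 -> K) -> Prop) :
  (forall Y, D Y -> cluster Y /\ exists2 lam, good lam & geq (Xl lam) Y) ->
  (forall lam, good lam -> lam 1 = 0) \/
  S != set0 /\ (forall lam : 'I_2 -> K, (exists l, lam l != 0) -> cluster (Xl lam)) ->
  exists E1 E2, [/\ zirreducible E1, zirreducible E2,
    (forall Y, D Y -> E1 Y) /\ ~ (forall Y, E1 Y -> D Y) &
    (forall Y, E1 Y -> E2 Y) /\ ~ (forall Y, E2 Y -> E1 Y)].
Proof.
move=> hD hg.
have [l1 hl1] : exists l1, forall lam, good lam -> pvo (Xl lam) (r l1) != 0 ->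
    p lam l1 = p dual0 l1 -> lam 1 = 0.
  case: hg => [h|[S0 cl]]; first by exists lx => lam /h.
  have [l1 [l1S nc]] := p_nonconst_ex S0 cl.
  by exists l1 => lam _; exact: p_nonconst.
have [l [l2 [l1l l2l l12]]] : exists l l2 : 'I_3, [/\ l1 != l, l2 != l & l1 != l2].
  by case: (letterP l1); [exists ly, lz|exists lx, lz|exists lx, ly].
have hD' Y (h : D Y) := (hD Y h).2.
do 2!eexists; split; [exact: (surface_irreducible l)|exact: threefold_irreducible| |].
  split=> [Y DY|]; last exact: (surface_not_sub l1l hD' hl1).
  by have [cY [lam _ gY]] := hD _ DY; apply: pencil_surface gY.
split; first exact: surface_sub_threefold.
exact: (threefold_not_sub l1l l2l l12).
Qed.
End Pencil.

(** * Contracted sets in terms of weights and flows *)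

Section Contracted.
Local Notation aclosed := (arrow_closed).
Local Notation arrow := ('I_3 * I)%type.
Let src (a : arrow) := a.2.
Let tgt (a : arrow) := st a.1 a.2.
Local Notation flx := (flux src tgt).
Definition monomial (n : arrow -> nat) (X : data) : K := \prod_a X a.1 a.2 ^+ n a.

Variables (theta : I -> rat) (D : data -> Prop).
Let wt (W : {set I}) := \sum_(i in W) theta i.
Hypothesis theta0 : wt setT = 0.
Hypothesis D_cl : forall Y, D Y -> cluster Y.
Hypothesis wt_ge0 : forall (X : data) W, cluster X -> aclosed X W -> o \notin W -> 0 <= wt W.
Definition tight (X : data) (W : {set I}) := [/\ cluster X, aclosed X W, o \notin W, W != set0 & wt W = 0].
Hypothesis tight_uniq : forall X X' W W', tight X W -> tight X' W' -> W = W'.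
(** Parameters of the chamber near the wall are positive on S and keep the strict inequalities. *)
Hypothesis wall_cluster : forall X S (a : data), tight X S -> comm a ->
  (forall W, aclosed a W -> W != set0 -> W != setT -> W = S \/ 0 < wt W) -> cluster a.
(** All that is kept of the contraction: vanishing at one point of [D] implies vanishing at the
    others, for binomial sections. *)
Hypothesis same_image : forall X Y, D X -> D Y -> forall (m : nat) (n n' : arrow -> nat),
  (forall i, flx (fun a => (n a)%:R : rat) i = m%:R * theta i) ->
  (forall i, flx (fun a => (n' a)%:R : rat) i = m%:R * theta i) ->
  forall c, monomial n X = c * monomial n' X -> monomial n Y = c * monomial n' Y.

Lemma closedT (X : data) W : cluster X -> aclosed X W -> o \in W -> W = setT.
Proof.
move=> [_ cyc] cW oW; apply/setP => i; rewrite inE; have [w <- w0] := cyc i.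
exact: arrow_closed_pv w0.
Qed.

Lemma closed_wt_ge0 (X : data) W : cluster X -> aclosed X W -> 0 <= wt W.
Proof.
move=> cX cW; have [oW|oW] := boolP (o \in W); last exact: wt_ge0 cW oW.
by rewrite (closedT cX cW oW) theta0.
Qed.

Lemma closed_tight (X : data) W : cluster X -> aclosed X W -> W != set0 -> W != setT -> wt W = 0 -> tight X W.
Proof.
move=> cX cW W0 WT w0; split=> //.
by apply: contra WT => oW; rewrite (closedT cX cW oW).
Qed.

Section Fixed.
Variables (X : data) (S : {set I}).
Hypothesis DX : D X.
Hypothesis cS : aclosed X S.
Hypothesis oS : o \notin S.
Hypothesis S_tight : S = set0 \/ tight X S.
Hypothesis tight_S : forall Y W, D Y -> tight Y W -> W = S.
Let noncross (a : arrow) := ~~ ((src a \notin S) && (tgt a \in S)).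
Let nz (Y : data) (a : arrow) := Y a.1 a.2 != 0.

Lemma monomial_neq0 n Y : (monomial n Y != 0) = [forall a, (n a != 0%N) ==> nz Y a].
Proof.
apply/idP/forallP => [/prodf_neq0 h a|h].
  by apply/implyP => na; have := h a isT; rewrite expf_eq0 lt0n na.
by apply/prodf_neq0 => a _; rewrite expf_eq0 lt0n; have := h a; case: eqP.
Qed.

(** [theta] is the flux of a flow on the nonzero arrows of [Y] because submodules have nonnegative
    weight. A small amount can be reserved beforehand on each of these arrows not entering S: only S
    has weight zero, and the reserved arrows bring nothing into S. *)
Lemma flow_monomial Y : D Y -> exists (m : nat) (n : arrow -> nat),
  [/\ (0 < m)%N, forall i, flx (fun a => (n a)%:R : rat) i = m%:R * theta i,
      forall a, n a != 0%N -> nz Y a & forall a, noncross a -> nz Y a -> n a != 0%N].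
Proof.
move=> DY; have cY := D_cl DY.
pose N a : rat := (noncross a && nz Y a)%:R.
(* The denominator bounds the number of arrows through any cut, so reserving [e] on each keeps
   positive weights nonnegative. *)
have [e e0 eP] := eps_ex [seq wt W / (#|{: arrow}|%:R + 1) | W <- enum {: {set I}}].
pose M : rat := #|{: arrow}|%:R + 1.
have M0 : 0 < M by rewrite ltr_wpDl ?ler0n.
pose d (W : {set I}) a : rat := (tgt a \in W)%:R - (src a \in W)%:R.
have NW W : \sum_a N a * d W a <= M.
  apply: (@le_trans _ _ (\sum_(a : arrow) 1)); last by rewrite sumr_const lerDl ler01.
  apply: ler_sum => a _; rewrite /N /d.
  by case: (_ && _); case: (_ \in _); case: (_ \in _) => /=; lra.
have NS : \sum_a N a * d S a <= 0.
  apply: sumr_le0 => a _; rewrite /N /d /noncross.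
  by case: (src a \in S); case: (tgt a \in S); case: (nz Y a) => /=; lra.
pose b i := theta i - e * flx N i.
have sumb (W : {set I}) : \sum_(i in W) b i = wt W - e * \sum_a N a * d W a.
  by rewrite sumrB -mulr_sumr flux_sum.
have [||n [n0 nE nb]] := @flow_ex I arrow src tgt [set a | nz Y a] b.
- transitivity (\sum_(i in setT) b i); first by apply: eq_bigl => i; rewrite inE.
  rewrite sumb theta0 big1 ?mulr0 ?subr0 // => a _; by rewrite /d !inE subrr mulr0.
- move=> W cW; have {}cW : aclosed Y W.
    by move=> j i iW h; apply: (cW (j, i)); rewrite ?inE.
  rewrite sumb; have w0 := closed_wt_ge0 cY cW.
  have [->|WT] := eqVneq W setT.
    by rewrite theta0 big1 ?mulr0 ?subr0 // => a _; rewrite /d !inE subrr mulr0.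
  have [->|W0] := eqVneq W set0.
    by rewrite /wt big_set0 big1 ?mulr0 ?subr0 // => a _; rewrite /d !inE subrr mulr0.
  have [we|wn] := eqVneq (wt W) 0.
    have -> : W = S by apply: (tight_S DY); apply: closed_tight.
    rewrite subr_ge0; apply: (@le_trans _ _ 0); first by rewrite pmulr_rle0.
    by have := tight_S DY (closed_tight cY cW W0 WT we) => <-; rewrite we.
  have wp : 0 < wt W by rewrite lt_def wn.
  have : e <= wt W / M by apply: eP; [apply/mapP; exists W; rewrite // mem_enum|rewrite divr_gt0].
  rewrite ler_pdivlMr // => h; rewrite subr_ge0; apply: le_trans h.
  by rewrite ler_pM2l.
have n'0 a : 0 <= n a + e * N a by rewrite addr_ge0 // mulr_ge0 ?ler0n // ltW.
have [m [N' [m0 eN]]] := clear_denominators n'0; exists m, N'; split=> //.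
- move=> i; rewrite -[theta i](subrK (e * flx N i)) -/(b i) -nb /flux mulr_sumr -big_split mulr_sumr /=.
  by apply: eq_bigr => a _; rewrite eN; ring.
- move=> a; apply: contraNT => na; rewrite -(eqr_nat rat) eN nE ?inE // /N (negbTE na) andbF.
  by rewrite mulr0 addr0 mul0r.
- move=> a ha na; rewrite -(eqr_nat rat) eN mulf_neq0 //; last by rewrite pnatr_eq0 -lt0n.
  by rewrite /N ha na mulr1 gt_eqF // ltr_wpDl.
Qed.

Lemma same_support Y a : D Y -> noncross a -> nz Y a = nz X a.
Proof.
suff imp Y1 Y2 : D Y1 -> D Y2 -> noncross a -> nz Y1 a -> nz Y2 a.
  by move=> DY ha; apply/idP/idP; apply: imp.
move=> D1 D2 ha na; have [m [n [m0 fn hn hN]]] := flow_monomial D1.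
have : monomial n Y1 != 0 by rewrite monomial_neq0; apply/forallP => a'; apply/implyP; exact: hn.
have [e|] := eqVneq (monomial n Y2) 0.
  (* With coefficient 0 the binomial is a single monomial. *)
  have := same_image D2 D1 fn fn (c := 0); rewrite e !mul0r => /(_ erefl) ->; by rewrite eqxx.
by rewrite monomial_neq0 => /forallP /(_ a); rewrite hN.
Qed.

(** Added to a large multiple of a flow that is positive on its support, [k] becomes an honest
    monomial of the same weight as that multiple; the binomial of the two carries the Laurent value
    from [X] to [Y]. *)
Lemma laurent_eq Y (k : arrow -> int) : D Y ->
  (forall a, k a != 0 -> noncross a /\ nz X a) -> (forall i, flx k i = 0) ->
  \prod_a (Y a.1 a.2 / X a.1 a.2) ^ k a = 1.
Proof.
move=> DY supp fk; have [m [n [m0 fn hn hN]]] := flow_monomial DX.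
pose M := (\sum_a `|k a|)%N.
have kM a : (`|k a| <= M)%N by rewrite /M (bigD1 a) //= leq_addr.
pose n1 a := absz ((M * n a)%N%:Z + k a).
have en1 a : (n1 a)%:Z = (M * n a)%N%:Z + k a.
  rewrite /n1 gez0_abs //; have [->|/supp[h1 h2]] := eqVneq (k a) 0; first by rewrite addr0.
  have := kM a; have := hN a h1 h2; case: (n a) => // x _; rewrite mulnS; lia.
pose n2 a := (M * n a)%N.
have f2 i : flx (fun a => (n2 a)%:R : rat) i = (M * m)%:R * theta i.
  by rewrite natrM -mulrA -fn /flux mulr_sumr; apply: eq_bigr => a _; rewrite natrM mulrA.
have f1 i : flx (fun a => (n1 a)%:R : rat) i = (M * m)%:R * theta i.
  rewrite -f2; have -> : flx (fun a => (n1 a)%:R : rat) i = flx (fun a => (n2 a)%:R : rat) i + (flx k i)%:~R.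
    rewrite /flux rmorph_sum -big_split /=; apply: eq_bigr => a _.
    rewrite -[(n1 a)%:R]/((n1 a)%:Z%:~R) en1 intrD mulrDl; congr (_ * _ + _).
    by rewrite intrM intrB !natz.
  by rewrite fk addr0.
have mono Z : (forall a, k a != 0 -> nz Z a) -> monomial n1 Z = monomial n2 Z * \prod_a Z a.1 a.2 ^ k a.
  move=> hZ; rewrite /monomial -big_split /=; apply: eq_bigr => a _.
  rewrite -[_ ^+ n1 a]/(_ ^ (n1 a)%:Z) en1 -[_ ^+ n2 a]/(_ ^ (n2 a)%:Z).
  have [->|/hZ h] := eqVneq (k a) 0; first by rewrite addr0 expr0z mulr1.
  exact: expfzDr.
have hX a : k a != 0 -> nz X a by case/supp.
have hY a : k a != 0 -> nz Y a by move=> /supp[h1 h2]; rewrite same_support.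
have n2X : monomial n2 X != 0.
  rewrite monomial_neq0; apply/forallP => a; apply/implyP => h; apply: hn.
  by apply: contra h => /eqP h; rewrite /n2 h muln0.
have n2Y : monomial n2 Y != 0.
  apply/negP => /eqP e; have := same_image DY DX f2 f2 (c := 0).
  by rewrite e !mul0r => /(_ erefl) /eqP; rewrite (negbTE n2X).
have := same_image DX DY f1 f2 (c := \prod_a X a.1 a.2 ^ k a).
rewrite !mono // mulrC => /(_ erefl); rewrite mulrC => /(mulIf n2Y) e.
rewrite (eq_bigr (fun a => Y a.1 a.2 ^ k a / X a.1 a.2 ^ k a)) => [|a _].
  rewrite prodf_div e divff //; apply/prodf_neq0 => a _.
  by have [->|/hX h] := eqVneq (k a) 0; rewrite ?expr0z ?oner_eq0 // expfz_neq0.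
by rewrite expfzMl exprz_inv invr_expz.
Qed.

(* The invariant Laurent monomials separate the torus orbits of the associated graded modules. *)
Lemma normal_form Y : D Y -> exists t, geq (cross X S t) Y.
Proof.
move=> DY.
pose delta (i x : I) : int := (i == x)%:R.
(* Integral chains from [root] to [v] along nonzero arrows that do not enter S, traversed in either
   direction. *)
pose pot root v (k : arrow -> int) := (forall a, k a != 0 -> noncross a /\ nz X a) /\
  forall x, flx k x = delta v x - delta root x.
have flxD (k k' : arrow -> int) x : flx (fun a => k a + k' a) x = flx k x + flx k' x.
  by rewrite /flux -big_split /=; apply: eq_bigr => a _; rewrite mulrDl.
have flx1 a (c : int) x : flx (fun a' => (a' == a)%:R * c) x = c * (delta (tgt a) x - delta (src a) x).
  rewrite /flux (bigD1 a) //= big1 ?addr0 ?eqxx ?mul1r // => a' /negbTE->; by rewrite !mul0r.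
have pot_step root v a (c : int) v' : (exists k, pot root v k) -> noncross a -> nz X a ->
    (forall x, delta v' x = delta v x + c * (delta (tgt a) x - delta (src a) x)) -> exists k, pot root v' k.
  move=> [k [sk fk]] ha na e; exists (fun a' => k a' + (a' == a)%:R * c); split.
    by move=> a'; have [->//|ne] := eqVneq a' a; rewrite mul0r addr0; exact: sk.
  by move=> x; rewrite flxD flx1 fk e; ring.
have pot_fwd root a : noncross a -> nz X a -> (exists k, pot root (src a) k) -> exists k, pot root (tgt a) k.
  by move=> ha na h; apply: (pot_step root (src a) a 1) => // x; ring.
have pot_bwd root a : noncross a -> nz X a -> (exists k, pot root (tgt a) k) -> exists k, pot root (src a) k.
  by move=> ha na h; apply: (pot_step root (tgt a) a (-1)) => // x; ring.
have pot0 root : exists k, pot root root k.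
  exists (fun=> 0); split=> [a|x]; first by rewrite eqxx.
  by rewrite subrr /flux big1 // => a _; rewrite mul0r.
have potQ v : v \notin S -> exists k, pot o v k.
  have [w <- w0] := (D_cl DX).2 v; elim/last_ind: w w0 => [|w j IH]; first by move=> _ _; exact: pot0.
  rewrite mv_rcons pv_rcons mulf_eq0 negb_or => /andP[w0 j0] jS.
  have wS : mv o w \notin S by apply: contra jS => h; exact: cS.
  by apply: (pot_fwd o (j, mv o w)); rewrite /noncross /src /tgt /= ?wS ?jS //; exact: IH.
(* S is connected: a component and its complement in S are submodules of nonnegative weight with sum
   0, so the component has weight zero and is S by uniqueness. *)
have potS : exists root, forall v, v \in S -> exists k, pot root v k.
  case: S_tight => [->|tS]; first by exists o => v; rewrite inE.
  have [_ _ _ /set0Pn[root rS] wS] := tS; exists root.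
  pose C := [set v in S | `[< exists k, pot root v k >]].
  have CP v : reflect (v \in S /\ exists k, pot root v k) (v \in C).
    by rewrite inE; apply: (iffP andP) => -[h1 h2]; split=> //; apply/asboolP.
  have nS j v : v \in S -> noncross (j, v) by move=> vS; rewrite /noncross /src /= vS.
  have cC : aclosed X C.
    move=> j v /CP[vS pv'] h; apply/CP; split; first exact: cS.
    by apply: (pot_fwd root (j, v)) => //; exact: nS.
  have cSC : aclosed X (S :\: C).
    move=> j v; rewrite !inE => /andP[vC vS] h; rewrite vS /= in vC; rewrite (cS vS h) andbT /=.
    apply: contra vC => /asboolP pt; apply/asboolP.
    by apply: (pot_bwd root (j, v)) => //; exact: nS.
  have rC : root \in C by apply/CP; split=> //; exact: pot0.
  have sub : C \subset S by apply/subsetP => v /CP[].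
  have oC : o \notin C by apply: contra oS => /(subsetP sub).
  have wC : wt C = 0.
    apply/eqP; rewrite eq_le (wt_ge0 (D_cl DX) cC oC) andbT.
    rewrite -wS /wt [leRHS](big_setID C) /= (setIidPr sub) lerDl.
    by apply: (wt_ge0 (D_cl DX) cSC); rewrite inE negb_and oS orbT.
  have eC : C = S.
    apply: (tight_S DX); split=> //; [exact: D_cl|by apply/set0Pn; exists root].
  by move=> v; rewrite -eC => /CP[].
have [root rootP] := potS.
have /fin_all_exists [k kP] : forall v, exists k, pot (if v \in S then root else o) v k.
  by move=> v; case: ifP => [vS|/negbT vS]; [exact: rootP|exact: potQ].
pose be a := Y a.1 a.2 / X a.1 a.2.
have be0 a : noncross a -> nz X a -> be a != 0.
  by move=> ha na; rewrite mulf_neq0 ?invr_eq0 //; have := same_support DY ha; rewrite na.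
have bek (q : arrow -> int) : (forall a, q a != 0 -> noncross a /\ nz X a) -> \prod_a be a ^ q a != 0.
  move=> sq; apply/prodf_neq0 => a _; have [->|/sq[h1 h2]] := eqVneq (q a) 0.
    by rewrite expr0z oner_eq0.
  by rewrite expfz_neq0 // be0.
(* The gauge at [v] compares [Y] with [X] along the chosen chain to [v]. *)
pose c v := \prod_a be a ^ k v a.
have c0 v : c v != 0 by apply: bek; case: (kP v).
exists (fun j i => c i * (c (st j i))^-1 * Y j i); exists c => // j i.
rewrite /cross; case: ifP => [_|/negbT ha]; first by field; rewrite !c0.
have h : noncross (j, i) by [].
have [X0|X0] := eqVneq (X j i) 0.
  have := same_support DY h; rewrite /nz /= X0 eqxx mulr0 => /negbFE/eqP; exact.
have na : nz X (j, i) by [].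
have eS : (st j i \in S) = (i \in S).
  apply/idP/idP => [jS|iS]; last exact: cS.
  by move: ha; rewrite jS andbT negbK.
(* The chain to [i], the arrow, and the chain back form a cycle; the roots agree because the arrow
   does not cross the boundary of S. *)
pose q a := k i a + (a == (j, i))%:R * 1 + (- k (st j i) a).
have sq a : q a != 0 -> noncross a /\ nz X a.
  rewrite /q; have [->//|ne] := eqVneq a (j, i); rewrite mul0r addr0 => hq.
  have [e|/(kP i).1//] := eqVneq (k i a) 0; apply: (kP (st j i)).1.
  by apply: contraNneq hq => ->; rewrite e subr0.
have fq x : flx q x = 0.
  rewrite !flxD flx1 (kP i).2; have -> : flx (fun a => - k (st j i) a) x = - flx (k (st j i)) x.
    by rewrite /flux -sumrN; apply: eq_bigr => a _; rewrite mulNr.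
  by rewrite (kP (st j i)).2 eS /src /tgt /=; ring.
have := laurent_eq DY sq fq.
rewrite (eq_bigr (fun a => be a ^ k i a * be a ^ (a == (j, i))%:R / be a ^ k (st j i) a)) => [|a _].
  rewrite prodf_div big_split /= -/(c i) -/(c (st j i)) (bigD1 (j, i)) //= eqxx.
  rewrite big1 => [|a /negbTE->]; last by rewrite expr0z.
  rewrite mulr1 expr1z /be /= => /eqP; rewrite -[1]divr1 eqr_div ?oner_eq0 // !mulr1 mul1r => /eqP <-.
  by field; rewrite X0 c0.
have [/andP[h1 h2]|h1] := boolP (noncross a && nz X a).
  by rewrite /q mulr1 !expfzDr ?be0 // -invr_expz.
have z v : k v a = 0.
  by apply/eqP/contraT => /(kP v).1[h2 h3]; rewrite h2 h3 in h1.
have ne : a != (j, i) by apply: contraNneq h1 => ->; rewrite h na.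
by rewrite /q !z (negbTE ne) mul0r oppr0 !addr0 !expr0z divr1 mulr1.
Qed.

(** For a submodule W of the changed data, the intersection and the union with S are submodules of
    [X] whose weights add up to that of W. If both are zero, uniqueness gives W = S, unless the
    union is everything; then the nonzero entering arrow forces S into W, and W is everything. *)
Lemma crossing_cluster t : tight X S -> comm (cross X S t) ->
  (exists j i, [/\ i \notin S, st j i \in S & t j i != 0]) -> cluster (cross X S t).
Proof.
move=> tS ct [j [i [iS jS tji]]]; have [cX _ _ S0 wS] := tS.
apply: (wall_cluster tS ct) => W cW W0 WT.
have cI : aclosed X (W :&: S).
  move=> j' i'; rewrite !inE => /andP[i'W i'S] h; rewrite (cS i'S h) andbT.
  by apply: cW => //; rewrite /cross i'S.
have cU : aclosed X (W :|: S).
  move=> j' i'; rewrite !inE; have [i'S _ h|i'S] := boolP (i' \in S); first by rewrite (cS i'S h) orbT.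
  rewrite orbF => i'W h; have [//|h'] := boolP (st j' i' \in S); first by rewrite orbT.
  by rewrite orbF; apply: cW => //; rewrite /cross (negbTE h') andbF.
have sum : wt W = wt (W :&: S) + wt (W :|: S).
  have e1 : wt (W :|: S) = wt S + wt (W :\: S).
    by rewrite /wt setUC (big_setID S) /= setUK setDUl setDv set0U.
  have e2 : wt W = wt (W :&: S) + wt (W :\: S) by rewrite /wt (big_setID S).
  by rewrite e1 e2 wS add0r.
have pI := closed_wt_ge0 cX cI; have pU := closed_wt_ge0 cX cU.
have [I0|I0] := eqVneq (wt (W :&: S)) 0; last by right; rewrite sum ltr_pwDl // lt_def I0.
have [U0|U0] := eqVneq (wt (W :|: S)) 0; last by right; rewrite sum ltr_wpDl // lt_def U0.
left; have [oU|oU] := boolP (o \in W :|: S).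
  have UT := closedT cX cU oU.
  have iW : i \in W by have : i \in W :|: S; [rewrite UT inE|rewrite inE (negbTE iS) orbF].
  have jW : st j i \in W by apply: cW; rewrite // /cross iS jS.
  have tI : tight X (W :&: S).
    by split=> //; [rewrite inE negb_and oS orbT|apply/set0Pn; exists (st j i); rewrite inE jW].
  have eI := tight_S DX tI; case/eqP: WT; rewrite -UT; apply/esym/setUidPl.
  by rewrite -eI subsetIl.
have tU : tight X (W :|: S).
  split=> //; case/set0Pn: W0 => x xW; apply/set0Pn; exists x; by rewrite inE xW.
have eU := tight_S DX tU; have WS : W \subset S by rewrite -eU subsetUl.
apply: (tight_S DX); split=> //; [|by apply: contra oS => /(subsetP WS)|by rewrite -(setIidPl WS)].
by rewrite -(setIidPl WS).
Qed.

End Fixed.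

Theorem contracted_chain : (exists X, D X) ->
  exists E1 E2, [/\ zirreducible E1, zirreducible E2,
    (forall Y, D Y -> E1 Y) /\ ~ (forall Y, E1 Y -> D Y) &
    (forall Y, E1 Y -> E2 Y) /\ ~ (forall Y, E2 Y -> E1 Y)].
Proof.
move=> [X0 DX0].
(* Without a submodule of weight zero, [D] is a single orbit, treated as a degenerate pencil with S
   empty. *)
have [[X [S [DX tS]]]|notight] := pselect (exists X S, D X /\ tight X S); last first.
  have clS : aclosed X0 set0 by move=> j i; rewrite inE.
  have oS : o \notin set0 by rewrite inE.
  have uni Y W : D Y -> tight Y W -> W = set0 by move=> DY tW; case: notight; exists Y, W.
  have nf := normal_form DX0 clS oS (or_introl erefl) uni.
  have [rep [g [r [k [co X00]]]]] := coords_ex (D_cl DX0).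
  apply: (@pencil_chain X0 set0 (fun=> X0) (D_cl DX0) clS oS erefl _ rep g r k co X00
    D (fun lam => lam 1 = 0)); last by left.
    by move=> l; rewrite crossX; case: (D_cl DX0).
  move=> Y DY; split; first exact: D_cl.
  have [t gt] := nf Y DY; exists dual0 => //.
  suff e a : cross X0 set0 a = cross X0 set0 t by rewrite (e _).
  by apply: data_ext => j i; rewrite /cross !inE.
have [cX clS oS S0 _] := tS.
have uni Y W : D Y -> tight Y W -> W = S by move=> _ tW; exact: tight_uniq tW tS.
have nf := normal_form DX clS oS (or_intror tS) uni.
pose crossing a := (a.2 \notin S) && (st a.1 a.2 \in S).
pose TT t := exists2 Y, D Y & geq (cross X S t) Y.
have cT t : TT t -> comm (cross X S t).
  by move=> [Y DY gY]; case: (geq_cluster (geq_sym gY) (D_cl DY)).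
have TX : TT X by exists X => //; rewrite crossX; exact: geq_refl.
have Xc : exists2 a, crossing a & X a.1 a.2 != 0.
  apply: contrapT => h; case/set0Pn: S0 => s sS; have [w ow w0] := cX.2 s.
  suff : mv o w \notin S by rewrite ow sS.
  elim/last_ind: w w0 {ow} => // w j IH; rewrite pv_rcons mv_rcons mulf_eq0 negb_or => /andP[w0 j0].
  by apply/negP => jS; apply: h; exists (j, mv o w); rewrite // /crossing /= IH.
have cl n (T : 'I_n -> data) : (forall l, TT (T l)) ->
    (forall lam : 'I_n -> K, (forall a, crossing a -> \sum_l lam l * T l a.1 a.2 = 0) -> forall l, lam l = 0) ->
    forall lam : 'I_n -> K, (exists l, lam l != 0) -> cluster (cross X S (fun j i => \sum_l lam l * T l j i)).
  move=> hT ind lam [l ll]; apply: (crossing_cluster DX clS oS uni tS).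
    by apply: cross_comm_sum => //; [case: cX|move=> l'; exact: cT].
  apply: contrapT => h; case/eqP: ll; apply: ind => a /andP[a1 a2].
  by apply/eqP/contraT => ne; case: h; exists a.1, a.2.
have [rep [g [r [k [co X00]]]]] := coords_ex cX.
have crossE t t' : (forall a, crossing a -> t a.1 a.2 = t' a.1 a.2) -> cross X S t = cross X S t'.
  move=> e; apply: data_ext => j i; rewrite /cross.
  by case: ifP => // h; exact: (e (j, i)).
(* The values occurring on the entering arrows span a space of dimension one, two, or at least
   three. *)
have [[t2 T2 n2]|dep2] := pselect (exists2 t, TT t & forall c, ~ forall a, crossing a -> t a.1 a.2 = c * X a.1 a.2); last first.
  apply: (@pencil_chain X S (fun=> X) cX clS oS erefl _ rep g r k co X00
    D (fun lam => lam 1 = 0)); last by left.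
    by move=> l; exact: cT.
  move=> Y DY; split; first exact: D_cl.
  have [t gt] := nf Y DY.
  have [c ec] : exists c, forall a, crossing a -> t a.1 a.2 = c * X a.1 a.2.
    apply: contrapT => h; apply: dep2; exists t; first by exists Y.
    by move=> c hc; apply: h; exists c.
  exists (fun l => if l == 0 then c else 0) => //.
  rewrite (crossE _ t) // => a ha; rewrite sum_ord2 /= mul0r addr0 ec //.
pose T2' (l : 'I_2) := if l == 0 then X else t2.
have hT2 l : TT (T2' l) by rewrite /T2'; case: eqP.
have ind2 (lam : 'I_2 -> K) : (forall a, crossing a -> \sum_l lam l * T2' l a.1 a.2 = 0) -> forall l, lam l = 0.
  move=> h; have {}h a (ha : crossing a) : lam 0 * X a.1 a.2 + lam 1 * t2 a.1 a.2 = 0.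
    by rewrite -(h a ha) sum_ord2.
  have l1 : lam 1 = 0.
    apply/eqP/contraT => l1; case: (n2 (- lam 0 / lam 1)) => a ha.
    apply: (mulfI l1); rewrite -[LHS]subr0 -(h a ha); field; exact: l1.
  have l0 : lam 0 = 0.
    have [a ha Xa] := Xc; apply: (mulIf Xa); rewrite mul0r.
    by have := h a ha; rewrite l1 mul0r addr0.
  by move=> l; have [-> //|] := eqVneq l 0; case: l => [[|[|//]]] hl // _; rewrite -l1; congr lam; exact: val_inj.
have [[t3 T3 n3]|dep3] := pselect (exists2 t, TT t & forall c d, ~ forall a, crossing a -> t a.1 a.2 = c * X a.1 a.2 + d * t2 a.1 a.2); last first.
  apply: (@pencil_chain X S T2' cX clS oS erefl _ rep g r k co X00
    D (fun=> True)); last by right; split=> //; exact: cl.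
    by move=> l; exact: cT.
  move=> Y DY; split; first exact: D_cl.
  have [t gt] := nf Y DY.
  have [c [d ec]] : exists c d, forall a, crossing a -> t a.1 a.2 = c * X a.1 a.2 + d * t2 a.1 a.2.
    apply: contrapT => h; apply: dep3; exists t; first by exists Y.
    by move=> c d hc; apply: h; exists c, d.
  exists (fun l => if l == 0 then c else d) => //.
  by rewrite (crossE _ t) // => a ha; rewrite sum_ord2 /= ec.
pose T3' := sel X t2 t3.
have hT3 l : TT (T3' l) by case: (letterP l).
exfalso; apply: (@rank_three_false X S T3') => //.
apply: (cl _ _ hT3) => lam h.
have {}h a (ha : crossing a) : lam lx * X a.1 a.2 + lam ly * t2 a.1 a.2 + lam lz * t3 a.1 a.2 = 0.
  by rewrite -(h a ha) big_letter.
have lz0 : lam lz = 0.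
  apply/eqP/contraT => l1; case: (n3 (- lam lx / lam lz) (- lam ly / lam lz)) => a ha.
  apply: (mulfI l1); rewrite -[LHS]subr0 -(h a ha); field; exact: l1.
pose lam2 (l : 'I_2) := if l == 0 then lam lx else lam ly.
have l2 := ind2 lam2 _; have {}l2 : forall l, lam2 l = 0.
  by apply: l2 => a ha; rewrite sum_ord2 /= -[RHS](h a ha) lz0 mul0r addr0.
by move=> l; case: (letterP l); [exact: (l2 0)|exact: (l2 1)|].
Qed.
End Contracted.

End McKayQuiver.

(** * Characters and simultaneous diagonalisation *)

Section AbelianGroup.
Variables (C : numClosedFieldType) (gT : finGroupType) (G : {group gT}).
Hypothesis abG : abelian G.

Lemma pchar'G : ([pchar C]^'.-group G)%g.
Proof. by apply/pgroupP=> p _; rewrite inE /= pchar_num. Qed.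

Definition gchar (psi : gT -> C) : Prop :=
  (forall g h, g \in G -> h \in G -> psi (g * h)%g = psi g * psi h) /\
  forall g, g \in G -> psi g != 0.

Lemma gchar1 psi : gchar psi -> psi 1%g = 1.
Proof.
case=> pM p0; have G1 := group1 G; apply: (mulfI (p0 _ G1)).
by rewrite -pM // mulg1 mulr1.
Qed.

Lemma gcharV psi g : gchar psi -> g \in G -> psi g^-1%g = (psi g)^-1.
Proof.
move=> cp Gg; have [pM p0] := cp; apply: (mulfI (p0 _ Gg)).
by rewrite -pM ?groupV // mulgV gchar1 // divff // p0.
Qed.

Lemma gchar_torsion psi g : gchar psi -> g \in G -> psi g ^+ #|G| = 1.
Proof.
move=> cp Gg; have [pM p0] := cp.
have pX n : psi (g ^+ n)%g = psi g ^+ n.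
  by elim: n => [|n IH]; rewrite ?expg0 ?gchar1 ?expr0 // expgS exprS pM ?groupX // IH.
by rewrite -pX expg_cardG // gchar1.
Qed.

Lemma gchar_div psi phi : gchar psi -> gchar phi -> gchar (fun g => psi g / phi g).
Proof.
move=> [pM p0] [qM q0]; split=> [g h Gg Gh|g Gg]; last by rewrite mulf_neq0 ?invr_eq0 ?p0 ?q0.
by rewrite pM // qM // invfM mulrACA.
Qed.

Lemma repr_diag n (rG : mx_representation C G n) : exists2 P : 'M[C]_n, P \in unitmx &
  exists psi : 'I_n -> gT -> C, (forall j, gchar (psi j)) /\
    forall g, g \in G -> P *m rG g = diag_mx (\row_j psi j g) *m P.
Proof.
pose As := [seq rG g | g <- enum G].
have [toP _] := codiagonalizableP As; have [|P Pu /allP PA] := toP.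
  split=> [A B|A].
    move=> /mapP[g]; rewrite mem_enum => Gg -> /mapP[h]; rewrite mem_enum => Gh ->.
    by rewrite /comm_mx -!repr_mxM // (centsP abG).
  move=> /mapP[g]; rewrite mem_enum => Gg ->; case: n rG {A As toP} => [|n] rG.
    by exists 1%:M; rewrite ?unitmx1 //; apply/is_diag_mxP => -[].
  apply/diagonalizableP; have [rs ers] := closed_field_poly_normal ('X^#|G| - 1 : {poly C}).
  have N0 := cardG_gt0 G.
  have lead1 : lead_coef ('X^#|G| - 1 : {poly C}) = 1 by rewrite lead_coefXnsubC.
  rewrite lead1 scale1r in ers; exists rs.
    by rewrite -separable_prod_XsubC -ers separable_Xn_sub_1 // pnatr_eq0 -lt0n.
  rewrite -ers; apply/mxminpoly_min.
  rewrite rmorphB rmorph1 rmorphXn /= horner_mx_X; apply/eqP; rewrite subr_eq0.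
  suff rX m : rG g ^+ m = rG (g ^+ m)%g by rewrite rX expg_cardG // repr_mx1.
  by elim: m => [|m IH]; rewrite ?expr0 ?expg0 ?repr_mx1 // exprS expgS IH repr_mxM ?groupX.
exists P => //; pose q j g := (P *m rG g *m invmx P) j j; exists q.
have eD g : g \in G -> P *m rG g = diag_mx (\row_j q j g) *m P.
  move=> Gg; have : rG g \in As by apply: map_f; rewrite mem_enum.
  move/PA => /= /diagonalizable_forPex[d /(simmxRL Pu) ed].
  rewrite -[LHS](mulmxKV Pu) -ed; congr (diag_mx _ *m P); apply/rowP => j.
  by rewrite mxE /q -ed !mxE eqxx.
split=> // j; have M g h : g \in G -> h \in G -> q j (g * h)%g = q j g * q j h.
  move=> Gg Gh; rewrite /q repr_mxM // mulmxA eD // -!mulmxA [P *m (_ *m _)]mulmxA eD //.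
  rewrite !mulmxA mulmxK // mul_diag_mx mxE [diag_mx _ j j]mxE eqxx mulr1n.
  by rewrite !(mulmxK Pu); congr (_ * _); rewrite [RHS]mxE eqxx mulr1n.
split=> // g Gg; apply/eqP => e0; have := M _ _ Gg (groupVr Gg).
by rewrite e0 mul0r mulgV /q repr_mx1 mulmx1 mulmxV // mxE eqxx => /eqP; rewrite oner_eq0.
Qed.

End AbelianGroup.

(** * Eigenvectors and submodules of the regular representation *)

Section RegularRepresentation.
Variables (C : numClosedFieldType) (gT : finGroupType) (G : {group gT}).
Hypothesis abG : abelian G.
Variable sG : irrType C G.
Local Notation aG := (regular_repr C G).
Local Notation n := #|G|.
Let splitG : group_splitting_field C G := @group_closure_closed_field C gT G.
Let deg1 (i : sG) : irr_degree i = 1%N := irr_degree_abelian splitG abG i.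

Definition ebase (i : sG) : 'rV[C]_n := nz_row (socle_base i).

Lemma ebase_neq0 (i : sG) : ebase i != 0.
Proof. by rewrite nz_row_eq0; case: (socle_simple i). Qed.

Lemma comp_ebase (i : sG) : (i :=: ebase i)%MS.
Proof.
apply: (eqmx_trans (linear_irr_comp_pchar (pchar'G C G) splitG (deg1 i))).
apply/eqmxP; rewrite nz_row_sub andbT -(geq_leqif (mxrank_leqif_sup (nz_row_sub _))).
by rewrite -/(irr_degree i) deg1 lt0n mxrank_eq0 -/(ebase i) ebase_neq0.
Qed.

Lemma comp_rank (i : sG) : \rank i = 1%N.
Proof. by rewrite comp_ebase rank_rV ebase_neq0. Qed.

Lemma ebase_eigen (i : sG) g : g \in G -> exists a, ebase i *m aG g = a *: ebase i.
Proof.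
move=> Gg; apply/sub_rVP; rewrite -comp_ebase.
apply: submx_trans (mxmoduleP (component_mx_module aG (socle_base i)) g Gg).
by rewrite submxMr // comp_ebase.
Qed.

Lemma card_irr : #|{: sG}| = n.
Proof.
rewrite -[RHS](sum_irr_degree_pchar sG (pchar'G C G) splitG) -sum1_card.
by apply: eq_bigr => i _; rewrite deg1.
Qed.

Definition emx : 'M[C]_(#|{: sG}|, n) := \matrix_k ebase (enum_val k).

Lemma row_emx k : row k emx = ebase (enum_val k).
Proof. by rewrite rowK. Qed.

Lemma ebase_emx i : ebase i = row (enum_rank i) emx.
Proof. by rewrite row_emx enum_rankK. Qed.

Lemma emx_full : row_full emx.
Proof.
rewrite -sub1mx -(irr_mx_sum_pchar sG (pchar'G C G)); apply/sumsmx_subP => i _.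
by rewrite comp_ebase ebase_emx row_sub.
Qed.

Lemma emx_free : row_free emx.
Proof. by rewrite /row_free (eqnP emx_full) card_irr. Qed.

Definition edual (i : sG) : 'cV[C]_n := col (enum_rank i) (pinvmx emx).

Lemma ebase_dual i j : ebase i *m edual j = (i == j)%:R%:M.
Proof.
have : (emx *m pinvmx emx) (enum_rank i) (enum_rank j) = (i == j)%:R.
  by rewrite mulmxVp ?emx_free // mxE (inj_eq enum_rank_inj).
rewrite mxE => <-; apply/matrixP => a b; rewrite !ord1 !mxE eqxx mulr1n.
by apply: eq_bigr => k _; rewrite !mxE enum_rankK.
Qed.

Lemma dual_ebase : \sum_i edual i *m ebase i = 1%:M.
Proof.
rewrite -(mulVpmx emx_full); apply/matrixP => a b; rewrite summxE mxE.
rewrite (reindex_onto enum_rank enum_val) /=; last by move=> k _; rewrite enum_valK.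
apply: eq_big => [i|i _]; first by rewrite enum_rankK eqxx.
by rewrite mxE big_ord1 !mxE enum_rankK.
Qed.

Implicit Types (i : sG) (v : 'rV[C]_n) (S : {set sG}).

Lemma row_dual v : v = \sum_(i : sG) (v *m edual i) 0 0 *: (ebase i).
Proof.
rewrite -{1}[v]mulmx1 -(dual_ebase) mulmx_sumr; apply: eq_bigr => i _.
by rewrite mulmxA {1}[v *m _]mx11_scalar mul_scalar_mx.
Qed.

Definition ichar i g : C := (ebase i *m aG g *m edual i) 0 0.

Lemma ichar_eigen i g : g \in G -> ebase i *m aG g = ichar i g *: ebase i.
Proof.
move=> Gg; have [a ea] := ebase_eigen i Gg.
by rewrite /ichar ea -scalemxAl ebase_dual // eqxx !mxE eqxx mulr1n mulr1.
Qed.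

Lemma ebase_scale_inj i a b : a *: ebase i = b *: ebase i -> a = b.
Proof.
move=> /eqP; rewrite -subr_eq0 -scalerBl scaler_eq0 (negPf (ebase_neq0 i)) orbF.
by rewrite subr_eq0 => /eqP.
Qed.

(** The eigenvector of the regular representation for [psi], in the basis of group elements. *)
Definition kvec (psi : gT -> C) : 'rV[C]_n := \row_k (psi (enum_val k))^-1.

Lemma ichar_gchar i : gchar G (ichar i).
Proof.
have M g h : g \in G -> h \in G -> ichar i (g * h)%g = ichar i g * ichar i h.
  move=> Gg Gh; apply: (@ebase_scale_inj i).
  by rewrite -ichar_eigen ?groupM // repr_mxM // mulmxA !ichar_eigen // -scalemxAl ichar_eigen // scalerA mulrC.
split=> // g Gg; apply/eqP => e0.
have := ichar_eigen i (group1 G); rewrite repr_mx1 mulmx1 -(mulgV g) M ?groupV //.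
rewrite e0 mul0r scale0r => /eqP.
by rewrite (negPf (ebase_neq0 i)).
Qed.

Lemma kvec_eigen psi g : gchar G psi -> g \in G -> kvec psi *m aG g = psi g *: kvec psi.
Proof.
move=> cp Gg; have [pM p0] := cp; apply/rowP => k; rewrite !mxE.
have Gk := enum_valP k.
rewrite (bigD1 (gring_index G (enum_val k * g^-1)%g)) //= big1 => [|i ni].
  rewrite !mxE gring_indexK ?groupM ?groupV // mulgKV gring_valK !eqxx mulr1 addr0.
  by rewrite pM ?groupV // (gcharV cp) // invfM invrK mulrC.
rewrite !mxE /=; case: eqP => [ek|]; last by rewrite mulr0.
case/eqP: ni; rewrite ek gring_indexK ?groupM ?enum_valP // mulgK.
by rewrite gring_valK.
Qed.

Lemma eigen_kvec psi v : gchar G psi -> (forall g, g \in G -> v *m aG g = psi g *: v) ->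
  v = v 0 (gring_index G 1%g) *: kvec psi.
Proof.
move=> cp ev; have [pM p0] := cp; apply/rowP => k; rewrite !mxE.
have Gk := enum_valP k; apply: (mulfI (p0 _ Gk)); rewrite mulrCA divff ?p0 // mulr1.
have := congr1 (fun u : 'rV_n => u 0 k) (ev _ Gk); rewrite [X in _ = X]mxE => <-.
rewrite mxE (bigD1 (gring_index G 1%g)) //= big1 => [|i ni].
  by rewrite !mxE gring_indexK // mul1g gring_valK !eqxx mulr1 addr0.
rewrite !mxE /=; case: eqP => [ek|]; last by rewrite mulr0.
case/eqP: ni; apply/enum_val_inj; rewrite gring_indexK //.
have := congr1 (fun k => enum_val k) ek; rewrite gring_indexK ?groupM ?enum_valP // => e1.
by apply: (mulIg (enum_val k)); rewrite -e1 mul1g.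
Qed.

Lemma ichar_inj i j : (forall g, g \in G -> ichar i g = ichar j g) -> i = j.
Proof.
move=> eij; apply/eqP/negPn/negP => nij.
have ei := eigen_kvec (ichar_gchar i) (@ichar_eigen i).
have /(eigen_kvec (ichar_gchar i)) ej : forall g, g \in G -> ebase j *m aG g = ichar i g *: ebase j.
  by move=> g Gg; rewrite eij // ichar_eigen.
have := ebase_dual i j; rewrite (negPf nij) ei -scalemxAl => /eqP.
rewrite raddf0 scaler_eq0 => /orP[/eqP e0|/eqP e0].
  by have := ebase_neq0 i; rewrite ei e0 scale0r eqxx.
have := ebase_dual j j; rewrite ej -scalemxAl e0 scaler0 eqxx => /matrixP/(_ 0 0).
by rewrite !mxE eqxx => /esym/eqP; rewrite oner_eq0.
Qed.

Lemma eigen_ebase i v : (forall g, g \in G -> v *m aG g = ichar i g *: v) ->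
  v = (v *m edual i) 0 0 *: ebase i.
Proof.
move=> /(eigen_kvec (ichar_gchar i)) ev.
have ei := eigen_kvec (ichar_gchar i) (@ichar_eigen i).
set b := ebase i 0 _ in ei; set a := v 0 _ in ev.
have b0 : b != 0.
  by apply/eqP => b0; have := ebase_neq0 i; rewrite ei b0 scale0r eqxx.
have e : v = (a / b) *: ebase i by rewrite ei scalerA divfK.
by rewrite {2}e -scalemxAl ebase_dual // eqxx !mxE eqxx mulr1n mulr1.
Qed.

Lemma ebase_ext m (A B : 'M[C]_(n, m)) :
  (forall i, ebase i *m A = ebase i *m B) -> A = B.
Proof.
move=> e; rewrite -[A]mul1mx -[B]mul1mx -(dual_ebase) !mulmx_suml.
by apply: eq_bigr => i _; rewrite -!mulmxA e.
Qed.

Lemma ichar_surj psi : gchar G psi -> exists i, forall g, g \in G -> ichar i g = psi g.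
Proof.
move=> cp; have [pM p0] := cp.
have : exists i, (kvec psi *m edual i) 0 0 != 0.
  apply/existsP; apply: contraT; rewrite negb_exists => /forallP H.
  have : kvec psi = 0.
    by rewrite [LHS]row_dual big1 // => i _; have /negPn/eqP -> := H i; rewrite scale0r.
  move/rowP/(_ (gring_index G 1%g)); rewrite !mxE gring_indexK // (gchar1 cp) invr1.
  by move/eqP; rewrite oner_eq0.
case=> i ni; exists i => g Gg; apply: (mulIf ni).
have := congr1 (fun u : 'rV_n => (u *m edual i) 0 0) (kvec_eigen cp Gg).
rewrite /= -scalemxAl [X in _ = X]mxE => <-.
rewrite {2}[kvec psi]row_dual !mulmx_suml summxE (bigD1 i) //= big1 ?addr0 => [|j nji].
  by rewrite -!scalemxAl [RHS]mxE mulrC.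
rewrite -!scalemxAl ichar_eigen // -scalemxAl ebase_dual // (negPf nji) raddf0.
by rewrite !scaler0 mxE.
Qed.

Lemma ebase_Wedderburn i j : ebase j *m Wedderburn_id i = (i == j)%:R *: ebase j.
Proof.
have [_ _ _ idR] := Wedderburn_is_id_pchar (pchar'G C G) j.
have jR : (gring_mx aG (ebase j) \in Wedderburn_subring j)%MS.
  by rewrite genmxE mem_gring_mx comp_ebase.
rewrite -[ebase j](gring_mxK) -gring_row_mul.
have [->|nij] := eqVneq i j; first by rewrite idR // scale1r.
by rewrite (Wedderburn_mulmx0 _ jR (Wedderburn_id_mem _)) 1?eq_sym // raddf0 scale0r.
Qed.

Lemma mul_Wedderburn (v : 'rV_n) i : v *m Wedderburn_id i = (v *m edual i) 0 0 *: ebase i.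
Proof.
rewrite {1}(row_dual v) mulmx_suml (bigD1 i) //= big1 ?addr0 => [|j nj].
  by rewrite -scalemxAl ebase_Wedderburn eqxx scale1r.
by rewrite -scalemxAl ebase_Wedderburn eq_sym (negPf nj) scale0r scaler0.
Qed.

Definition support m (W : 'M[C]_(m, n)) : {set sG} := [set i | (ebase i <= W)%MS].
Definition span_mx S : 'M[C]_n := (\sum_(i in S) i)%MS.

Lemma ebase_span S i : i \in S -> (ebase i <= span_mx S)%MS.
Proof. by move=> iS; rewrite -(comp_ebase i) (sumsmx_sup i). Qed.

Lemma support_span S : support (span_mx S) = S.
Proof.
apply/setP => i; rewrite inE; apply/idP/idP; last exact: ebase_span.
apply: contraLR => niS; apply/negP => h.
have : (span_mx S <= kermx (edual i))%MS.
  apply/sumsmx_subP => j jS; rewrite (comp_ebase j) sub_kermx ebase_dual //.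
  by have [e|_] := eqVneq j i; [move: niS; rewrite -e jS|rewrite raddf0].
move/(submx_trans h); rewrite sub_kermx ebase_dual // eqxx => /eqP/matrixP/(_ 0 0).
by rewrite !mxE eqxx => /eqP; rewrite oner_eq0.
Qed.

Lemma span_module S : mxmodule aG (span_mx S).
Proof. by apply: sumsmx_module => i _; apply: component_mx_module. Qed.

(** The projection to an isotypic line is the action of an element of the group algebra. *)
Lemma module_coord m (W : 'M_(m, n)) (v : 'rV_n) i : mxmodule aG W -> (v <= W)%MS ->
  (v *m edual i) 0 0 != 0 -> i \in support W.
Proof.
move=> mW vW vi; rewrite inE -(eqmx_scale _ vi) -mul_Wedderburn.
apply: (mxmodule_envelop mW _ vW).
apply: submx_trans (Wedderburn_id_mem i) _.
by rewrite genmxE submxMl.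
Qed.

Lemma support_neq0 m (W : 'M_(m, n)) : mxmodule aG W -> W != 0 -> support W != set0.
Proof.
move=> mW W0; have v0 : nz_row W != 0 by rewrite nz_row_eq0.
have [/existsP[i vi]|] := boolP [exists i : sG, (nz_row W *m edual i) 0 0 != 0].
  by apply/set0Pn; exists i; apply: module_coord vi => //; apply: nz_row_sub.
rewrite negb_exists => /forallP H; case/eqP: v0.
by rewrite [LHS](row_dual) big1 // => i _; have /negPn/eqP -> := H i; rewrite scale0r.
Qed.

Lemma support_full m (W : 'M_(m, n)) : support W = setT -> row_full W.
Proof.
move=> sT; rewrite -sub1mx -(irr_mx_sum_pchar sG (pchar'G C G)); apply/sumsmx_subP => i _.
by rewrite (comp_ebase i); have := in_setT i; rewrite -sT inE.
Qed.

Lemma rank_cap_irr m (W : 'M_(m, n)) i : \rank (W :&: i)%MS = (i \in support W).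
Proof.
have r1 := comp_rank i; rewrite inE -(comp_ebase i).
case: (boolP (i <= W)%MS) => [iW|niW].
  by rewrite (capmx_idPr iW) r1.
apply/eqP; rewrite -leqn0 -ltnS -r1; apply: rank_ltmx.
rewrite ltmxE capmxSr; apply: contra niW => h.
exact: submx_trans h (capmxSl _ _).
Qed.

Variable psi : 'I_3 -> gT -> C.
Hypothesis psiC : forall j, gchar G (psi j).
Hypothesis psi_prod : forall g, g \in G -> psi lx g * psi ly g * psi lz g = 1.

(** The division reflects the contragredient action on coordinate functions; by [ichar_surj] the
    default value never occurs. *)
Definition mckay (j : 'I_3) i : sG :=
  odflt i [pick k : sG | [forall g in G, ichar k g == ichar i g / psi j g]].

Lemma mckay_ichar j i g : g \in G -> ichar (mckay j i) g = ichar i g / psi j g.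
Proof.
move=> Gg; rewrite /mckay; case: pickP => [k /forall_inP/(_ g Gg)/eqP //|H].
have [k ek] := ichar_surj (gchar_div (ichar_gchar i) (psiC j)).
by have /forall_inP[] := H k; move=> h Gh; rewrite ek.
Qed.

Lemma mckay_comm j l i : mckay j (mckay l i) = mckay l (mckay j i).
Proof. by apply: (ichar_inj) => g Gg; rewrite !mckay_ichar // mulrAC. Qed.

Lemma mckay_inj j : injective (mckay j).
Proof.
move=> i k e; apply: (ichar_inj) => g Gg; have [_ /(_ _ Gg) p0] := psiC j.
by apply: (divIf p0); rewrite -!mckay_ichar // e.
Qed.

Lemma ichar_principal g : g \in G -> ichar (principal_comp sG) g = 1.
Proof.
move=> Gg; apply: (@ebase_scale_inj (principal_comp sG)).
rewrite -ichar_eigen // scale1r; move: g Gg; apply/(@rfix_mxP _ _ _ _ aG _ _ G).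
by rewrite -(irr1_rfix sG) comp_ebase.
Qed.

Definition invariant_lattice (d1 d2 d3 : int) : Prop :=
  forall g, g \in G -> psi lx g ^ d1 * psi ly g ^ d2 * psi lz g ^ d3 = 1.

Let psi0 j g : g \in G -> psi j g != 0. Proof. by case: (psiC j) => _; apply. Qed.

Lemma invariant_latticeP : lattice invariant_lattice.
Proof.
split=> [x y z x' y' z' h h' g Gg|x y z h g Gg|g Gg|x y z].
- rewrite !expfzDr ?psi0 // -[RHS](mulr1 1) -{1}(h g Gg) -(h' g Gg); ring.
- by rewrite -!invr_expz -!invfM h // invr1.
- by rewrite !expr1z psi_prod.
exists #|G|; first exact: cardG_gt0.
have T j g d : g \in G -> psi j g ^ (d *+ #|G|) = 1.
  by move=> Gg; rewrite -mulr_natl -exprz_exp natz -exprnP gchar_torsion // exp1rz.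
by move=> g Gg; rewrite !T // !mulr1.
Qed.

Lemma ichar_mv i w g : g \in G -> ichar (mv mckay i w) g = ichar i g / \prod_(j <- w) psi j g.
Proof.
move=> Gg; elim: w i => [|j w IH] i; first by rewrite big_nil invr1 mulr1.
by rewrite big_cons /= IH mckay_ichar // invfM mulrA.
Qed.

Lemma prod_mon m g : \prod_(j <- mon m) psi j g = psi lx g ^+ m.1.1 * psi ly g ^+ m.1.2 * psi lz g ^+ m.2.
Proof. by rewrite /mon !big_cat /= !big_nseq !iter_mulr !mulr1 mulrA. Qed.

Lemma mckay_mon m m' : mv mckay (principal_comp sG) (mon m) = mv mckay (principal_comp sG) (mon m') <->
  Lexpo invariant_lattice m m'.
Proof.
have Q g : g \in G -> (psi lx g ^+ m.1.1 * psi ly g ^+ m.1.2 * psi lz g ^+ m.2 =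
    psi lx g ^+ m'.1.1 * psi ly g ^+ m'.1.2 * psi lz g ^+ m'.2) <->
    psi lx g ^ (m.1.1%:Z - m'.1.1%:Z) * psi ly g ^ (m.1.2%:Z - m'.1.2%:Z) * psi lz g ^ (m.2%:Z - m'.2%:Z) = 1.
  move=> Gg; have p0 j := psi0 j Gg.
  rewrite !expfzDr // -!invr_expz -!exprnP.
  have h j n : psi j g ^+ n != 0 by rewrite expf_neq0.
  set A := _ ^+ _; set B := _ ^+ _; set D := _ ^+ _; set A' := (psi lx g) ^+ _; set B' := psi ly g ^+ m'.1.2; set D' := psi lz g ^+ m'.2.
  have -> : A / A' * (B / B') * (D / D') = (A * B * D) / (A' * B' * D') by rewrite !invfM; ring.
  split=> [->|/divr1_eq //]; by rewrite divff // !mulf_neq0 //; exact: h.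
split=> [e g Gg|H].
  apply/(Q g Gg); apply: invr_inj; rewrite -!prod_mon.
  by have := congr1 (fun i => ichar i g) e; rewrite !ichar_mv // ichar_principal // !mul1r.
by apply: (ichar_inj) => g Gg; rewrite !ichar_mv // !prod_mon; congr (_ / _); apply/(Q g Gg)/H.
Qed.

End RegularRepresentation.

Section Reach.
Variables (I : finType) (K : numFieldType) (st : 'I_3 -> I -> I) (o : I).
Implicit Types (a : data I K) (S : {set I}).

Definition reachable (a : data I K) : {set I} :=
  [set i | `[< exists2 w, mv st o w = i & pv st a o w != 0 >]].

Lemma reachable_closed a : arrow_closed st a (reachable a).
Proof.
move=> l i; rewrite !inE => /asboolP[w ew pw] a0; apply/asboolP.
by exists (rcons w l); rewrite ?mv_rcons ?ew // pv_rcons mulf_neq0 // ew.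
Qed.

Lemma reachable0 a : o \in reachable a.
Proof. by rewrite inE; apply/asboolP; exists [::]; rewrite //= oner_eq0. Qed.

Lemma reachable_cluster a : comm st a -> reachable a = setT -> cluster st o a.
Proof. by move=> ca rT; split=> // i; have := in_setT i; rewrite -rT inE => /asboolP. Qed.

Lemma cluster_closed a S : cluster st o a -> arrow_closed st a S -> o \in S -> S = setT.
Proof.
move=> [ca ga] aS oS; apply/setP => i; rewrite inE; have [w <- pw] := ga i.
exact: (arrow_closed_pv aS oS pw).
Qed.

End Reach.

(** * Weights of sets of characters *)

Section Weights.
Variables (R : realType) (gT : finGroupType) (G : {group gT}).
Local Notation I := (Irr R G).
Local Notation o := (principal_comp I).
Implicit Types (theta : param R G) (i : I) (S : {set I}) (s : seq (param R G)).

Definition weight theta S : rat := \sum_(i in S) (theta i : rat).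

Lemma weight_segment t theta theta' S :
  weight ((1 - t) *: theta + t *: theta') S = (1 - t) * weight theta S + t * weight theta' S.
Proof.
rewrite /weight !mulr_sumr -big_split /=; apply: eq_bigr => i _.
by rewrite !ffunE.
Qed.

Lemma weightC theta S : in_Theta theta -> weight theta (~: S) = - weight theta S.
Proof.
rewrite /in_Theta (bigID (mem S)) /= => e; apply/eqP; rewrite -addr_eq0 addrC; apply/eqP.
rewrite -[RHS]e; congr (_ + _); apply: eq_bigl => i; by rewrite inE.
Qed.

Lemma positive_weight theta S : positive theta -> S != set0 -> o \notin S -> 0 < weight theta S.
Proof.
move=> [_ pos] /set0Pn[k kS] oS; rewrite /weight (bigD1 k) //=; apply: ltr_wpDr.
  apply: sumr_ge0 => i /andP[iS _]; apply/ltW/pos; by apply: contraNneq oS => <-.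
by apply: pos; apply: contraNneq oS => <-.
Qed.

Definition theta_pos : param R G := [ffun i => if i == o then - (#|[set~ o]|%:R : rat) else 1].

Lemma theta_pos_positive : positive theta_pos.
Proof.
split=> [|i /negPf io]; last by rewrite ffunE io.
rewrite /in_Theta (bigD1 o) //= ffunE eqxx (eq_bigr (fun=> 1)) => [|i /negPf io]; last by rewrite ffunE io.
rewrite sumr_const addrC; apply/eqP; rewrite subr_eq0; apply/eqP; congr (_%:R).
by apply: eq_card => i; rewrite !inE.
Qed.

Lemma weightD theta theta' S : weight (theta + theta') S = weight theta S + weight theta' S.
Proof. by rewrite -big_split /=; apply: eq_bigr => i _; rewrite ffunE. Qed.

Lemma weightZ t theta S : weight (t *: theta) S = t * weight theta S.
Proof. by rewrite /weight mulr_sumr; apply: eq_bigr => i _; rewrite ffunE. Qed.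

Lemma span_weight S s theta : (forall t, t \in s -> weight t S = 0) ->
  theta \in <<s>>%VS -> weight theta S = 0.
Proof.
move=> s0 /(coord_span (X := in_tuple s)) ->.
apply: (big_ind (fun t => weight t S = 0)) => [|t t' h h'|k _].
- by rewrite /weight big1 // => i _; rewrite ffunE.
- by rewrite weightD h h' addr0.
by rewrite weightZ s0 ?mulr0 // mem_nth.
Qed.

Lemma free_size s : free s -> (size s <= #|{: I}|)%N.
Proof.
move=> /eqP <-; apply: leq_trans (dimvS (subvf _)) _.
by rewrite dimvf -[X in (_ <= X)%N]muln1.
Qed.

Definition delta i : param R G := [ffun k => (k == i)%:R].

Lemma weight_delta i S : weight (delta i) S = (i \in S)%:R.
Proof.
rewrite /weight big_mkcond (bigD1 i) //= ffunE eqxx big1 ?addr0; first by case: (i \in S).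
by move=> k /negPf nk; rewrite ffunE nk; case: ifP.
Qed.

Lemma weight_deltaB i k S : weight (delta i - delta k) S = (i \in S)%:R - (k \in S)%:R.
Proof. by rewrite weightD -scaleN1r weightZ !weight_delta mulN1r. Qed.

(** The weights of the full set, of [W'] and of [W] vanish on [s] and are triangular on three
    further vectors, which therefore extend [s] to a free family. *)
Lemma three_free s W W' : free s -> (forall t, t \in s -> in_Theta t) ->
  (forall t, t \in s -> weight t W = 0) -> (forall t, t \in s -> weight t W' = 0) ->
  o \notin W -> o \notin W' -> W' != set0 -> ~~ (W \subset W') ->
  (size s + 3 <= #|{: I}|)%N.
Proof.
move=> fs sT sW sW' oW oW' /set0Pn[k kW'] /subsetPn[i iW niW'].
have : free [:: delta o, delta k - delta o, delta i - delta o & s].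
  rewrite !free_cons fs andbT; apply/and3P; split; apply/negP.
  - move/(span_weight (S := setT)); rewrite weight_delta inE => h; move/eqP: (oner_neq0 rat); apply; apply: h.
    move=> t; rewrite !inE => /or3P[/eqP->|/eqP->|ts]; rewrite ?weight_deltaB ?inE ?subrr //.
    by rewrite /weight -[RHS](sT _ ts); apply: eq_bigl => j; rewrite inE.
  - move/(span_weight (S := W')); rewrite weight_deltaB kW' (negPf oW') subr0 => h.
    move/eqP: (oner_neq0 rat); apply; apply: h => t.
    rewrite !inE => /orP[/eqP->|/sW' //]; by rewrite weight_deltaB (negPf niW') (negPf oW') subrr.
  move/(span_weight (S := W)); rewrite weight_deltaB iW (negPf oW) subr0 => h.
  move/eqP: (oner_neq0 rat); apply; exact: h.
by move/free_size; rewrite /= addn3.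
Qed.

(** A basis of the space of parameters inside the closed chamber, which shows that the chamber has
    full dimension. *)
Definition deltas : seq (param R G) := [seq delta i - delta o | i <- enum (predC1 o)].

Lemma size_deltas : size deltas = #|{: I}|.-1.
Proof. by rewrite size_map -cardE cardC1. Qed.

Lemma free_deltas : free deltas.
Proof.
rewrite /deltas; have := enum_uniq (predC1 o).
have : {subset enum (predC1 o) <= predC1 o} by move=> i; rewrite mem_enum.
elim: (enum _) => [|i s IH] /= io; first by rewrite nil_free.
case/andP=> nis us; rewrite free_cons IH // ?andbT; last by move=> k ks; apply: io; rewrite inE ks orbT.
have nio : i != o by apply: io; rewrite mem_head.
apply/negP => /(span_weight (S := [set i])); rewrite weight_deltaB !inE eqxx eq_sym (negPf nio) subr0 => h.
move/eqP: (oner_neq0 rat); apply; apply: h => t /mapP[k ks ->].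
rewrite weight_deltaB !inE [o == i]eq_sym (negPf nio) subr0.
by have /negPf -> : k != i by apply: contraNneq nis => <-.
Qed.

Lemma deltasP (Q : param R G -> Prop) : (forall i, i != o -> Q (delta i - delta o)) ->
  forall t, t \in deltas -> Q t.
Proof.
move=> Qd t; rewrite /deltas; have : {subset enum (predC1 o) <= predC1 o} by move=> i; rewrite mem_enum.
elim: (enum _) => [|i s IH] //= io; rewrite inE => /predU1P[->|].
  by apply: Qd; apply: io; rewrite mem_head.
by apply: IH => k ks; apply: io; rewrite inE ks orbT.
Qed.

End Weights.

(** * Polynomial functions and semi-invariant monomials *)

Section PolynomialFunctions.
Variables (R : realType) (gT : finGroupType) (G : {group gT}).
Local Notation C := R[i]%C.
Implicit Types (X : rep R G) (f g : rep R G -> C).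

Definition pfun f : Prop := exists p, forall X, f X = eval p X.

Lemma pfun_const c : pfun (fun=> c).
Proof. by exists c%:MP => X; rewrite /eval mevalC. Qed.

Lemma pfun_coord j x y : pfun (fun X => X j x y).
Proof. by exists 'X_(enum_rank (j, x, y)) => X; rewrite /eval mevalXU enum_rankK. Qed.

Lemma pfun_add f g : pfun f -> pfun g -> pfun (fun X => f X + g X).
Proof. by move=> [p fp] [q gq]; exists (p + q) => X; rewrite fp gq /eval mevalD. Qed.

Lemma pfun_mul f g : pfun f -> pfun g -> pfun (fun X => f X * g X).
Proof. by move=> [p fp] [q gq]; exists (p * q) => X; rewrite fp gq /eval mevalM. Qed.

Lemma pfun_sum (J : Type) (r : seq J) (F : J -> rep R G -> C) :
  (forall k, pfun (F k)) -> pfun (fun X => \sum_(k <- r) F k X).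
Proof.
move=> pF; elim: r => [|k r IH].
  by have [p e] := pfun_const 0; exists p => X; rewrite big_nil -e.
by have [p e] := pfun_add (pF k) IH; exists p => X; rewrite big_cons -e.
Qed.

Lemma pfun_prod (J : Type) (r : seq J) (F : J -> rep R G -> C) :
  (forall k, pfun (F k)) -> pfun (fun X => \prod_(k <- r) F k X).
Proof.
move=> pF; elim: r => [|k r IH].
  by have [p e] := pfun_const 1; exists p => X; rewrite big_nil -e.
by have [p e] := pfun_mul (pF k) IH; exists p => X; rewrite big_cons -e.
Qed.

Lemma pfun_exp f n : pfun f -> pfun (fun X => f X ^+ n).
Proof.
move=> pf; elim: n => [|n IH]; first exact: pfun_const.
by have [p e] := pfun_mul pf IH; exists p => X; rewrite exprS -e.
Qed.

End PolynomialFunctions.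

Section PolyfSums.
Variables (I : finType) (K : numFieldType).

Lemma polyf_eq (f g : data I K -> K) : polyf f -> f =1 g -> polyf g.
Proof. by move=> pf /funext <-. Qed.

Lemma polyf_sum (J : Type) (r : seq J) (F : J -> data I K -> K) :
  (forall k, polyf (F k)) -> polyf (fun a => \sum_(k <- r) F k a).
Proof.
move=> pF; elim: r => [|k r IH].
  by apply: (polyf_eq (@polyf_const I K 0)) => a; rewrite big_nil.
by apply: (polyf_eq (polyf_add (pF k) IH)) => a; rewrite big_cons.
Qed.

Lemma polyf_prod (J : Type) (r : seq J) (F : J -> data I K -> K) :
  (forall k, polyf (F k)) -> polyf (fun a => \prod_(k <- r) F k a).
Proof.
move=> pF; elim: r => [|k r IH].
  by apply: (polyf_eq (@polyf_const I K 1)) => a; rewrite big_nil.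
by apply: (polyf_eq (polyf_mul (pF k) IH)) => a; rewrite big_cons.
Qed.

Lemma polyf_exp (f : data I K -> K) n : polyf f -> polyf (fun a => f a ^+ n).
Proof.
move=> pf; elim: n => [|n IH]; first exact: polyf_const.
by apply: (polyf_eq (polyf_mul pf IH)) => a; rewrite exprS.
Qed.

End PolyfSums.

Section Semiinvariants.
Variables (I A : finType) (K : fieldType) (s t : A -> I).

Lemma prod_gauge (c : I -> K) (n : A -> nat) : (forall i, c i != 0) ->
  \prod_a ((c (s a))^-1 * c (t a)) ^+ n a = \prod_i c i ^ (flux s t (fun a => (n a)%:Z) i).
Proof.
move=> c0; have cz i d : c i ^ d != 0 by rewrite expfz_neq0.
have E i : c i ^ (flux s t (fun a => (n a)%:Z) i) =
    \prod_a (c i ^ ((n a)%:Z * ((t a == i)%:R - (s a == i)%:R))).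
  rewrite /flux; apply: (big_ind2 (fun (d : int) x => c i ^ d = x)) => [|d x d' y <- <-|//].
    by rewrite expr0z.
  by rewrite expfzDr.
under [RHS]eq_bigr => i _ do rewrite E.
rewrite exchange_big /=; apply: eq_bigr => a _.
have D i : c i ^ ((n a)%:Z * ((t a == i)%:R - (s a == i)%:R)) =
    (if t a == i then c i ^+ n a else 1) * (if s a == i then (c i ^+ n a)^-1 else 1).
  rewrite mulrBr expfzDr // -invr_expz.
  by case: (t a == i); case: (s a == i); rewrite ?mulr1 ?mulr0 ?expr0z ?invr1 ?mulr1 // -exprnP.
under [RHS]eq_bigr => i _ do rewrite D.
rewrite big_split /= -!big_mkcond /= (big_pred1 (t a)) => [|i]; last by rewrite eq_sym.
rewrite (big_pred1 (s a)) => [|i]; last by rewrite eq_sym.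
by rewrite exprMn exprVn mulrC.
Qed.

End Semiinvariants.

(** * From constellations and walls to quiver data *)

Section Moduli.
Variables (R : realType) (gT : finGroupType) (G : {group gT}).
Local Notation C := R[i]%C.
Hypothesis abG : abelian G.
Variables (rG : mx_representation C G 3) (P : 'M[C]_3) (psi : 'I_3 -> gT -> C).
Hypothesis uP : P \in unitmx.
Hypothesis psiC : forall j, gchar G (psi j).
Hypothesis PrG : forall g, g \in G -> P *m rG g = diag_mx (\row_j psi j g) *m P.
Local Notation I := (Irr R G).
Local Notation aG := (regular_repr C G).
Local Notation st := (@mckay C gT G I psi).
Local Notation o := (principal_comp I).
Implicit Types (X : rep R G) (theta : param R G) (i : I) (l : 'I_3).
Implicit Types (S : {set I}) (a b : data I C).

Lemma psi_prod g : g \in G -> \det (rG g) = 1 -> psi lx g * psi ly g * psi lz g = 1.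
Proof.
move=> Gg d1; have : \det (P *m rG g) = \det P by rewrite det_mulmx d1 mulr1.
rewrite PrG // det_mulmx det_diag => e.
have P0 : \det P != 0 by rewrite -unitfE -unitmxE.
have := mulIf P0 (etrans e (esym (mul1r _))).
rewrite !big_ord_recl big_ord0 !mxE mulr1 mulrA => e1; rewrite -[RHS]e1.
by congr (psi _ g * psi _ g * psi _ g); apply: val_inj.
Qed.

Definition diag_coord X l : 'M[C]_#|G| := \sum_k invmx P k l *: X k.

Lemma change_basis (V : lmodType C) (A B : 'M[C]_3) (v : 'I_3 -> V) j : B *m A = 1%:M ->
  \sum_l A l j *: (\sum_k B k l *: v k) = v j.
Proof.
move=> BA; under eq_bigr => l _ do rewrite scaler_sumr.
rewrite exchange_big /= (eq_bigr (fun k => (k == j)%:R *: v k)) => [|k _].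
  by rewrite (bigD1 j) //= eqxx scale1r big1 ?addr0 // => k /negPf ->; rewrite scale0r.
have := congr1 (fun M : 'M_3 => M k j) BA; rewrite !mxE => <-; rewrite scaler_suml.
by apply: eq_bigr => l _; rewrite scalerA mulrC.
Qed.

Lemma diag_coordK X j : X j = \sum_l P l j *: diag_coord X l.
Proof. by rewrite change_basis // mulVmx. Qed.

Lemma lincomb_comm (Y : 'I_3 -> 'M[C]_#|G|) (f g : 'I_3 -> C) :
  (forall j k, Y j *m Y k = Y k *m Y j) ->
  (\sum_j f j *: Y j) *m (\sum_k g k *: Y k) = (\sum_k g k *: Y k) *m (\sum_j f j *: Y j).
Proof.
move=> YY; rewrite !mulmx_suml; under eq_bigr => k _ do rewrite mulmx_sumr.
rewrite exchange_big /=; apply: eq_bigr => j _; rewrite mulmx_sumr.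
by apply: eq_bigr => k _; rewrite -!scalemxAl -!scalemxAr YY !scalerA mulrC.
Qed.

Lemma constellationP X : constellation rG X <->
  (forall l m, diag_coord X l *m diag_coord X m = diag_coord X m *m diag_coord X l) /\
  (forall g, g \in G -> forall l,
    diag_coord X l *m aG g = (psi l g)^-1 *: (aG g *m diag_coord X l)).
Proof.
have rQ g : g \in G -> forall k l, \sum_j rG g k j * invmx P j l = invmx P k l * psi l g.
  move=> Gg k l; have := congr1 (fun A => (invmx P *m A *m invmx P) k l) (PrG Gg).
  rewrite !mulmxA mulVmx // mul1mx mulmxK // mxE => ->.
  rewrite mxE (bigD1 l) //= big1 ?addr0 => [|j nj]; first by rewrite !mxE eqxx mulr1n.
  by rewrite !mxE (negPf nj) mulr0n mulr0.
have Pr g : g \in G -> forall l j, \sum_k P l k * rG g k j = psi l g * P l j.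
  move=> Gg l j; have := congr1 (fun A : 'M_3 => A l j) (PrG Gg).
  by rewrite mul_diag_mx !mxE.
split=> [[XX Xg]|[YY Yg]]; split.
- by move=> l m; exact: lincomb_comm.
- move=> g Gg l; rewrite -(gcharV (psiC l) Gg) mulmx_sumr mulmx_suml scaler_sumr.
  under eq_bigr => k _ do rewrite -scalemxAl Xg // scaler_sumr.
  rewrite exchange_big /=; apply: eq_bigr => j _; rewrite -scalemxAr scalerA.
  rewrite mulrC -rQ ?groupV // scaler_suml; apply: eq_bigr => k _.
  by rewrite scalerA mulrC.
- by move=> j k; rewrite (diag_coordK X j) (diag_coordK X k); exact: lincomb_comm.
move=> g Gg j; rewrite {1}(diag_coordK X j) mulmx_suml.
under eq_bigr => l _ do rewrite -scalemxAl Yg // scalerA mulrC -(gcharV (psiC l) Gg) -Pr ?groupV // scaler_suml.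
rewrite exchange_big /=; apply: eq_bigr => k _; rewrite [in RHS](diag_coordK X k).
rewrite mulmx_sumr scaler_sumr; apply: eq_bigr => l _.
by rewrite -scalemxAr scalerA mulrC.
Qed.

Definition dat X : data I C := fun l i => (ebase i *m diag_coord X l *m edual (st l i)) 0 0.

Definition mk (a : data I C) : rep R G :=
  [ffun j => \sum_l P l j *: \sum_i a l i *: (edual i *m ebase (st l i))].

Lemma datE X l i : dat X l i = (ebase i *m diag_coord X l *m edual (st l i)) 0 0.
Proof. by []. Qed.

Lemma dat_eigen X l i : constellation rG X ->
  ebase i *m diag_coord X l = dat X l i *: ebase (st l i).
Proof.
move=> /constellationP[_ Yg]; apply: (eigen_ebase abG) => g Gg.
rewrite -mulmxA Yg // -scalemxAr mulmxA ichar_eigen // -scalemxAl scalerA.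
by rewrite (mckay_ichar abG psiC l i Gg) mulrC.
Qed.

Lemma diag_coord_mk a l : diag_coord (mk a) l = \sum_i a l i *: (edual i *m ebase (st l i)).
Proof.
by rewrite /diag_coord; under eq_bigr => k _ do rewrite ffunE; rewrite change_basis // mulmxV.
Qed.

Lemma mk_eigen a l i : ebase i *m diag_coord (mk a) l = a l i *: ebase (st l i).
Proof.
rewrite diag_coord_mk mulmx_sumr (bigD1 i) //= big1 ?addr0 => [|k nk].
  by rewrite -scalemxAr mulmxA ebase_dual // eqxx mul1mx.
by rewrite -scalemxAr mulmxA ebase_dual // eq_sym (negPf nk) raddf0 mul0mx scaler0.
Qed.

Lemma mkK a : dat (mk a) = a.
Proof.
apply/funext => l; apply/funext => i; rewrite /dat mk_eigen -scalemxAl ebase_dual //.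
by rewrite eqxx !mxE eqxx mulr1n mulr1.
Qed.

Lemma datK X : constellation rG X -> mk (dat X) = X.
Proof.
move=> cX; apply/ffunP => j; rewrite !diag_coordK; apply: eq_bigr => l _; congr (_ *: _).
by apply: (ebase_ext abG (sG := I)) => i; rewrite mk_eigen dat_eigen.
Qed.

Lemma dat_comm X : constellation rG X -> comm st (dat X).
Proof.
move=> cX j k i; have [YY _] := (constellationP X).1 cX.
have E l m : ebase i *m diag_coord X l *m diag_coord X m =
    (dat X l i * dat X m (st l i)) *: ebase (st m (st l i)).
  by rewrite (dat_eigen _ _ cX) -scalemxAl (dat_eigen _ _ cX) scalerA.
have := congr1 (mulmx (ebase i)) (YY j k); rewrite [X in X = _]mulmxA [X in _ = X]mulmxA !E.
rewrite (mckay_comm abG psiC j k i); exact: ebase_scale_inj.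
Qed.

Lemma mk_constellation a : comm st a -> constellation rG (mk a).
Proof.
have E l m i : ebase i *m diag_coord (mk a) l *m diag_coord (mk a) m =
    (a l i * a m (st l i)) *: ebase (st m (st l i)).
  by rewrite (mk_eigen a l i) -scalemxAl (mk_eigen a m _) scalerA.
move=> ca; apply/constellationP; split=> [l m|g Gg l]; apply: (ebase_ext abG (sG := I)) => i.
  by rewrite [LHS]mulmxA [RHS]mulmxA E E ca (mckay_comm abG psiC l m i).
rewrite [LHS]mulmxA (mk_eigen a l i) -scalemxAl (ichar_eigen abG _ Gg).
rewrite -[RHS]scalemxAr [in RHS]mulmxA (ichar_eigen abG _ Gg) -scalemxAl (mk_eigen a l i).
rewrite !scalerA (mckay_ichar abG psiC l i Gg); congr (_ *: _); ring.
Qed.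

Lemma theta_of_support (theta : param R G) W :
  theta_of theta W = \sum_(i in support I W) theta i.
Proof.
have d1 i : irr_degree i = 1%N.
  exact: irr_degree_abelian (@group_closure_closed_field C gT G) abG i.
rewrite [RHS]big_mkcond /=; apply: eq_bigr => i _.
by rewrite /mult d1 divn1 rank_cap_irr //; case: (i \in _).
Qed.

Lemma subsheaf_support X W : constellation rG X -> subsheaf X W ->
  arrow_closed st (dat X) (support I W).
Proof.
move=> cX [_ sW] l i; rewrite !inE => iW d0.
rewrite -(eqmx_scale _ d0) -(dat_eigen l i cX).
rewrite mulmx_sumr summx_sub // => k _; rewrite -scalemxAr scalemx_sub //.
exact: submx_trans (submxMr _ iW) (sW k).
Qed.

Lemma subsheaf_span X S : constellation rG X -> arrow_closed st (dat X) S ->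
  subsheaf X (span_mx S).
Proof.
move=> cX aS; split=> [|j]; first exact: span_module.
rewrite sumsmxMr; apply/sumsmx_subP => i iS.
rewrite (eqmxMr _ (comp_ebase abG i)) (diag_coordK X j) mulmx_sumr summx_sub // => l _.
rewrite -scalemxAr scalemx_sub // (dat_eigen l i cX).
have [->|d0] := eqVneq (dat X l i) 0; first by rewrite scale0r sub0mx.
by rewrite scalemx_sub // ebase_span // aS.
Qed.

Lemma subsheaf_weights (Q : rat -> Prop) theta X : constellation rG X ->
  (forall W, subsheaf X W -> W != 0 -> ~~ row_full W -> Q (theta_of theta W)) <->
  (forall S, arrow_closed st (dat X) S -> S != set0 -> S != setT -> Q (weight theta S)).
Proof.
move=> cX; split=> sX W => [aW W0 WT|sW W0 WT].
  have := sX _ (subsheaf_span cX aW); rewrite theta_of_support support_span //; apply.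
    apply: contraNneq W0 => e0; rewrite -(support_span abG W) e0.
    by apply/eqP/setP => i; rewrite !inE submx0 (negPf (ebase_neq0 i)).
  by apply: contra WT => /submx_full f; rewrite -(support_span abG W); apply/eqP/setP => i; rewrite !inE f.
have [mW _] := sW; rewrite theta_of_support; apply: sX.
- exact: subsheaf_support.
- exact: support_neq0.
by apply: contra WT => /eqP/(support_full abG).
Qed.

Lemma stableP theta X : Defs.stable rG theta X <-> constellation rG X /\
  forall S, arrow_closed st (dat X) S -> S != set0 -> S != setT -> 0 < weight theta S.
Proof. by split=> -[cX sX]; split=> //; apply/(subsheaf_weights (fun x => 0 < x)). Qed.

Lemma semistableP theta X : semistable rG theta X <-> constellation rG X /\
  forall S, arrow_closed st (dat X) S -> S != set0 -> S != setT -> 0 <= weight theta S.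
Proof. by split=> -[cX sX]; split=> //; apply/(subsheaf_weights (fun x => 0 <= x)). Qed.

(** If the trivial character generated a proper submodule, the complementary characters would have
    positive weight, and the submodule a negative one. *)
Lemma semistable_cluster theta X : positive theta -> semistable rG theta X -> cluster st o (dat X).
Proof.
move=> pos /(semistableP)[cX sX].
apply: reachable_cluster; first exact: (dat_comm).
apply/eqP; apply: contraT => nT.
set S := reachable _ _ _ in nT; have oS : o \in S by exact: reachable0.
have S0 : S != set0 by apply/set0Pn; exists o.
have := sX S (@reachable_closed _ _ _ _ _) S0 nT; rewrite leNgt => /negP[].
rewrite -(setCK S) weightC; last by case: pos.
rewrite oppr_lt0 positive_weight //; last by rewrite in_setC oS.
by apply: contraNneq nT => e; rewrite -(setCK S) e setC0.
Qed.

Lemma cluster_stable theta X : positive theta -> constellation rG X -> cluster st o (dat X) ->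
  Defs.stable rG theta X.
Proof.
move=> pos cX clX; apply/(stableP); split=> // S aS S0 ST.
apply: positive_weight => //; apply: contra ST => oS; apply/eqP.
exact: cluster_closed aS oS.
Qed.

Lemma stable_semistable theta X : Defs.stable rG theta X -> semistable rG theta X.
Proof. by move=> [cX sX]; split=> // W sW W0 WT; apply/ltW/sX. Qed.

Lemma positive_generic theta : positive theta -> generic rG theta.
Proof.
move=> pos; split=> [|X ssX]; first by case: pos.
exact: (cluster_stable pos (proj1 ssX) (semistable_cluster pos ssX)).
Qed.

(** At the first parameter where some submodule reaches weight zero, [X] is semistable but not
    stable, against genericity. This parameter is rational because the weights are. *)
Lemma segment_stable theta theta' X : generic_segment rG theta theta' ->
  Defs.stable rG theta X -> Defs.stable rG theta' X.
Proof.
move=> gen /(stableP)[cX sX]; apply/(stableP); split=> //.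
pose bad S := [&& `[< arrow_closed st (dat X) S >], S != set0, S != setT & weight theta' S <= 0].
suff nb S : ~~ bad S.
  move=> S aS S0 ST; rewrite ltNge; apply: contra (nb S) => h.
  by rewrite /bad S0 ST h !andbT; apply/asboolP.
apply/negP => bS.
pose T S := weight theta S / (weight theta S - weight theta' S).
have [M /and4P[/asboolP aM M0 MT wM] minM] : exists2 M, bad M & forall S, bad S -> T M <= T S.
  by case: (arg_minP T bS) => M; exists M.
have wpos S' : arrow_closed st (dat X) S' -> S' != set0 -> S' != setT -> 0 < weight theta S'.
  exact: sX.
have wM0 := wpos M aM M0 MT.
have wM1 : 0 < weight theta M - weight theta' M by lra.
have T01 : 0 <= T M <= 1.
  apply/andP; split; first by apply: divr_ge0; exact: ltW.
  by rewrite /T (ler_pdivrMr _ _ wM1) mul1r; lra.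
have [_ /(_ X) gt] := gen (T M) T01.
have /gt/(stableP)[_ /(_ M aM M0 MT)] :
    semistable rG ((1 - T M) *: theta + T M *: theta') X.
  apply/(semistableP); split=> // S' aS' S0 ST; rewrite weight_segment.
  have w0 := wpos S' aS' S0 ST; have [w1|w1] := ltP 0 (weight theta' S').
    by case/andP: T01 => h1 h2; apply: addr_ge0; apply: mulr_ge0; rewrite ?subr_ge0 // ltW.
  have : bad S' by rewrite /bad S0 ST w1 !andbT; apply/asboolP.
  by move/minM; rewrite {2}/T ler_pdivlMr ?subr_gt0 1?(le_lt_trans w1) // => h; lra.
rewrite -/(weight _ _) weight_segment {1 2}/T.
have d0 : weight theta M - weight theta' M != 0 by lra.
have -> : (1 - weight theta M / (weight theta M - weight theta' M)) * weight theta M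
  + weight theta M / (weight theta M - weight theta' M) * weight theta' M = 0 by field.
by rewrite ltxx.
Qed.

Lemma segment_sym theta theta' : generic_segment rG theta theta' -> generic_segment rG theta' theta.
Proof.
move=> gen t t01; have := gen (1 - t); rewrite subKr [X in generic _ X]addrC; apply; lra.
Qed.

Lemma chamber_stable theta theta' X : same_chamber rG theta theta' ->
  Defs.stable rG theta X <-> Defs.stable rG theta' X.
Proof.
case=> _ _; elim=> [a b ab|a|a b c _ IH1 _ IH2] //; last by rewrite IH1.
by split; apply: segment_stable => //; apply: segment_sym.
Qed.

Lemma positive_chamber0 theta : positive theta -> chamber0 rG theta.
Proof.
move=> pos; have gen := positive_generic pos.
by exists theta => //; split=> //; apply: rt_refl.
Qed.

Lemma chamber0_cluster theta X : chamber0 rG theta -> constellation rG X ->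
  Defs.stable rG theta X <-> cluster st o (dat X).
Proof.
move=> [theta0 pos sc] cX; rewrite -(chamber_stable X sc); split; last exact: cluster_stable.
by move/stable_semistable; apply: semistable_cluster.
Qed.

Lemma stable0P X : stable0 rG X <-> constellation rG X /\ cluster st o (dat X).
Proof.
split=> [sX|[cX clX] theta ch]; last exact/(chamber0_cluster ch cX).
have ch := positive_chamber0 (theta_pos_positive R G); have [cX _] := sX _ ch.
split; first exact: cX.
exact: (proj1 (chamber0_cluster ch cX) (sX _ ch)).
Qed.

Lemma cluster_weight theta a W : chamber0 rG theta -> cluster st o a -> arrow_closed st a W ->
  W != set0 -> o \notin W -> 0 < weight theta W.
Proof.
move=> ch cla aW W0 oW; have ca : comm st a by case: cla.
have cX := mk_constellation ca.
have da := mkK a.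
have clX : cluster st o (dat (mk a)) by rewrite da.
have := proj2 (chamber0_cluster ch cX) clX.
move/(stableP) => [_ /(_ W)]; rewrite da; apply=> //.
by apply: contraNneq oW => ->; rewrite inE.
Qed.

Lemma closure0_near theta (d : rat) : closure0 rG theta -> 0 < d ->
  exists2 theta', chamber0 rG theta' & forall W, `|weight theta W - weight theta' W| < d.
Proof.
move=> [_ cl] d0; have n0 : 0 < #|{: I}|.+1%:R :> rat by rewrite ltr0n.
have [theta' ch near] := cl (d / #|{: I}|.+1%:R) (divr_gt0 d0 n0).
exists theta' => // W; rewrite /weight -sumrB; apply: le_lt_trans (ler_norm_sum _ _ _) _.
apply: (@le_lt_trans _ _ (\sum_(i in W) d / #|{: I}|.+1%:R)).
  by apply: ler_sum => i _; apply/ltW/near.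
apply: (@le_lt_trans _ _ (\sum_(i : I) d / #|{: I}|.+1%:R)).
  rewrite [leLHS]big_mkcond; apply: ler_sum => i _; case: ifP => // _.
  by apply: divr_ge0; apply: ltW.
rewrite sumr_const -(mulr_natr (d / _)) mulrAC ltr_pdivrMr // ltr_pM2l // ltr_nat.
by rewrite ltnS max_card.
Qed.

Lemma closure0_weight theta a W : closure0 rG theta -> cluster st o a -> arrow_closed st a W ->
  o \notin W -> 0 <= weight theta W.
Proof.
move=> cl cla aW oW; have [->|W0] := eqVneq W set0; first by rewrite /weight big_set0.
rewrite leNgt; apply/negP => neg; have := closure0_near cl; move/(_ (- weight theta W)).
rewrite oppr_gt0 => /(_ neg)[theta' ch /(_ W)]; rewrite ltr_norml => /andP[h _].
have := cluster_weight ch cla aW W0 oW; lra.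
Qed.

Lemma closure0_delta i : i != o -> closure0 rG (delta i - delta o).
Proof.
move=> io; split.
  rewrite /in_Theta; have := weight_deltaB i o setT; rewrite !inE subrr => e.
  by rewrite -[RHS]e; apply: eq_bigl => k; rewrite inE.
move=> e e0; have n0 : 0 < #|{: I}|.+1%:R :> rat by rewrite ltr0n.
(* The entries of [theta_pos] are bounded by the number of characters, hence the denominator. *)
pose c := e / #|{: I}|.+1%:R; have c0 : 0 < c by rewrite divr_gt0.
have [tT tp] := theta_pos_positive R G.
exists (delta i - delta o + c *: theta_pos R G).
  apply: (positive_chamber0); split=> [|k ko].
    rewrite /in_Theta; have := weightD (delta i - delta o) (c *: theta_pos R G) setT.
    rewrite weight_deltaB weightZ !inE subrr add0r => h.
    have e1 theta : \sum_i theta i = weight theta setT by apply: eq_bigl => k; rewrite inE.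
    by rewrite e1 h -e1 tT mulr0.
  rewrite !ffunE (negPf ko) subr0; apply: ltr_wpDl; first by case: (_ == _).
  by apply: mulr_gt0 => //; apply: tp.
move=> k; have -> : (delta i - delta o) k - (delta i - delta o + c *: theta_pos R G) k = - (c * theta_pos R G k) :> rat.
  by rewrite !ffunE opprD addrA subrr add0r.
rewrite normrN normrM (gtr0_norm c0) /c mulrAC ltr_pdivrMr // ltr_pM2l // ffunE.
case: ifP => _; first by rewrite normrN normr_nat ltr_nat ltnS max_card.
by rewrite normr1 ltr1n ltnS; apply/card_gt0P; exists o.
Qed.

(** The dimension of the wall is at least the number of characters minus two, and a submodule of
    weight zero at [theta0] has weight zero on the whole wall; two different supports would leave
    too little room. *)
Lemma wall_data F theta0 : wall0 rG F -> generic_on F theta0 ->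
  [/\ weight theta0 setT = 0,
   forall a W, cluster st o a -> arrow_closed st a W -> o \notin W -> 0 <= weight theta0 W,
   forall a a' W W', tight st o theta0 a W -> tight st o theta0 a' W' -> W = W' &
   forall a S (b : data I C), tight st o theta0 a S -> comm st b ->
    (forall W, arrow_closed st b W -> W != set0 -> W != setT -> W = S \/ 0 < weight theta0 W) ->
    cluster st o b].
Proof.
move=> [[f [_ fF]] [d [[s [sF fs ss]] _] [_ dK]]] [F0 gen0].
have FK theta : F theta -> closure0 rG theta by case/fF.
have K0 := FK _ F0.
have in_ThetaE theta : in_Theta theta <-> weight theta setT = 0.
  by rewrite /in_Theta /weight; under [X in _ <-> X = _]eq_bigl => i do rewrite inE.
(* The weight of W is nonnegative at [theta] and at a point of the wall on the other side of
   [theta0], and zero at [theta0]. *)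
have tightF a W theta : tight st o theta0 a W -> F theta -> weight theta W = 0.
  move=> [cla aW oW W0 wW] Ft; have [e e0 /FK ke] := gen0 _ Ft.
  have := closure0_weight ke cla aW oW; rewrite weightD weightZ weightD -scaleN1r weightZ.
  have := closure0_weight (FK _ Ft) cla aW oW.
  have -> : weight theta0 W = 0 by exact: wW.
  rewrite add0r add0r mulN1r mulrN oppr_ge0 => h1 h2.
  by apply/eqP; rewrite eq_le h1 andbT -(pmulr_rle0 _ e0).
have dn : (#|{: I}|.-1 <= d.+1)%N.
  rewrite -(size_deltas R G); apply: dK (free_deltas R G).
  by apply: deltasP => i io; apply: closure0_delta.
split.
- by apply/in_ThetaE; case: K0.
- by move=> a W; apply: closure0_weight.
- move=> a a' W W' tW tW'; apply/eqP/negPn/negP => nW.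
  have [[_ _ oW W0 _] [_ _ oW' W0' _]] := (tW, tW').
  have sT t : t \in s -> in_Theta t by move/sF/FK => [].
  have h1 t : t \in s -> weight t W = 0 by move/sF; apply: tightF tW.
  have h2 t : t \in s -> weight t W' = 0 by move/sF; apply: tightF tW'.
  have : (size s + 3 <= #|{: I}|)%N.
    case: (boolP (W \subset W')) => [sub|nsub]; last exact: three_free oW oW' W0' nsub.
    apply: (three_free fs sT h2 h1 oW' oW W0); apply: contra nW => sub'.
    by rewrite eqEsubset sub.
  rewrite ss; lia.
move=> a S b tS cb wb.
(* Within the least positive weight of [theta0], a parameter of the chamber keeps all strict
   inequalities. *)
have [e e0 we] := eps_ex [seq weight theta0 W | W <- enum {: {set I}}].
have [theta ch near] := closure0_near K0 e0.
have [cla aS oS S0 wS] := tS.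
have cX := mk_constellation cb.
have da := mkK b.
rewrite -da; apply: (proj1 (chamber0_cluster ch cX)).
apply/(stableP); split=> // W; rewrite da => aW W0 WT.
have [->|w0] := wb W aW W0 WT; first exact: cluster_weight ch cla aS S0 oS.
have := near W; have := we _ (map_f _ (mem_enum _ W)) w0; rewrite ltr_norml => h1 /andP[h2 h3].
lra.
Qed.

Lemma pfun_dat l i : pfun (fun X => dat X l i).
Proof.
have pY x y : pfun (fun X => diag_coord X l x y).
  have [p e] : pfun (fun X => \sum_(k : 'I_3) invmx P k l * X k x y).
    by apply: pfun_sum => k; apply: pfun_mul; [apply: pfun_const|apply: pfun_coord].
  by exists p => X; rewrite -e /diag_coord summxE; apply: eq_bigr => k _; rewrite mxE.
have [p e] : pfun (fun X => \sum_y (\sum_x ebase i 0 x * diag_coord X l x y) * edual (st l i) y 0).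
  apply: pfun_sum => y; apply: pfun_mul; last exact: pfun_const.
  by apply: pfun_sum => x; apply: pfun_mul; [apply: pfun_const|apply: pY].
exists p => X; rewrite -e datE mxE; apply: eq_bigr => y _.
by rewrite mxE.
Qed.

Lemma pfun_polyf (f : data I C -> C) : polyf f -> pfun (fun X => f (dat X)).
Proof.
elim=> [k|j i|g h _ Hg _ Hh|g h _ Hg _ Hh].
- exact: pfun_const.
- exact: pfun_dat.
- exact: pfun_add.
- exact: pfun_mul.
Qed.

Lemma polyf_mk j x y : polyf (fun a => mk a j x y).
Proof.
have h : polyf (fun a : data I C => \sum_l P l j * \sum_i a l i * (edual i *m ebase (st l i)) x y).
  apply: polyf_sum => l; apply: polyf_mul; first exact: polyf_const.
  apply: polyf_sum => i; apply: polyf_mul; [exact: polyf_coord|exact: polyf_const].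
apply: (polyf_eq h) => a; rewrite ffunE summxE; apply: eq_bigr => l _.
rewrite [RHS]mxE summxE; congr (_ * _); apply: eq_bigr => i _; by rewrite [RHS]mxE.
Qed.

Lemma polyf_eval p : polyf (fun a => eval p (mk a)).
Proof.
have h : polyf (fun a => \sum_(m <- msupp p) p@_m * \prod_(k < ncoord G)
    (let: (j, x, y) := (enum_val k : 'I_3 * 'I_#|G| * 'I_#|G|) in mk a j x y) ^+ m k).
  apply: polyf_sum => m; apply: polyf_mul; first exact: polyf_const.
  apply: polyf_prod => k; apply: polyf_exp.
  by case: (enum_val k : 'I_3 * 'I_#|G| * 'I_#|G|) => [[j x] y]; apply: polyf_mk.
by apply: (polyf_eq h) => a; rewrite /eval mevalE.
Qed.

Lemma ebase_torus (c : {ffun I -> C}) i : ebase i *m torus_mx c = c i *: ebase i.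
Proof.
rewrite /torus_mx mulmx_sumr (bigD1 i) //= big1 ?addr0 => [|k nk].
  by rewrite -scalemxAr ebase_Wedderburn // eqxx scale1r.
by rewrite -scalemxAr ebase_Wedderburn // (negPf nk) scale0r scaler0.
Qed.

Lemma diag_coord_conj (A B : 'M_#|G|) X X' l : (forall k, X' k = A *m X k *m B) ->
  diag_coord X' l = A *m diag_coord X l *m B.
Proof.
move=> e; rewrite /diag_coord mulmx_sumr mulmx_suml; apply: eq_bigr => k _.
by rewrite e -scalemxAr -scalemxAl.
Qed.

Lemma torus_actE (c : {ffun I -> C}) X : in_torus c -> constellation rG X ->
  torus_act c X = mk (fun l i => (c i)^-1 * c (st l i) * dat X l i).
Proof.
move=> c0 cX; pose c' : {ffun I -> C} := [ffun i => (c i)^-1].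
have TT : torus_mx c *m torus_mx c' = 1%:M.
  apply: (ebase_ext abG (sG := I)) => i.
  rewrite mulmxA ebase_torus -scalemxAl ebase_torus scalerA ffunE mulmx1.
  by rewrite divff ?scale1r //; exact: (c0 i).
have [uT _] := mulmx1_unit TT.
have iT : invmx (torus_mx c) = torus_mx c'.
  by rewrite -[LHS]mulmx1 -TT mulKmx.
apply/ffunP => j; rewrite !(diag_coordK _ j); apply: eq_bigr => l _; congr (_ *: _).
rewrite (@diag_coord_conj (torus_mx c') (torus_mx c) X) => [|k]; last by rewrite ffunE iT.
apply: (ebase_ext abG (sG := I)) => i; rewrite (mk_eigen) !mulmxA ebase_torus.
rewrite -!scalemxAl (dat_eigen l i cX) -scalemxAl ebase_torus !scalerA ffunE.
by congr (_ *: _); rewrite mulrAC.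
Qed.

Lemma stable0_mk a : stable0 rG (mk a) <-> cluster st o a.
Proof.
rewrite (stable0P) (mkK); split=> [[]|ca] //; split=> //.
by apply: (mk_constellation); case: ca.
Qed.

Definition realize (D : data I C -> Prop) X : Prop := stable0 rG X /\ D (dat X).

Lemma realize_mk (D : data I C -> Prop) a : (D a -> cluster st o a) -> realize D (mk a) <-> D a.
Proof.
move=> Dc; rewrite /realize stable0_mk (mkK); split=> [[]|Da] //.
by split=> //; apply: Dc.
Qed.

Lemma zclosed_cluster (D : data I C -> Prop) a : zclosed st o D -> D a -> cluster st o a.
Proof. by case=> -[Q _ h] _ /h[]. Qed.

Lemma mk_dat X : stable0 rG X -> mk (dat X) = X.
Proof. by move/(stable0P) => [cX _]; apply: (datK). Qed.

Lemma closed_realize (D : data I C -> Prop) : zclosed st o D -> Defs.closed rG (realize D).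
Proof.
move=> [[Q Qp QD] Dinv]; split.
  exists (fun p => exists2 f, Q f & forall X, f (dat X) = eval p X) => X; split.
    case=> sX /QD[_ h]; split=> // p [f Qf <-]; exact: h.
  case=> sX h; split=> //; apply/QD.
  split; first by have /(stable0P)[] := sX.
  by move=> f Qf; have [p e] := pfun_polyf (Qp _ Qf); rewrite e; apply: h; exists f.
move=> c X c0 [sX DX]; have [cX clX] := proj1 (stable0P X) sX.
rewrite (torus_actE c0 cX); set b := fun l i => _.
have Db : D b by apply: Dinv DX; exists c.
split; last by rewrite (mkK).
by apply/stable0_mk; apply: zclosed_cluster Db; split=> //; exists Q.
Qed.

Lemma zclosed_mk (A : rep R G -> Prop) : Defs.closed rG A -> zclosed st o (fun a => A (mk a)).
Proof.
move=> [[Q QA] Ainv]; split.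
  exists (fun f => exists2 p, Q p & f = fun a => eval p (mk a)).
    by move=> f [p _ ->]; apply: polyf_eval.
  move=> a; rewrite QA stable0_mk; split=> -[ca h]; split=> //.
    by move=> f [p Qp ->]; apply: h.
  by move=> p Qp; apply: (h (fun a => eval p (mk a))); exists p.
move=> a b [c c0 e] Aa; pose c' : {ffun I -> C} := [ffun i => c i].
have sa : stable0 rG (mk a) by case/QA: Aa.
have [cX _] := proj1 (stable0P _) sa.
have c'0 : in_torus c' by move=> i; rewrite ffunE.
have -> : mk b = torus_act c' (mk a); last exact: Ainv.
rewrite (torus_actE c'0 cX) (mkK); congr (mk _).
by apply/funext => l; apply/funext => i; rewrite !ffunE e.
Qed.

Lemma irreducible_realize (D : data I C -> Prop) : zirreducible st o D -> Defs.irreducible rG (realize D).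
Proof.
move=> [clD [a Da] irD]; have Dcl b := zclosed_cluster clD (a := b).
split; [exact: closed_realize|by exists (mk a); apply/realize_mk => //; apply: Dcl|].
move=> A B cA cB AB; case: (irD _ _ (zclosed_mk cA) (zclosed_mk cB)) => [b Db|h|h].
- by apply: AB; apply/realize_mk => //; apply: Dcl.
- by left=> X [sX DX]; rewrite -(mk_dat sX); apply: h.
by right=> X [sX DX]; rewrite -(mk_dat sX); apply: h.
Qed.

Local Notation arrow := ('I_3 * I)%type.
Local Notation src := (fun a : arrow => a.2).
Local Notation tgt := (fun a : arrow => st a.1 a.2).

Definition arrow_weight n (i : I) : int := flux src tgt (fun e => (n e)%:Z) i.

Lemma arrow_weightE n i : (arrow_weight n i)%:~R = flux src tgt (fun e => (n e)%:R : rat) i.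
Proof.
rewrite /arrow_weight /flux rmorph_sum /=; apply: eq_bigr => a _.
by rewrite rmorphM rmorphB /= !rmorph_nat.
Qed.

Lemma monomial_torus n (c : {ffun I -> C}) X : in_torus c -> constellation rG X ->
  monomial n (dat (torus_act c X)) = (\prod_i c i ^ arrow_weight n i) * monomial n (dat X).
Proof.
move=> c0 cX; rewrite (torus_actE c0 cX) (mkK) /monomial.
rewrite /arrow_weight -prod_gauge // -big_split /=; apply: eq_bigr => a _.
by rewrite exprMn.
Qed.

Lemma pfun_monomial n : pfun (fun X => monomial n (dat X)).
Proof. by apply: pfun_prod => a; apply: pfun_exp; apply: pfun_dat. Qed.

Lemma binomial_section n n' (c : C) : arrow_weight n =1 arrow_weight n' ->
  taut_section rG (arrow_weight n) (fun X => monomial n (dat X) - c * monomial n' (dat X)).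
Proof.
move=> en; split=> [X _|d X d0 sX].
  have [p e] : pfun (fun X => monomial n (dat X) + (- c) * monomial n' (dat X)).
    apply: pfun_add; first exact: pfun_monomial.
    by apply: pfun_mul; [exact: pfun_const|exact: pfun_monomial].
  exists p, 1; split; first by rewrite /eval meval1 oner_neq0.
  by move=> Y _ _; rewrite -e /eval meval1 divr1 mulNr.
have [cX _] := proj1 (stable0P X) sX.
rewrite (monomial_torus n d0 cX) (monomial_torus n' d0 cX) mulrCA.
under eq_bigr => i _ do rewrite en.
by rewrite mulrBr.
Qed.

Lemma contracted_binomial theta0 (D : rep R G -> Prop) X Y m n n' c :
  contracted_to_point rG theta0 D -> D X -> D Y ->
  (forall i, flux src tgt (fun e => (n e)%:R : rat) i = m%:R * theta0 i) ->
  (forall i, flux src tgt (fun e => (n' e)%:R : rat) i = m%:R * theta0 i) ->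
  monomial n (dat X) = c * monomial n' (dat X) ->
  monomial n (dat Y) = c * monomial n' (dat Y).
Proof.
move=> ctr DX DY fn fn' e.
have wE i : (arrow_weight n i)%:~R = theta0 i *+ m :> rat by rewrite arrow_weightE fn mulr_natl.
have en : arrow_weight n =1 arrow_weight n'.
  by move=> i; apply: (@intr_inj rat); rewrite !arrow_weightE fn fn'.
have [h _] := ctr X Y DX DY m (arrow_weight n) wE _ (binomial_section c en).
by apply/eqP; rewrite -subr_eq0; apply/eqP/h; rewrite e subrr.
Qed.

End Moduli.

Theorem corollary1p4 (R : realType) (gT : finGroupType) (G : {group gT})
    (abG : abelian G)
    (rG : mx_representation R[i]%C G 3) (faithG : mx_faithful rG)
    (detG : forall g, g \in G -> \det (rG g) = 1)
    (F : param R G -> Prop) (wallF : wall0 rG F) :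
  ~ typeII rG F.
Proof.
case=> theta0 gen0 [D [[clD [X0 DX0] _] _ nochain] ctr].
have [P uP [psi [psiC PrG]]] := repr_diag abG rG.
pose I := Irr R G; pose st := @mckay _ gT G I psi; pose o := principal_comp I.
pose mk' := @mk R gT G P psi; pose D' (a : data I R[i]%C) := D (mk' a).
have psi1 g : g \in G -> psi lx g * psi ly g * psi lz g = 1.
  by move=> Gg; apply: (psi_prod uP PrG Gg); apply: detG.
have clD' : zclosed st o D' := zclosed_mk abG uP psiC PrG clD.
have D's X : D X -> stable0 rG X by case: clD => -[Q QD] _ /QD[].
have DmkX X : D X -> D' (dat P psi X).
  by move=> DX; rewrite /D' /mk' (mk_dat abG uP psiC PrG) //; apply: D's.
have [th0 wge0 uniq wallc] := wall_data abG uP psiC PrG wallF gen0.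
have [] := @contracted_chain _ _ st o (invariant_lattice G psi)
  (mckay_comm abG psiC) (mckay_inj abG psiC)
  (invariant_latticeP psiC psi1) (mckay_mon abG I psiC) theta0 D' th0 _ wge0 uniq wallc _ _.
- by move=> a; apply: zclosed_cluster clD'.
- move=> a b Da Db m n n' fn fn' c; rewrite -[a](mkK abG psi uP) -[b](mkK abG psi uP).
  exact: contracted_binomial ctr Da Db fn fn'.
- by exists (dat P psi X0); apply: DmkX.
(* The chain contradicts codimension one once it is carried back from quiver data to
   constellations. *)
move=> E1 [E2 [iE1 iE2 [DE1 nED] [E12 nE21]]]; apply: nochain.
have c1 a : E1 a -> cluster st o a by case: iE1 => cl _ _; apply: zclosed_cluster cl.
have c2 a : E2 a -> cluster st o a by case: iE2 => cl _ _; apply: zclosed_cluster cl.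
exists (realize rG P psi E1), (realize rG P psi E2); split.
- exact: irreducible_realize.
- exact: irreducible_realize.
- split=> [X DX|sub]; first by split; [exact: D's|exact/DE1/DmkX].
  by apply: nED => a Ea; apply: sub; apply/(realize_mk abG uP psiC PrG) => //; apply: c1.
split=> [X [sX EX]|sub]; first by split=> //; exact: E12.
apply: nE21 => a Ea; apply/(realize_mk abG uP psiC PrG (D := E1) (a := a)); first exact: c1.
by apply: sub; apply/(realize_mk abG uP psiC PrG) => //; apply: c2.
Qed.
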